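(* For every $\epsilon>0$, it is NP-hard to approximate MDJR within a factor of $\left(\frac{1}{k}\right)^{1-\epsilon}$; that is, unless P = NP there is no polynomial-time algorithm that, on every instance, outputs a size-$k$ committee whose JR degree is at least $\left(\frac{1}{k}\right)^{1-\epsilon}$ times the maximum JR degree.
   Context: An instance consists of voters $N=\{1,\dots,n\}$, candidates $C$, approval ballots $A_i\subseteq C$ for $i\in N$, and a committee size $k$ with $1\le k\le|C|$, and is assumed to have at least one cohesive group, where $N'\subseteq N$ is a cohesive group if $|N'|\ge n/k$ and $|\bigcap_{i\in N'}A_i|\ge1$. A size-$k$ committee $W\subseteq C$ achieves JR degree $c$ if every cohesive group contains at least $c$ voters $i$ with $|A_i\cap W|\ge1$; its JR degree is the largest such $c$. MDJR is the problem of finding a size-$k$ committee of maximum JR degree. *)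

(* Defs.v *)
From Stdlib Require Import Reals.
From mathcomp Require Import all_boot.

(*  1. Machine model: deterministic single-tape Turing machines over   *)
(*     the alphabet {0,1,blank} (blank = None), finitely many states.  *)

Inductive move := MoveL | MoveR | Stay.

Record TM := {
  tm_nq : nat;
  tm_delta : 'I_tm_nq.+1 -> option bool -> 'I_tm_nq.+1 * option bool * move;
  tm_halt : 'I_tm_nq.+1 -> bool
}.

(* tape = (reversed left part, symbol under head, right part) *)
Definition tape := (seq (option bool) * option bool * seq (option bool))%type.
Definition config (M : TM) := ('I_(tm_nq M).+1 * tape)%type.

Definition move_tape (mv : move) (t : tape) : tape :=
  let: (l, a, r) := t in
  match mv with
  | Stay => t
  | MoveL => match l with [::] => ([::], None, a :: r) | b :: l' => (l', b, a :: r) end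
  | MoveR => match r with [::] => (a :: l, None, [::]) | b :: r' => (a :: l, b, r') end
  end.

Definition step (M : TM) (c : config M) : config M :=
  let: (q, (l, a, r)) := c in
  if tm_halt M q then c else
  let: (q', s, mv) := tm_delta M q a in (q', move_tape mv (l, s, r)).

Definition init (M : TM) (x : seq bool) : config M :=
  (ord0, ([::], head None (map Some x), behead (map Some x))).

Fixpoint read_bits (s : seq (option bool)) : seq bool :=
  match s with Some b :: s' => b :: read_bits s' | _ => [::] end.

Definition output (M : TM) (c : config M) : seq bool :=
  let: (_, (_, a, r)) := c in read_bits (a :: r).

Definition runs_within (M : TM) (x : seq bool) (t : nat) (y : seq bool) : Prop :=
  exists2 t', t' <= t &
    tm_halt M (iter t' (@step M) (init M x)).1 /\
    @output M (iter t' (@step M) (init M x)) = y.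

Definition polyb (c d n : nat) : nat := c * n ^ d + c.

Definition inP (L : seq bool -> bool) : Prop :=
  exists M : TM, exists c d : nat,
    forall x, runs_within M x (polyb c d (size x)) [:: L x].

(* self-delimiting pairing of two bit strings *)
Definition pair_enc (x w : seq bool) : seq bool :=
  flatten [seq [:: b; b] | b <- x] ++ [:: false; true] ++ w.

Definition inNP (L : seq bool -> bool) : Prop :=
  exists V : seq bool -> bool, exists c d : nat,
    inP V /\ forall x, L x <-> exists2 w, size w <= polyb c d (size x) & V (pair_enc x w).

Definition P_eq_NP : Prop := forall L, inP L <-> inNP L.

Record instance := {
  nv : nat;
  nc : nat;
  ballot : {ffun 'I_nv -> {set 'I_nc}};
  csize : nat
}.

Section Election.
Variable I : instance.
Local Notation n := (nv I).
Local Notation m := (nc I).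
Local Notation A := (ballot I).
Local Notation k := (csize I).

(* |N'| >= n/k  (written multiplicatively, k >= 1) and |cap_{i in N'} A_i| >= 1 *)
Definition cohesive (G : {set 'I_n}) : bool :=
  (n <= #|G| * k) && [exists c : 'I_m, [forall i in G, c \in A i]].

Definition represented (W : {set 'I_m}) (G : {set 'I_n}) : nat :=
  #|[set i in G | A i :&: W != set0]|.

Definition achieves (W : {set 'I_m}) (c : nat) : bool :=
  [forall G : {set 'I_n}, cohesive G ==> (c <= represented W G)].

(* the largest c achieved (any achieved c is <= n when a cohesive group exists) *)
Definition jr_degree (W : {set 'I_m}) : nat :=
  \max_(c < n.+1 | achieves W c) c.

Definition opt_jr : nat :=
  \max_(W : {set 'I_m} | #|W| == k) jr_degree W.

Definition valid_instance : Prop :=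
  1 <= k <= m /\ exists G : {set 'I_n}, cohesive G.

End Election.

Definition enc_nat (a : nat) : seq bool := nseq a true ++ [:: false].

Definition enc_instance (I : instance) : seq bool :=
  enc_nat (csize I) ++ enc_nat (nv I) ++ enc_nat (nc I) ++
  flatten [seq [seq (j \in ballot I i) | j <- enum 'I_(nc I)] | i <- enum 'I_(nv I)].

Definition dec_committee (m : nat) (y : seq bool) : {set 'I_m} :=
  [set j : 'I_m | nth false y j].

Definition poly_approx_MDJR (eps : R) : Prop :=
  exists M : TM, exists c d : nat,
    forall I : instance, valid_instance I ->
      exists y : seq bool,
        runs_within M (enc_instance I) (polyb c d (size (enc_instance I))) y /\
        size y = nc I /\
        #|dec_committee (nc I) y| = csize I /\
        Rle (Rmult (Rpower (Rdiv 1 (INR (csize I))) (Rminus 1 eps)) (INR (opt_jr I)))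
            (INR (jr_degree I (dec_committee (nc I) y))).

(* Main.v *)
(* Next to a hitting-set core, D dummy candidates share one voter and are otherwise approved by
   s - 1 voters each, where s = n/k.  A committee of degree at least 2 contains all dummies, hence
   has only k - D picks left, and these hit every row of the core; conversely such a hitting set
   gives degree s.  As k exceeds s only by a factor polynomial in the core, taking s to be a large
   power of the size of the core makes s / k^(1 - eps) > 1, so that an approximate solution of the
   instance solves the core.

   The core is a Cook-Levin tableau of an NP verifier V.  Candidates are pairs (cell, letter), and
   counting forces one pick per cell; the clause saying that f(a, b, c) lies below neighbouring
   cells a, b, c becomes a disjunction of candidates, since not picking a means picking another
   letter.  The approximate committee need not be checked: a word is read off it as a witness
   and V is run on it.

   The machines are obtained by compiling stack programs with bounded loops to structured tape
   programs, with the stacks on interleaved tracks, and these to machines. *)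
Require Import Defs.
From Stdlib Require Import Reals ZArith Lia Lra FunctionalExtensionality.
From mathcomp Require Import all_boot zify.
Set Implicit Arguments. Unset Strict Implicit. Unset Printing Implicit Defensive.

(** * Structured tape programs *)

(** The obstacle is that [n / k] has to equal the number [s] of copies of a core row, although the
    core has far more rows than picks. Each dummy adds one pick but only [s - 1] voters, hence gains
    one voter, so making up for the [X] surplus rows takes about [X * s] dummies. Thus [k] is itself
    linear in [s], which is where the exponent [1 - eps] comes from: with [G] just above the core
    size, [e >= 1 / eps] and [s = G ^ e + 1], one has [G <= k ^ eps] and
    [s > k / G >= k ^ (1 - eps)]. In the tableau the rows of the diagram are laid end to end with
    wrap-around. The head never comes near an edge, so no boundary clauses are needed and all
    clauses share one shape. All sizes in the instance depend only on the length of the input and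
    are given by polynomial expressions, so the encoding is printed by nested loops over the input,
    without any arithmetic. [P_eq_NP] is an equality of classes, so the inclusion of P in NP has to
    be proved in this machine model as well. *)

Lemma size_cons T (x : T) s : size (x :: s) = (size s).+1.
Proof. by []. Qed.

Definition sym := option bool.
Definition ftape := Z -> sym.

Definition fupd (f : ftape) (h : Z) (s : sym) : ftape :=
  fun z => if Z.eqb z h then s else f z.

Definition displ (mv : move) : Z :=
  match mv with MoveL => -1 | MoveR => 1 | Stay => 0 end%Z.

(** Programs are analysed on absolute positions instead of the two lists of a configuration; the
    default [None] of [nth] turns everything past the ends of the lists into blanks. *)
Definition represents (t : tape) (f : ftape) (h : Z) : Prop :=
  let: (l, a, r) := t in
  [/\ a = f h, forall i, nth None r i = f (h + 1 + Z.of_nat i)%Z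
    & forall i, nth None l i = f (h - 1 - Z.of_nat i)%Z].

Lemma represents_step t f h s mv : represents t f h ->
  represents (move_tape mv (t.1.1, s, t.2)) (fupd f h s) (h + displ mv)%Z.
Proof.
case: t => [[l a] r] /= [_ Hr Hl]; rewrite /fupd.
have Er z i : z = (h + 1 + Z.of_nat i)%Z -> (if Z.eqb z h then s else f z) = nth None r i.
  by move=> ->; rewrite Hr; case: Z.eqb_spec => //; lia.
have El z i : z = (h - 1 - Z.of_nat i)%Z -> (if Z.eqb z h then s else f z) = nth None l i.
  by move=> ->; rewrite Hl; case: Z.eqb_spec => //; lia.
have E0 z : z = h -> (if Z.eqb z h then s else f z) = s by move=> ->; rewrite Z.eqb_refl.
have nthS (u : seq sym) i : nth None (behead u) i = nth None u i.+1 by rewrite nth_behead.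
case: mv => /=.
- have -> : (match l with [::] => ([::], None, s :: r) | b :: l' => (l', b, s :: r) end)
     = (behead l, nth None l 0, s :: r) by case: (l).
  split=> [|[|i]|i].
  + by rewrite (El _ 0) //; lia.
  + by rewrite /= E0 //; lia.
  + by rewrite /= (Er _ i) //; lia.
  + by rewrite nthS (El _ i.+1) //; lia.
- have -> : (match r with [::] => (s :: l, None, [::]) | b :: r' => (s :: l, b, r') end)
     = (s :: l, nth None r 0, behead r) by case: (r).
  split=> [|i|[|i]].
  + by rewrite (Er _ 0) //; lia.
  + by rewrite nthS (Er _ i.+1) //; lia.
  + by rewrite /= E0 //; lia.
  + by rewrite /= (El _ i) //; lia.
- split=> [|i|i].
  + by rewrite E0 //; lia.
  + by rewrite (Er _ i) //; lia.
  + by rewrite (El _ i) //; lia.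
Qed.

Definition input_tape (x : seq bool) : ftape :=
  fun z => if Z.ltb z 0 then None else onth x (Z.to_nat z).

Lemma nth_map_Some (x : seq bool) i : nth None (map Some x) i = onth x i.
Proof. by elim: x i => [|a x IH] [|i] //=. Qed.

Lemma represents_init (x : seq bool) :
  represents ([::], head None (map Some x), behead (map Some x)) (input_tape x) 0.
Proof.
rewrite /input_tape; split=> [|i|i].
- by case: x.
- rewrite nth_behead nth_map_Some; case: Z.ltb_spec; first lia.
  by move=> _; congr (onth x _); lia.
- by rewrite nth_nil; case: Z.ltb_spec => //; lia.
Qed.

Inductive tprog :=
| TAct of (sym -> sym * move)
| TSeq of tprog & tprog
| TIf of (sym -> bool) & tprog & tprog
| TWhile of (sym -> bool) & tprog.

(** The nat is the exact number of steps of the assembled machine: a test costs one step, and a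
    then-branch or a loop body one more for the jump at its end. *)
Inductive tev : tprog -> ftape -> Z -> nat -> ftape -> Z -> Prop :=
| TEvAct g f h : tev (TAct g) f h 1 (fupd f h (g (f h)).1) (h + displ (g (f h)).2)%Z
| TEvSeq p q n m f h f1 h1 f2 h2 :
    tev p f h n f1 h1 -> tev q f1 h1 m f2 h2 -> tev (TSeq p q) f h (n + m) f2 h2
| TEvThen (c : sym -> bool) p q n f h f1 h1 : c (f h) -> tev p f h n f1 h1 ->
    tev (TIf c p q) f h n.+2 f1 h1
| TEvElse (c : sym -> bool) p q n f h f1 h1 : c (f h) = false -> tev q f h n f1 h1 ->
    tev (TIf c p q) f h n.+1 f1 h1
| TEvExit (c : sym -> bool) p f h : c (f h) = false -> tev (TWhile c p) f h 1 f h
| TEvLoop (c : sym -> bool) p n m f h f1 h1 f2 h2 : c (f h) -> tev p f h n f1 h1 ->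
    tev (TWhile c p) f1 h1 m f2 h2 -> tev (TWhile c p) f h (n + m).+2 f2 h2.

(* The nat is the address of the next instruction. *)
Definition instr := sym -> nat * sym * move.

Definition jump (j : nat) : instr := fun a => (j, a, Stay).

Fixpoint assemble (p : tprog) (s : nat) : seq instr :=
  match p with
  | TAct g => [:: fun a => (s.+1, (g a).1, (g a).2)]
  | TSeq p q => let cp := assemble p s in cp ++ assemble q (s + size cp)
  | TIf c p q =>
      let cp := assemble p s.+1 in
      let cq := assemble q (s + size cp).+2 in
      (fun a => (if c a then s.+1 else (s + size cp).+2, a, Stay)) ::
      cp ++ jump ((s + size cp).+2 + size cq) :: cq
  | TWhile c p =>
      let cp := assemble p s.+1 in
      (fun a => (if c a then s.+1 else (s + size cp).+2, a, Stay)) :: cp ++ [:: jump s]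
  end.

Section Machine.
Variable code : seq instr.

(** The control state is the program counter, and the address just past the code is the halting
    state. *)
Definition machine : TM := {|
  tm_nq := size code;
  tm_delta := fun i a => let: (j, s, mv) := nth (jump 0) code i a in (inord j, s, mv);
  tm_halt := fun i => i == size code :> nat |}.

Definition at_pc (c : config machine) (i : nat) (f : ftape) (h : Z) : Prop :=
  c.1 = i :> nat /\ represents c.2 f h.

Definition reaches (i : nat) f h n (j : nat) f' h' : Prop :=
  forall c, at_pc c i f h -> at_pc (iter n (@step machine) c) j f' h'.

Lemma reaches_trans i j k f h n f1 h1 m f2 h2 :
  reaches i f h n j f1 h1 -> reaches j f1 h1 m k f2 h2 -> reaches i f h (n + m) k f2 h2.
Proof. by move=> A B c /A /B; rewrite addnC iterD. Qed.

Lemma reaches_instr i f h j s mv : i < size code ->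
  nth (jump 0) code i (f h) = (j, s, mv) -> j <= size code ->
  reaches i f h 1 j (fupd f h s) (h + displ mv)%Z.
Proof.
move=> Hi Hn Hj [q [[l a] r]] [Hq R]; rewrite /= in Hq; have /= R' := represents_step s mv R.
have [Ea _ _] : represents (l, a, r) f h := R.
rewrite /at_pc /step /= Hq (ltn_eqF Hi) Ea Hn /=.
by rewrite inordK // ltnS.
Qed.

Lemma fupd_id f h : fupd f h (f h) = f.
Proof. by apply: functional_extensionality => z; rewrite /fupd; case: Z.eqb_spec => // ->. Qed.

Lemma reaches_jump i f h (j : nat) : i < size code ->
  nth (jump 0) code i (f h) = (j, f h, Stay) -> j <= size code ->
  reaches i f h 1 j f h.
Proof.
move=> Hi Hn Hj; have := reaches_instr Hi Hn Hj.
by rewrite fupd_id /displ Z.add_0_r.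
Qed.

(** Addresses are absolute, so the induction has to range over the code before and after the
    fragment, which is assembled for address [size pre]. *)
Lemma assemble_correct p f h n f' h' : tev p f h n f' h' ->
  forall pre post, code = pre ++ assemble p (size pre) ++ post ->
  reaches (size pre) f h n (size pre + size (assemble p (size pre))) f' h'.
Proof.
have nth0 (pre c post : seq instr) x : nth (jump 0) (pre ++ (x :: c) ++ post) (size pre) = x.
  by rewrite nth_cat ltnn subnn.
elim=> {p f h n f' h'}.
- move=> g f h pre post Hc; rewrite /= addn1; apply: reaches_instr.
  + by rewrite Hc !size_cat /=; lia.
  + by rewrite Hc nth0.
  + by rewrite Hc !size_cat /=; lia.
- move=> p q n m f h f1 h1 f2 h2 _ IHp _ IHq pre post /=.
  set cp := assemble p _; set cq := assemble q _; move=> Hc.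
  have Hp : code = pre ++ cp ++ (cq ++ post) by rewrite Hc -!catA.
  have Hq : code = (pre ++ cp) ++ assemble q (size (pre ++ cp)) ++ post.
    by rewrite size_cat Hc -!catA.
  apply: reaches_trans (IHp _ _ Hp) _.
  by have := IHq _ _ Hq; rewrite size_cat -/cp -/cq -addnA size_cat.
- move=> c p q n f h f1 h1 Hcf _ IHp pre post /=.
  set cp := assemble p _; set cq := assemble q _ => Hc.
  set br := fun a => _ in Hc.
  have Hp : code = (pre ++ [:: br]) ++ assemble p (size (pre ++ [:: br])) ++
      ((jump ((size pre + size cp).+2 + size cq) :: cq) ++ post).
    by rewrite size_cat addn1 Hc -!catA /= -?catA.
  have Sz : size code = size pre + (size cp + (size cq + size post).+1).+1.
    by rewrite Hc !(size_cat, size_cons) /=; lia.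
  have -> : n.+2 = 1 + (n + 1) by lia.
  apply: (@reaches_trans _ (size pre).+1 _ _ _ _ f h).
    by apply: reaches_jump; [lia | rewrite Hc nth0 /br Hcf | lia].
  have := IHp _ _ Hp; rewrite size_cat !addn1 -/cp => Hr.
  rewrite -(addn1 n); apply: reaches_trans Hr _.
  apply: reaches_jump; [lia | | rewrite size_cat /=; lia].
  rewrite Hp size_cat addn1 catA nth_cat !size_cat /= -/cp !addn1 addSn ltnn subnn /jump.
  by rewrite /=; congr (_, _, _); lia.
- move=> c p q n f h f1 h1 Hcf _ IHq pre post /=.
  set cp := assemble p _; set cq := assemble q _ => Hc.
  set br := fun a => _ in Hc.
  set pre' := pre ++ br :: cp ++ [:: jump ((size pre + size cp).+2 + size cq)].
  have Spre : size pre' = (size pre + size cp).+2 by rewrite !(size_cat, size_cons) /=; lia.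
  have Hq : code = pre' ++ assemble q (size pre') ++ post.
    by rewrite Spre -/cq Hc -!catA /= -?catA.
  have Sz : size code = size pre + (size cp + (size cq + size post).+1).+1.
    by rewrite Hc !(size_cat, size_cons) /=; lia.
  rewrite -add1n.
  apply: (@reaches_trans _ (size pre + size cp).+2 _ _ _ _ f h).
    by apply: reaches_jump; [lia | rewrite Hc nth0 /br Hcf | lia].
  have := IHq _ _ Hq; rewrite Spre -/cq.
  by congr (reaches _ _ _ _ _ _ _); rewrite size_cat /=; lia.
- move=> c p f h Hcf pre post /=; set cp := assemble p _ => Hc.
  have Sz : size code = size pre + (size cp + (size post).+1).+1.
    by rewrite Hc !(size_cat, size_cons) /=; lia.
  have -> : size pre + (size (cp ++ [:: jump (size pre)])).+1 = (size pre + size cp).+2.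
    by rewrite size_cat /=; lia.
  by apply: reaches_jump; [lia | rewrite Hc nth0 Hcf | lia].
- move=> c p n m f h f1 h1 f2 h2 Hcf _ IHp _ IHw pre post Hc.
  have {}IHw := IHw _ _ Hc; move: Hc; rewrite /=.
  set cp := assemble p _ => Hc; set br := fun a => _ in Hc.
  have Sz : size code = size pre + (size cp + (size post).+1).+1.
    by rewrite Hc !(size_cat, size_cons) /=; lia.
  have Hp : code = (pre ++ [:: br]) ++ assemble p (size (pre ++ [:: br])) ++
      ([:: jump (size pre)] ++ post).
    by rewrite size_cat addn1 Hc -!catA /= -?catA.
  have -> : (n + m).+2 = 1 + (n + (1 + m)) by lia.
  apply: (@reaches_trans _ (size pre).+1 _ _ _ _ f h).
    by apply: reaches_jump; [lia | rewrite Hc nth0 /br Hcf | lia].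
  have := IHp _ _ Hp; rewrite size_cat !addn1 -/cp => Hr.
  apply: reaches_trans Hr _.
  apply: (@reaches_trans _ (size pre) _ _ _ _ f1 h1) IHw.
  apply: reaches_jump; [lia | | lia].
  by rewrite Hp size_cat addn1 catA nth_cat !size_cat /= -/cp !addn1 addSn ltnn subnn.
Qed.

End Machine.

(** The blank to the right of the head stops [read_bits] after a single bit. *)
Lemma machine_run (p : tprog) (x : seq bool) n f h b :
  tev p (input_tape x) 0 n f h -> f h = Some b -> f (h + 1)%Z = None ->
  runs_within (machine (assemble p 0)) x n [:: b].
Proof.
move=> E Hb Hn; exists n => //.
have Hc : assemble p 0 = [::] ++ assemble p (size (Nil instr)) ++ [::] by rewrite cats0.
have := assemble_correct E Hc; move/(_ (init _ x)); case.
  by split; [| exact: represents_init].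
move: (iter n _ _) => [q [[l a] r]] /= -> [-> Hr _]; split=> //.
by rewrite Hb; move: (Hr 0); rewrite Z.add_0_r Hn; case: (r) => [|[]] //= ? ? ->.
Qed.

(** * Stacks on interleaved tracks *)

Definition trun p f h N f' h' : Prop := exists2 n, n <= N & tev p f h n f' h'.

Lemma trun_weaken p f h N N' f' h' :
  trun p f h N f' h' -> N <= N' -> trun p f h N' f' h'.
Proof. by case=> n Hn E HN; exists n => //; apply: leq_trans HN. Qed.

Lemma trun_seq p q f h N M f1 h1 f2 h2 :
  trun p f h N f1 h1 -> trun q f1 h1 M f2 h2 -> trun (TSeq p q) f h (N + M) f2 h2.
Proof. by case=> n Hn E [m Hm E']; exists (n + m); [exact: leq_add | exact: TEvSeq E E']. Qed.

Lemma trun_then (c : sym -> bool) p q f h N f' h' :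
  c (f h) -> trun p f h N f' h' -> trun (TIf c p q) f h N.+2 f' h'.
Proof. by move=> Hc [n Hn E]; exists n.+2 => //; apply: TEvThen. Qed.

Lemma trun_else (c : sym -> bool) p q f h N f' h' :
  c (f h) = false -> trun q f h N f' h' -> trun (TIf c p q) f h N.+2 f' h'.
Proof. by move=> Hc [n Hn E]; exists n.+1; [exact: leqW | apply: TEvElse]. Qed.

Arguments trun_then {c p q f h N f' h'}.
Arguments trun_else {c p q f h N f' h'}.

Lemma trun_exit (c : sym -> bool) p f h : c (f h) = false -> trun (TWhile c p) f h 1 f h.
Proof. by move=> Hc; exists 1 => //; apply: TEvExit. Qed.

Lemma trun_loop (c : sym -> bool) p f h N M f1 h1 f2 h2 : c (f h) ->
  trun p f h N f1 h1 -> trun (TWhile c p) f1 h1 M f2 h2 ->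
  trun (TWhile c p) f h (N + M).+2 f2 h2.
Proof.
move=> Hc [n Hn E] [m Hm E']; exists (n + m).+2; last exact: TEvLoop Hc E E'.
by rewrite !ltnS leq_add.
Qed.

Definition twrite (s : sym) : tprog := TAct (fun=> (s, Stay)).
Definition tmove (mv : move) (n : nat) : tprog :=
  iter n (TSeq (TAct (fun a => (a, mv)))) (TAct (fun a => (a, Stay))).

Lemma trun_write s f h : trun (twrite s) f h 1 (fupd f h s) h.
Proof.
exists 1 => //; have := TEvAct (fun=> (s, Stay)) f h.
by rewrite /= Z.add_0_r.
Qed.

Lemma trun_move mv n f h h' : h' = (h + Z.of_nat n * displ mv)%Z ->
  trun (tmove mv n) f h n.+1 f h'.
Proof.
move=> ->; exists n.+1 => //.
elim: n h => [|n IH] h.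
  have := TEvAct (fun a => (a, Stay)) f h.
  by rewrite /= fupd_id Z.add_0_r.
have E := TEvAct (fun a => (a, mv)) f h; rewrite /= fupd_id in E.
rewrite -(add1n n.+1); apply: TEvSeq E _.
have -> : (h + Z.of_nat n.+1 * displ mv = h + displ mv + Z.of_nat n * displ mv)%Z by lia.
exact: IH.
Qed.

Section Tracks.
Variable K : nat.

(* Cell i of track t; the tracks are interleaved and grow to the left of the input.  Track 0 is
   the return path: its cell 0 holds Some false, the cells passed by the head hold Some true. *)
Definition cell_pos (i t : nat) : Z := (- 2 - Z.of_nat (i * K + t))%Z.

(** Position [-1] belongs to no track: it stays a blank separator between the tracks and the
    input. *)
Definition home : Z := (-2)%Z.

Lemma cell_pos00 : cell_pos 0 0 = home. Proof. by []. Qed.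

Lemma cell_pos_inj i t j u : t < K -> u < K -> (cell_pos i t =? cell_pos j u)%Z = (i == j) && (t == u).
Proof.
move=> Ht Hu; apply/idP/idP => [/Z.eqb_eq E|/andP[/eqP-> /eqP->]]; last exact: Z.eqb_refl.
have {}E : i * K + t = j * K + u by rewrite /cell_pos in E; lia.
have K0 : 0 < K by lia.
have -> : i = j.
  by have := congr1 (divn^~ K) E; rewrite !divnMDl // !divn_small // !addn0.
rewrite eqxx /=.
by have := congr1 (modn^~ K) E; rewrite !modnMDl !modn_small // => ->.
Qed.

Lemma cell_pos_le i t : (cell_pos i t <= -2)%Z.
Proof. rewrite /cell_pos; lia. Qed.

Lemma cell_pos_home i t : t < K -> (cell_pos i t =? home)%Z = (i == 0) && (t == 0).
Proof. by move=> Ht; rewrite -cell_pos00 cell_pos_inj //; lia. Qed.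

Lemma fupd_cell f i t s j u : t < K -> u < K ->
  fupd f (cell_pos i t) s (cell_pos j u) = if (j == i) && (u == t) then s else f (cell_pos j u).
Proof. by move=> Ht Hu; rewrite /fupd cell_pos_inj. Qed.

Lemma fupd_right f i t s z : (-2 < z)%Z -> fupd f (cell_pos i t) s z = f z.
Proof. by move=> Hz; rewrite /fupd; case: Z.eqb_spec => // E; have := @cell_pos_le i t; lia. Qed.

(** Stack [v] occupies track [v.+1], bottom first, so that a push or a pop changes only the free end
    of the track. *)
Definition lay (S : nat -> seq bool) (f : ftape) : Prop :=
  f home = Some false /\ forall i v, v.+1 < K -> f (cell_pos i v.+1) = onth (rev (S v)) i.

Definition right_eq (f f' : ftape) : Prop := forall z, (-2 < z)%Z -> f' z = f z.

Lemma right_eq_trans f g h : right_eq f g -> right_eq g h -> right_eq f h.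
Proof. by move=> A B z Hz; rewrite B // A. Qed.

Definition marked (f : ftape) (n : nat) : Prop :=
  forall j, 0 < j <= n -> f (cell_pos j 0) = Some true.

Definition hop (t : nat) : tprog :=
  TSeq (tmove MoveL (K - t)) (TSeq (twrite (Some true)) (tmove MoveL t)).

Definition scan (t : nat) : tprog := TWhile isSome (hop t).

Definition return_home (t : nat) : tprog :=
  TSeq (tmove MoveR t) (TWhile (fun a => a != Some false) (tmove MoveR K)).

Lemma trun_hop f i t : t <= K ->
  trun (hop t) f (cell_pos i t) (K + 3) (fupd f (cell_pos i.+1 0) (Some true)) (cell_pos i.+1 t).
Proof.
move=> Ht; apply: trun_weaken.
  apply: trun_seq (trun_move (h' := cell_pos i.+1 0) _ _) _; first by rewrite /cell_pos /displ; lia.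
  apply: trun_seq (trun_write _ _ _) (trun_move _ _).
  by rewrite /cell_pos /displ; lia.
lia.
Qed.

Lemma trun_return f n t : 0 < K -> f home = Some false -> marked f n ->
  trun (return_home t) f (cell_pos n t) (t + n * (K + 3) + 2) f home.
Proof.
move=> K0 Hh Hm; have -> : t + n * (K + 3) + 2 = t.+1 + (n * (K + 3)).+1 by lia.
apply: trun_seq (trun_move (h' := cell_pos n 0) _ _) _; first by rewrite /cell_pos /displ; lia.
elim: n Hm => [|n IH] Hm; first by apply: trun_exit; rewrite Hh.
have -> : (n.+1 * (K + 3)).+1 = (K.+1 + (n * (K + 3)).+1).+2 by lia.
apply: (@trun_loop _ _ _ _ _ _ f (cell_pos n 0)).
- by rewrite Hm // ltnSn.
- by apply: trun_move; rewrite /cell_pos /displ; lia.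
- by apply: IH => j /andP[j0 jn]; apply: Hm; rewrite j0 leqW.
Qed.

Definition unmarked_eq (f f' : ftape) : Prop :=
  [/\ f' home = f home, right_eq f f' &
      forall i t, 0 < t < K -> f' (cell_pos i t) = f (cell_pos i t)].

Lemma unmarked_eq_trans f g h : unmarked_eq f g -> unmarked_eq g h -> unmarked_eq f h.
Proof.
case=> A B C [A' B' C']; split; first by rewrite A'.
  exact: right_eq_trans B B'.
by move=> i t Ht; rewrite C' // C.
Qed.

Lemma unmarked_mark f i : 0 < K -> unmarked_eq f (fupd f (cell_pos i.+1 0) (Some true)).
Proof.
move=> K0; split.
- by rewrite -cell_pos00 fupd_cell.
- by move=> z Hz; rewrite fupd_right.
- by move=> j t /andP[t0 tK]; rewrite fupd_cell // (gtn_eqF t0) andbF.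
Qed.

Lemma marked_mark f i : 0 < K -> marked f i -> marked (fupd f (cell_pos i.+1 0) (Some true)) i.+1.
Proof.
move=> K0 Hm j Hj; rewrite fupd_cell // andbT; case: eqP => // Hji.
by apply: Hm; lia.
Qed.

Lemma trun_scan t n i f : 0 < t < K -> marked f i ->
  (forall j, i <= j < i + n -> isSome (f (cell_pos j t))) -> f (cell_pos (i + n) t) = None ->
  exists f', [/\ trun (scan t) f (cell_pos i t) (n * (K + 5)).+1 f' (cell_pos (i + n) t),
    unmarked_eq f f' & marked f' (i + n)].
Proof.
move=> Ht; have K0 : 0 < K by lia.
elim: n i f => [|n IH] i f Hm Hs Hn.
  by rewrite addn0 in Hn *; exists f; split=> //; apply: trun_exit; rewrite Hn.
have U := unmarked_mark f i K0.
have [_ _ Ut] := U.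
case: (IH i.+1 (fupd f (cell_pos i.+1 0) (Some true))).
- exact: marked_mark.
- by move=> j Hj; rewrite Ut //; apply: Hs; lia.
- by rewrite Ut // addSnnS.
move=> f' [T U' M]; exists f'; rewrite addSnnS in T M; split=> //; last exact: unmarked_eq_trans U U'.
have -> : (n.+1 * (K + 5)).+1 = (K + 3 + (n * (K + 5)).+1).+2 by lia.
apply: trun_loop T; first by apply: Hs; lia.
by apply: trun_hop; lia.
Qed.

Definition fset (S : nat -> seq bool) v s : nat -> seq bool :=
  fun w => if w == v then s else S w.

Lemma isSome_onth (s : seq bool) i : isSome (onth s i) = (i < size s).
Proof. by elim: s i => [|a s IH] [|i] //=. Qed.

Lemma onth_rcons (s : seq bool) b i :
  onth (rcons s b) i = if i == size s then Some b else onth s i.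
Proof. by elim: s i => [|a s IH] [|i] //=; case: i. Qed.

Lemma lay_unmarked S f f' : lay S f -> unmarked_eq f f' -> lay S f'.
Proof. by case=> H0 H [E0 _ E]; split=> [|i v Hv]; [rewrite E0|rewrite E // H]. Qed.

Lemma unmarked_right f f' : unmarked_eq f f' -> right_eq f f'.
Proof. by case. Qed.

Lemma lay_write S f v i a s : v.+1 < K -> lay S f ->
  (forall j, onth (rev s) j = if j == i then a else onth (rev (S v)) j) ->
  lay (fset S v s) (fupd f (cell_pos i v.+1) a).
Proof.
move=> Hv [H0 H] Hs; split; first by rewrite -cell_pos00 fupd_cell ?andbF //; lia.
move=> j w Hw; rewrite fupd_cell // eqSS /fset; case: (w =P v) => [->|_]; last by rewrite andbF H.
by rewrite andbT Hs H.
Qed.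

Lemma right_write f i t a : right_eq f (fupd f (cell_pos i t) a).
Proof. by move=> z Hz; rewrite fupd_right. Qed.

Lemma scan_top S f v : v.+1 < K -> lay S f ->
  exists f', [/\ trun (TSeq (tmove MoveL v.+1) (scan v.+1)) f home
                   (v.+2 + (size (S v) * (K + 5)).+1) f' (cell_pos (size (S v)) v.+1),
    lay S f', right_eq f f' & marked f' (size (S v))].
Proof.
move=> Hv L; have [H0 H] := L.
case: (@trun_scan v.+1 (size (S v)) 0 f) => //.
- by move=> j /=; lia.
- by move=> j Hj; rewrite H // isSome_onth size_rev; lia.
- by have := isSome_onth (rev (S v)) (size (S v)); rewrite H // size_rev ltnn; case: onth.
move=> f' [T U M]; exists f'; split=> //; last exact: unmarked_right.
  apply: trun_seq T; apply: trun_move; rewrite /cell_pos /home /displ; lia.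
exact: lay_unmarked U.
Qed.

(** Per cell a scan costs [K + 5], a copying pass [K + 10] and the return [K + 3]. The constant also
    absorbs the fixed moves, so that a push, pop or copy costs at most [unit_cost] times the size of
    the stack plus one. *)
Definition unit_cost : nat := 4 * K + 30.

Definition push_prog v b : tprog :=
  TSeq (TSeq (tmove MoveL v.+1) (scan v.+1)) (TSeq (twrite (Some b)) (return_home v.+1)).

(** After the test for emptiness the head goes back to [home] before scanning, so that [scan_top],
    which starts there, can be reused. *)
Definition pop_prog v : tprog :=
  TSeq (tmove MoveL v.+1)
    (TIf isSome
      (TSeq (TSeq (tmove MoveR v.+1) (TSeq (tmove MoveL v.+1) (scan v.+1)))
        (TSeq (tmove MoveR K) (TSeq (twrite None) (return_home v.+1))))
      (tmove MoveR v.+1)).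

Definition test_prog v (pe p0 p1 : tprog) : tprog :=
  TSeq (tmove MoveL v.+1)
    (TIf isSome
      (TSeq (TSeq (tmove MoveR v.+1) (TSeq (tmove MoveL v.+1) (scan v.+1)))
        (TSeq (tmove MoveR K)
          (TIf (fun a => a == Some true)
            (TSeq (return_home v.+1) p1) (TSeq (return_home v.+1) p0))))
      (TSeq (tmove MoveR v.+1) pe)).

Lemma marked_write f n i t a : 0 < t < K -> marked f n -> marked (fupd f (cell_pos i t) a) n.
Proof.
move=> Ht Hm j Hj; rewrite fupd_cell; [|lia|lia].
by have -> : (0 == t) = false by [lia]; rewrite andbF Hm.
Qed.

Lemma trun_left f v : trun (tmove MoveL v.+1) f home v.+2 f (cell_pos 0 v.+1).
Proof. by apply: trun_move; rewrite /cell_pos /home /displ; lia. Qed.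

Lemma trun_right f v : trun (tmove MoveR v.+1) f (cell_pos 0 v.+1) v.+2 f home.
Proof. by apply: trun_move; rewrite /cell_pos /home /displ; lia. Qed.

Lemma trun_rightK f n t : trun (tmove MoveR K) f (cell_pos n.+1 t) K.+1 f (cell_pos n t).
Proof. by apply: trun_move; rewrite /cell_pos /displ; lia. Qed.

Lemma lay_home S f : lay S f -> f home = Some false. Proof. by case. Qed.

Lemma lay_top S f v : v.+1 < K -> lay S f -> isSome (f (cell_pos 0 v.+1)) = (S v != [::]).
Proof. by move=> Hv [_ ->] //; rewrite isSome_onth size_rev lt0n size_eq0. Qed.

Lemma run_push S f v b : v.+1 < K -> lay S f ->
  exists f', [/\ trun (push_prog v b) f home (unit_cost * (size (S v)).+1) f' home,
    lay (fset S v (b :: S v)) f' & right_eq f f'].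
Proof.
move=> Hv L; have [f1 [T L1 R1 M1]] := scan_top Hv L.
set n := size (S v) in T M1 *; set f2 := fupd f1 (cell_pos n v.+1) (Some b).
have L2 : lay (fset S v (b :: S v)) f2.
  apply: lay_write => // j; rewrite rev_cons onth_rcons size_rev -/n.
  by case: eqP.
exists f2; split=> //; last exact: right_eq_trans R1 (right_write _ _ _ _).
apply: trun_weaken.
  apply: trun_seq T _; apply: trun_seq (trun_write _ _ _) _.
  apply: trun_return; [lia | exact: lay_home L2 | by apply: marked_write => //; lia].
rewrite /unit_cost; nia.
Qed.

Lemma scan_last S f v b s : v.+1 < K -> lay S f -> S v = b :: s ->
  exists f', [/\ trun (TSeq (tmove MoveR v.+1) (TSeq (tmove MoveL v.+1) (scan v.+1))) f
                   (cell_pos 0 v.+1) (2 * v.+2 + ((size s).+1 * (K + 5)).+1) f' (cell_pos (size s).+1 v.+1),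
    lay S f', right_eq f f', marked f' (size s).+1 & f' (cell_pos (size s) v.+1) = Some b].
Proof.
move=> Hv L E; have [f1 [T L1 R1 M1]] := scan_top Hv L; rewrite E /= in T M1.
exists f1; split=> //.
  apply: trun_weaken; first by apply: trun_seq T; exact: trun_right.
  lia.
by case: L1 => _ -> //; rewrite E rev_cons onth_rcons size_rev eqxx.
Qed.

Lemma run_pop S f v : v.+1 < K -> lay S f ->
  exists f', [/\ trun (pop_prog v) f home (unit_cost * (size (S v)).+1) f' home,
    lay (fset S v (behead (S v))) f' & right_eq f f'].
Proof.
move=> Hv L; case E: (S v) => [|b s].
  exists f; split=> //.
    apply: trun_weaken.
      apply: trun_seq (trun_left _ _) (trun_else _ (trun_right _ _)).
      by rewrite (lay_top Hv L) E.
    rewrite /unit_cost; nia.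
  by case: L => H0 H; split=> // i w Hw; rewrite /fset; case: eqP => [->|_]; rewrite H // E.
have [f1 [T L1 R1 M1 B1]] := scan_last Hv L E.
set f2 := fupd f1 (cell_pos (size s) v.+1) None.
have L2 : lay (fset S v s) f2.
  apply: lay_write => // j; rewrite E rev_cons onth_rcons size_rev.
  case: eqP => // ->; have := isSome_onth (rev s) (size s).
  by rewrite size_rev ltnn; case: onth.
exists f2; split=> //; last exact: right_eq_trans R1 (right_write _ _ _ _).
apply: trun_weaken.
  apply: trun_seq (trun_left _ _) (trun_then _ _); first by rewrite (lay_top Hv L) E.
  apply: trun_seq T _; apply: trun_seq (trun_rightK _ _ _) _.
  apply: trun_seq (trun_write _ _ _) _.
  apply: trun_return; [lia | exact: lay_home L2 |].
  by apply: marked_write => [|j Hj]; [lia | apply: M1; lia].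
rewrite /unit_cost /=; nia.
Qed.

(** The branch is treated as a continuation: its run from [f1], the tape after the scan, is a
    premise. This separates the head moves from the induction on branches in [compile_correct]. *)
Lemma run_test S f v pe p0 p1 : v.+1 < K -> lay S f ->
  exists f1, [/\ lay S f1, right_eq f f1 & forall N f',
    trun (match S v with [::] => pe | b :: _ => if b then p1 else p0 end) f1 home N f' home ->
    trun (test_prog v pe p0 p1) f home (unit_cost * (size (S v)).+1 + N) f' home].
Proof.
move=> Hv L; case E: (S v) => [|b s].
  exists f; split=> // N f' T.
  apply: trun_weaken.
    apply: trun_seq (trun_left _ _) (trun_else _ (trun_seq (trun_right _ _) T)).
    by rewrite (lay_top Hv L) E.
  rewrite /unit_cost /=; nia.
have [f1 [T L1 R1 M1 B1]] := scan_last Hv L E.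
exists f1; split=> // N f' T'.
have Tr : trun (return_home v.+1) f1 (cell_pos (size s) v.+1) (v.+1 + size s * (K + 3) + 2) f1 home.
  apply: trun_return; [lia | exact: lay_home L1 | by move=> j Hj; apply: M1; lia].
apply: trun_weaken.
  apply: trun_seq (trun_left _ _) (trun_then _ _); first by rewrite (lay_top Hv L) E.
  apply: trun_seq T _; apply: trun_seq (trun_rightK _ _ _) _.
  case: b {E} T' B1 => T' B1.
    by apply: trun_then (trun_seq Tr T'); rewrite B1.
  by apply: trun_else (trun_seq Tr T'); rewrite B1.
rewrite /unit_cost /=; nia.
Qed.

(** Sets up a loop counter: the length of stack [v] is written in unary on track [h.+1] in the same
    pass that lays the return path. *)
Definition copy_prog v h : tprog :=
  TSeq (tmove MoveL v.+1)
    (TSeq (TWhile isSome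
      (TSeq (tmove MoveL (h - v)) (TSeq (twrite (Some true))
        (TSeq (tmove MoveL (K - h.+1)) (TSeq (twrite (Some true)) (tmove MoveL v.+1))))))
      (return_home v.+1)).

Lemma rev_nseq T n (x : T) : rev (nseq n x) = nseq n x.
Proof.
elim: n => // n IH; rewrite [nseq n.+1 x]/= rev_cons IH.
by elim: n {IH} => //= n ->.
Qed.

Lemma onth_nseq n i : onth (nseq n true) i = if i < n then Some true else None.
Proof. by elim: n i => [|n IH] [|i] //=; rewrite IH ltnS. Qed.

Lemma run_copy S f v h : v < h -> h.+1 < K -> lay S f -> S h = [::] ->
  exists f', [/\ trun (copy_prog v h) f home (unit_cost * (size (S v)).+1) f' home,
    lay (fset S h (nseq (size (S v)) true)) f' & right_eq f f'].
Proof.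
move=> Hvh Hh L Sh; rewrite /copy_prog; set n := size (S v); set body := TSeq (tmove MoveL (h - v)) _.
have loop m i f1 : i + m = n -> marked f1 i -> lay (fset S h (nseq i true)) f1 -> right_eq f f1 ->
    exists f', [/\ trun (TWhile isSome body) f1 (cell_pos i v.+1) (m * (K + 10)).+1 f' (cell_pos n v.+1),
      marked f' n, lay (fset S h (nseq n true)) f' & right_eq f f'].
  elim: m i f1 => [|m IH] i f1 Hi Mi Li Ri.
    rewrite addn0 in Hi; subst i; exists f1; split=> //.
    apply: trun_exit; case: Li => _ ->; last by lia.
    by rewrite /fset (ltn_eqF Hvh) isSome_onth size_rev ltnn.
  set f2 := fupd f1 (cell_pos i h.+1) (Some true).
  have L2 : lay (fset S h (nseq i.+1 true)) f2.
    have := @lay_write (fset S h (nseq i true)) f1 h i (Some true) (nseq i.+1 true) Hh Li.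
    case.
      move=> j; rewrite /fset eqxx !rev_nseq !onth_nseq ltnS leq_eqVlt.
      by case: eqP.
    move=> H0 H; split=> // j w Hw; rewrite /f2 H // /fset.
    by case: eqP.
  have U := unmarked_mark f2 i (ltn_trans (ltn0Sn _) Hh).
  case: (IH i.+1 (fupd f2 (cell_pos i.+1 0) (Some true))).
  - by rewrite addSnnS.
  - by apply: marked_mark; [lia | apply: marked_write => //; lia].
  - exact: lay_unmarked U.
  - by apply: right_eq_trans (unmarked_right U); apply: right_eq_trans Ri (right_write _ _ _ _).
  move=> f' [T M' L' R']; exists f'; split=> //.
  have -> : (m.+1 * (K + 10)).+1 = (K + 8 + (m * (K + 10)).+1).+2 by lia.
  apply: trun_loop T.
    by case: Li => _ ->; [rewrite /fset (ltn_eqF Hvh) isSome_onth size_rev|]; lia.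
  apply: trun_weaken.
    apply: trun_seq (trun_move (h' := cell_pos i h.+1) _ _) _; first by rewrite /cell_pos /displ; lia.
    apply: trun_seq (trun_write _ _ _) _.
    apply: trun_seq (trun_move (h' := cell_pos i.+1 0) _ _) _; first by rewrite /cell_pos /displ; lia.
    apply: trun_seq (trun_write _ _ _) (trun_move _ _).
    by rewrite /cell_pos /displ; lia.
  lia.
case: (loop n 0 f) => //.
- by move=> j; lia.
- by case: L => H0 H; split=> // i w Hw; rewrite /fset; case: eqP => [->|_]; rewrite H // Sh.
move=> f' [T M L' R]; exists f'; split=> //.
apply: trun_weaken.
  apply: trun_seq (trun_left _ _) (trun_seq T (trun_return _ _ _ _)) => //; first lia.
  exact: lay_home L'.
rewrite /unit_cost; nia.
Qed.

End Tracks.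

(** * Stack programs *)

(** The only loop is [For], whose number of rounds is the length of a register on entry. Execution
    and cost are therefore total functions of the state, and the body may freely modify that
    register. *)
Inductive cmd :=
| Skip
| Push of nat & bool
| Pop of nat
| Test of nat & cmd & cmd & cmd
| For of nat & cmd
| Seq of cmd & cmd.

Declare Scope cmd_scope.
Delimit Scope cmd_scope with cmd.
Bind Scope cmd_scope with cmd.
Notation "a ;; b" := (Seq a b) (at level 96, right associativity) : cmd_scope.
Local Open Scope cmd_scope.

Definition state := seq (seq bool).

Notation reg st v := (nth [::] st v).
Notation upd st v s := (set_nth [::] st v s).

Fixpoint exec (c : cmd) (st : state) : state :=
  match c with
  | Skip => st
  | Push v b => upd st v (b :: reg st v)
  | Pop v => upd st v (behead (reg st v))
  | Test v ce c0 c1 =>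
      match reg st v with
      | [::] => exec ce st
      | b :: _ => if b then exec c1 st else exec c0 st
      end
  | For v c => iter (size (reg st v)) (exec c) st
  | Seq c1 c2 => exec c2 (exec c1 st)
  end.

Fixpoint cost (c : cmd) (st : state) : nat :=
  match c with
  | Skip | Push _ _ | Pop _ => 1
  | Test v ce c0 c1 =>
      (match reg st v with
      | [::] => cost ce st
      | b :: _ => if b then cost c1 st else cost c0 st
      end).+1
  | For v c => (\sum_(i < size (reg st v)) (cost c (iter i (exec c) st)).+1).+2
  | Seq c1 c2 => cost c1 st + cost c2 (exec c1 st)
  end.

Fixpoint regs (c : cmd) : nat :=
  match c with
  | Skip => 0
  | Push v _ | Pop v => v.+1
  | Test v ce c0 c1 => maxn v.+1 (maxn (regs ce) (maxn (regs c0) (regs c1)))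
  | For v c => maxn v.+1 (regs c)
  | Seq c1 c2 => maxn (regs c1) (regs c2)
  end.

Fixpoint depth (c : cmd) : nat :=
  match c with
  | Skip | Push _ _ | Pop _ => 0
  | Test _ ce c0 c1 => maxn (depth ce) (maxn (depth c0) (depth c1))
  | For _ c => (depth c).+1
  | Seq c1 c2 => maxn (depth c1) (depth c2)
  end.

Lemma size_iter_exec (c : cmd) st v n :
  (forall st v, size (reg (exec c st) v) <= size (reg st v) + cost c st) ->
  size (reg (iter n (exec c) st) v)
    <= size (reg st v) + \sum_(i < n) cost c (iter i (exec c) st).
Proof.
move=> H; elim: n => [|n IH]; first by rewrite big_ord0 addn0.
by rewrite big_ord_recr addnA /=; apply: leq_trans (H _ _) _; rewrite leq_add2r.
Qed.

(** Only a push lengthens a register, and it costs one. Bounds on the cost thus double as bounds on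
    register sizes, here and in the analysis of the solver. *)
Lemma size_exec c st v : size (reg (exec c st) v) <= size (reg st v) + cost c st.
Proof.
elim: c st v => [|w b|w|w ce IHe c0 IH0 c1 IH1|w c IH|c1 IH1 c2 IH2] st v /=.
- by rewrite leq_addr.
- by rewrite nth_set_nth /=; case: eqP => [->|_]; rewrite /=; lia.
- by rewrite nth_set_nth /=; case: eqP => [->|_]; rewrite ?size_behead; lia.
- by rewrite addnS; apply: leqW; case: (reg st w) => [|[]].
- apply: leq_trans (size_iter_exec _ _ _ IH) _.
  by rewrite leq_add2l; do 2!apply: leqW; apply: leq_sum => i _.
- by apply: leq_trans (IH2 _ _) _; rewrite addnA leq_add2r.
Qed.

Section Compiler.
Variables (R K : nat).

(** The depth [d] counts the enclosing loops. A loop keeps its counter on stack [R + d], so nested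
    loops never share one while consecutive loops do. *)
Fixpoint compile (d : nat) (c : cmd) : tprog :=
  match c with
  | Skip => tmove Stay 0
  | Push v b => push_prog K v b
  | Pop v => pop_prog K v
  | Test v ce c0 c1 => test_prog K v (compile d ce) (compile d c0) (compile d c1)
  | For v c =>
      let h := R + d in
      TSeq (copy_prog K v h) (TSeq (tmove MoveL h.+1) (TSeq
        (TWhile isSome (TSeq (tmove MoveR h.+1) (TSeq (pop_prog K h)
          (TSeq (compile d.+1 c) (tmove MoveL h.+1)))))
        (tmove MoveR h.+1)))
  | Seq c1 c2 => TSeq (compile d c1) (compile d c2)
  end.

(* Tracks from R on hold the unary counters g of the enclosing loops. *)
Definition tracks (st : state) (g : nat -> nat) : nat -> seq bool :=
  fun v => if v < R then reg st v else nseq (g (v - R)) true.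

Lemma fset_reg st g v s : v < R -> fset (tracks st g) v s = tracks (upd st v s) g.
Proof.
move=> Hv; apply: functional_extensionality => w; rewrite /fset /tracks nth_set_nth /=.
by case: eqP => [->|//]; rewrite Hv.
Qed.

Lemma fset_counter st g d n : fset (tracks st g) (R + d) (nseq n true) =
  tracks st (fun e => if e == d then n else g e).
Proof.
apply: functional_extensionality => w; rewrite /fset /tracks.
case: eqP => [->|Hw]; first by rewrite ltnNge leq_addr /= addKn eqxx.
by case: ltnP => // Hw'; case: eqP => // E; case: Hw; lia.
Qed.

Definition cost_factor := 3 * unit_cost K.

(** The budget [B] bounds each register plus the cost still to come, so by [size_exec] no stack ever
    exceeds height [B]. One unit of cost then takes at most [cost_factor * B.+1] machine steps.
    Counters from depth [d] on are empty on entry and again on exit. *)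
Lemma compile_correct c d st g f B :
  regs c <= R -> R + d + depth c < K -> lay K (tracks st g) f ->
  (forall e, d <= e -> g e = 0) ->
  (forall v, size (reg st v) + cost c st <= B) -> (forall e, g e <= B) ->
  exists f', [/\ trun (compile d c) f home (cost_factor * B.+1 * cost c st) f' home,
    lay K (tracks (exec c st) g) f' & right_eq f f'].
Proof.
have track v (st' : state) g' : v < R -> tracks st' g' v = reg st' v by rewrite /tracks => ->.
have Cu n : n <= B -> unit_cost K * n.+1 <= unit_cost K * B.+1 by rewrite leq_mul2l ltnS => ->; rewrite orbT.
elim: c d st g f => [|v b|v|v ce IHe c0 IH0 c1 IH1|v c IH|c1 IH1 c2 IH2] d st g f /=.
- move=> _ _ L _ _ _; exists f; split=> //.
  apply: trun_weaken; first by apply: (@trun_move Stay 0 f home home).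
  rewrite /cost_factor /unit_cost; nia.
- move=> Hv HK L _ HB _; have Hv' : v.+1 < K by lia.
  have [f' [T L' R']] := run_push b Hv' L; exists f'; split=> //.
    apply: trun_weaken T _; rewrite track //.
    have := HB v; have := Cu (size (reg st v)); rewrite /cost_factor; lia.
  by rewrite -fset_reg // -(track v st g).
- move=> Hv HK L _ HB _; have Hv' : v.+1 < K by lia.
  have [f' [T L' R']] := run_pop Hv' L; exists f'; split=> //.
    apply: trun_weaken T _; rewrite track //.
    have := HB v; have := Cu (size (reg st v)); rewrite /cost_factor; lia.
  by rewrite -fset_reg // -(track v st g).
- rewrite !geq_max => /andP[Hv /andP[He /andP[H0 H1]]] HK L Hg HB HgB.
  have Hv' : v.+1 < K by lia.
  have [f1 [L1 R1 T]] := run_test (compile d ce) (compile d c0) (compile d c1) Hv' L.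
  rewrite track // in T.
  set ch := match reg st v with [::] => ce | b :: _ => if b then c1 else c0 end.
  have Ecost : match reg st v with
      | [::] => cost ce st
      | b :: _ => if b then cost c1 st else cost c0 st
      end = cost ch st.
    by rewrite /ch; case: (reg st v) => [|[]].
  have -> : match reg st v with
      | [::] => exec ce st
      | b :: _ => if b then exec c1 st else exec c0 st
      end = exec ch st.
    by rewrite /ch; case: (reg st v) => [|[]].
  rewrite Ecost in HB *.
  have [f' [T' L' R']] : exists f', [/\ trun (compile d ch) f1 home (cost_factor * B.+1 * cost ch st) f' home,
    lay K (tracks (exec ch st) g) f' & right_eq f1 f'].
    have HB' w : size (reg st w) + cost ch st <= B by apply: leq_trans (HB w); rewrite leq_add2l.
    move: HB'; rewrite /ch; case: (reg st v) => [|[] ?] HB'.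
    + by apply: IHe => //; lia.
    + by apply: IH1 => //; lia.
    + by apply: IH0 => //; lia.
  exists f'; split=> //; last exact: right_eq_trans R1 R'.
  apply: trun_weaken; first apply: T.
    by move: T'; rewrite /ch; case: (reg st v) => [|[] ?]; apply.
  have := HB v; have := Cu (size (reg st v)); rewrite /cost_factor; lia.
- rewrite !geq_max => /andP[Hv Hc] HK L Hg HB HgB.
  have Hh : (R + d).+1 < K by lia.
  case: (run_copy (ltn_addr d Hv) Hh L).
    by rewrite /tracks ltnNge leq_addr /= addKn Hg.
  move=> f1 [T1 L1 R1].
  rewrite track // fset_counter in L1; rewrite track // in T1.
  set n := size (reg st v) in T1 L1 HB *.
  pose S i := iter i (exec c) st.
  pose G i := fun e : nat => if e == d then i else g e.
  have nB : n <= B by apply: leq_trans (HB v); apply: leq_addr.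
  have loop m i f0 : i + m = n -> lay K (tracks (S i) (G m)) f0 ->
    exists f', [/\ trun (TWhile isSome (TSeq (tmove MoveR (R + d).+1) (TSeq (pop_prog K (R + d))
          (TSeq (compile d.+1 c) (tmove MoveL (R + d).+1))))) f0 (cell_pos K 0 (R + d).+1)
        (\sum_(i <= j < n) cost_factor * B.+1 * (cost c (S j)).+1).+1 f' (cell_pos K 0 (R + d).+1),
      lay K (tracks (S n) (G 0)) f' & right_eq f0 f'].
    elim: m i f0 => [|m IHm] i f0 Hi L0.
      rewrite addn0 in Hi; subst i; exists f0; split=> //; rewrite big_geq //.
      apply: trun_exit; have := lay_top Hh L0.
      by rewrite /tracks ltnNge leq_addr /= addKn /G eqxx.
    have Nz : tracks (S i) (G m.+1) (R + d) = nseq m.+1 true.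
      by rewrite /tracks ltnNge leq_addr /= addKn /G eqxx.
    have [f2 [T2 L2 R2]] := run_pop Hh L0.
    rewrite Nz /= in T2; rewrite Nz /= fset_counter in L2.
    have EG : (fun e => if e == d then m else G m.+1 e) = G m.
      by apply: functional_extensionality => e; rewrite /G; case: eqP.
    rewrite EG in L2.
    (* The cost of the rounds already done plus that of round [i] stays within the cost of the loop,
       so the budget [B] remains valid for the body in this round. *)
    have Hsum : \sum_(j < i) cost c (S j) + cost c (S i) <= \sum_(j < n) (cost c (S j)).+1.
      rewrite -(big_mkord xpredT (fun j => cost c (S j))) -big_nat_recr //=.
      rewrite -(big_mkord xpredT (fun j => (cost c (S j)).+1)).
      rewrite (@big_cat_nat _ _ _ i.+1 0 n) //=; last by lia.
      by apply: leq_trans (leq_addr _ _); apply: leq_sum.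
    have [] := IH d.+1 (S i) (G m) f2 => //.
    + by lia.
    + by move=> e He; rewrite /G gtn_eqF // Hg // ltnW.
    + move=> w; have := HB w; have := @size_iter_exec c st w i (@size_exec c).
      rewrite -/(S i); move: Hsum; set X := \sum_(j < i) _; set Y := \sum_(j < n) _.
      lia.
    + by move=> e; rewrite /G; case: eqP => // _; lia.
    move=> f3 [T3 L3 R3].
    have [f4 [T4 L4 R4]] := IHm i.+1 f3 (etrans (addSnnS _ _) Hi) L3.
    exists f4; split=> //; last exact: right_eq_trans R2 (right_eq_trans R3 R4).
    rewrite big_ltn; last by lia.
    apply: trun_weaken.
      apply: trun_loop T4; first by rewrite (lay_top Hh L0) Nz.
      apply: trun_seq (trun_right _ _ _) (trun_seq T2 (trun_seq T3 (trun_left _ _ _))).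
    rewrite !size_nseq.
    set X := \sum_(_ <= j < _) _.
    have := Cu m.+1; rewrite /cost_factor /unit_cost; nia.
  have [f2 [T2 L2 R2]] := loop n 0 f1 (add0n _) L1.
  exists f2; split=> //; last exact: right_eq_trans R1 R2.
    apply: trun_weaken.
      apply: trun_seq T1 (trun_seq (trun_left _ _ _) (trun_seq T2 (trun_right _ _ _))).
    rewrite -big_distrr /= big_mkord /S.
    set X := \sum_(_ < _) _; have := Cu n nB; rewrite /cost_factor /unit_cost; nia.
  have -> : g = G 0 by apply: functional_extensionality => e; rewrite /G; case: eqP => // ->; rewrite Hg.
  exact: L2.
- rewrite !geq_max => /andP[H1 H2] HK L Hg HB HgB.
  have [] := IH1 d st g f => //; try by lia.
    by move=> w; apply: leq_trans (HB w); rewrite leq_add2l leq_addr.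
  move=> f1 [T1 L1 R1].
  have [] := IH2 d (exec c1 st) g f1 => //; try by lia.
    by move=> w; have := HB w; have := size_exec c1 st w; lia.
  move=> f2 [T2 L2 R2]; exists f2; split=> //; last exact: right_eq_trans R1 R2.
  by apply: trun_weaken (trun_seq T1 T2) _; rewrite -mulnDr.
Qed.

End Compiler.

(** * Polynomial bounds *)

Definition pbounded (t : nat -> nat) : Prop :=
  exists c d, forall n, t n <= polyb c d n.

Lemma pbounded_le t u : pbounded t -> (forall n, u n <= t n) -> pbounded u.
Proof. by case=> c [d H] E; exists c, d => n; apply: leq_trans (H n). Qed.

Lemma pbounded_const k : pbounded (fun=> k).
Proof. by exists k, 0 => n; rewrite /polyb leq_addl. Qed.

Lemma pbounded_id : pbounded id.
Proof. by exists 1, 1 => n; rewrite /polyb mul1n expn1 leq_addr. Qed.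

Lemma polyb_mono c d n m : n <= m -> polyb c d n <= polyb c d m.
Proof.
move=> H; rewrite /polyb leq_add2r leq_mul2l; apply/orP; right.
by case: d => // d; rewrite leq_exp2r.
Qed.

Lemma leq_expSn n d e : d <= e -> n ^ d <= n ^ e + 1.
Proof.
case: n => [|n] H; last by apply: leq_trans (leq_addr _ _); rewrite leq_pexp2l.
by case: d {H} => [|d]; [rewrite expn0 addn1 | rewrite exp0n].
Qed.

Lemma pbounded_mul t u : pbounded t -> pbounded u -> pbounded (fun n => t n * u n).
Proof.
case=> c [d H] [c' [d' H']]; exists (4 * (c * c')), (d + d') => n.
apply: leq_trans (leq_mul (H n) (H' n)) _; rewrite /polyb.
have A := leq_expSn n (leq_addr d' d); have B := leq_expSn n (leq_addl d d').
have : (n ^ d + 1) * (n ^ d' + 1) <= 4 * (n ^ (d + d') + 1).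
  by move: A B; rewrite expnD; nia.
set X := n ^ d; set Y := n ^ d'; set W := n ^ (d + d') => F.
have -> : (c * X + c) * (c' * Y + c') = c * c' * ((X + 1) * (Y + 1)) by lia.
have -> : 4 * (c * c') * W + 4 * (c * c') = c * c' * (4 * (W + 1)) by lia.
by rewrite leq_mul2l F orbT.
Qed.

Lemma pbounded_add t u : pbounded t -> pbounded u -> pbounded (fun n => t n + u n).
Proof.
case=> c [d H] [c' [d' H']]; exists (2 * (c + c')), (maxn d d') => n.
apply: leq_trans (leq_add (H n) (H' n)) _; rewrite /polyb.
have A := leq_expSn n (leq_maxl d d'); have B := leq_expSn n (leq_maxr d d').
by move: A B; set X := n ^ d; set Y := n ^ d'; set W := n ^ _; nia.
Qed.

Lemma pbounded_succ t : pbounded t -> pbounded (fun n => (t n).+1).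
Proof.
by move=> H; apply: pbounded_le (pbounded_add H (pbounded_const 1)) _ => n; rewrite addn1.
Qed.

Lemma pbounded_exp t d : pbounded t -> pbounded (fun n => t n ^ d).
Proof.
move=> H; elim: d => [|d IH].
  by apply: pbounded_le (pbounded_const 1) _ => n; rewrite expn0.
by apply: pbounded_le (pbounded_mul H IH) _ => n; rewrite expnS.
Qed.

Lemma pbounded_polyb t c d : pbounded t -> pbounded (fun n => polyb c d (t n)).
Proof.
move=> H; apply: pbounded_add (pbounded_const c).
exact: pbounded_mul (pbounded_const c) (pbounded_exp d H).
Qed.

Lemma pbounded_comp t u : pbounded t -> pbounded u -> pbounded (fun n => t (u n)).
Proof. by case=> c [d H] /(pbounded_polyb c d) Hu; apply: pbounded_le Hu _ => n. Qed.

(** * Loading the input word into a register *)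

Section Program.
Variable K : nat.
Local Notation cell := (cell_pos K).

Definition agrees (s : seq bool) (f : ftape) : Prop :=
  forall z, (-2 < z)%Z -> f z = input_tape s z.

Definition skip mv : tprog := TWhile isSome (tmove mv 1).

Lemma input_nat s i : input_tape s (Z.of_nat i) = onth s i.
Proof.
by rewrite /input_tape; case: Z.ltb_spec => [|_]; [lia | congr (onth s _); lia].
Qed.

Lemma agrees_nat s f i : agrees s f -> f (Z.of_nat i) = onth s i.
Proof. by move=> ->; [rewrite input_nat | lia]. Qed.

Lemma agrees_sep s f : agrees s f -> f (-1)%Z = None.
Proof. by move=> ->. Qed.

Lemma skip_right s f i : agrees s f -> i <= size s ->
  trun (skip MoveR) f (Z.of_nat i) ((size s - i) * 4).+1 f (Z.of_nat (size s)).
Proof.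
move=> A; move E: (size s - i) => n; elim: n i E => [|n IH] i E Hi.
  have -> : i = size s by lia.
  apply: trun_exit; rewrite (agrees_nat _ A).
  by have := isSome_onth s (size s); rewrite ltnn.
have -> : (n.+1 * 4).+1 = (2 + (n * 4).+1).+2 by lia.
apply: (@trun_loop isSome _ _ _ _ _ f (Z.of_nat i.+1)).
- by rewrite (agrees_nat _ A) isSome_onth; lia.
- by apply: trun_move; rewrite /displ; lia.
- by apply: IH; lia.
Qed.

Lemma skip_left s f i : agrees s f -> i <= size s ->
  trun (skip MoveL) f (Z.of_nat i - 1)%Z (i * 4).+1 f (-1)%Z.
Proof.
move=> A; elim: i => [|i IH] Hi; first by apply: trun_exit; rewrite (agrees_sep A).
have -> : (i.+1 * 4).+1 = (2 + (i * 4).+1).+2 by lia.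
apply: (@trun_loop isSome _ _ _ _ _ f (Z.of_nat i - 1)%Z).
- have -> : (Z.of_nat i.+1 - 1 = Z.of_nat i)%Z by lia.
  by rewrite (agrees_nat _ A) isSome_onth.
- by apply: trun_move; rewrite /displ; lia.
- by apply: IH; lia.
Qed.

Definition take_bit rin b : tprog :=
  TSeq (twrite None) (TSeq (tmove MoveL 1) (TSeq (skip MoveL) (TSeq (tmove MoveL 1)
    (TSeq (push_prog K rin b) (TSeq (tmove MoveR 2) (TSeq (skip MoveR) (tmove MoveL 1))))))).

(* The input is consumed from its last bit, so that its first bit ends up on top of the register. *)
Definition input_prog rin : tprog :=
  TSeq (tmove MoveL 2) (TSeq (twrite (Some false)) (TSeq (tmove MoveR 2)
    (TSeq (skip MoveR) (TSeq (tmove MoveL 1)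
      (TSeq (TWhile isSome (TIf (fun a => a == Some true) (take_bit rin true) (take_bit rin false)))
        (tmove MoveL 1)))))).

Definition single (rin : nat) (s : seq bool) : nat -> seq bool :=
  fun w => if w == rin then s else [::].

Lemma lay_right S f z a : lay K S f -> (-2 < z)%Z -> lay K S (fupd f z a).
Proof.
case=> H0 H Hz; have E y : (y <= -2)%Z -> fupd f z a y = f y.
  by move=> Hy; rewrite /fupd; case: Z.eqb_spec => //; lia.
by split=> [|i v Hv]; rewrite E ?H //; exact: cell_pos_le.
Qed.

Lemma agrees_erase s b f : agrees (rcons s b) f ->
  agrees s (fupd f (Z.of_nat (size s)) None).
Proof.
move=> A z Hz; rewrite /fupd; case: Z.eqb_spec => [->|Hn].
  by rewrite input_nat; have := isSome_onth s (size s); rewrite ltnn; case: onth.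
rewrite A // /input_tape; case: Z.ltb_spec => // H0; rewrite onth_rcons.
by case: eqP => //; lia.
Qed.

Definition take_cost n := (unit_cost K + 20) * n.+1.

Lemma trun_take_bit rin s b f t : rin.+1 < K -> lay K (single rin t) f ->
  agrees (rcons s b) f ->
  exists f', [/\ trun (take_bit rin b) f (Z.of_nat (size s)) (take_cost (size s + size t)) f'
                   (Z.of_nat (size s) - 1)%Z,
    lay K (single rin (b :: t)) f' & agrees s f'].
Proof.
move=> Hr L A; set f1 := fupd f (Z.of_nat (size s)) None.
have L1 : lay K (single rin t) f1 by apply: lay_right => //; lia.
have A1 := agrees_erase A; rewrite -/f1 in A1.
have [f2 [T2 L2 R2]] := run_push b Hr L1.
have A2 : agrees s f2 by move=> z Hz; rewrite R2 // A1.
exists f2; split=> //; last first.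
  suff <- : fset (single rin t) rin (b :: single rin t rin) = single rin (b :: t) by [].
  apply: functional_extensionality => w; rewrite /fset /single eqxx.
  by case: eqP.
apply: trun_weaken.
  apply: trun_seq (trun_write _ _ _) _.
  apply: trun_seq (trun_move (h' := (Z.of_nat (size s) - 1)%Z) _ _) _; first by rewrite /displ; lia.
  apply: trun_seq (skip_left A1 (leqnn _)) _.
  apply: trun_seq (trun_move (h' := home) _ _) _; first by [].
  apply: trun_seq T2 _.
  apply: trun_seq (trun_move (h' := Z.of_nat 0) _ _) _; first by [].
  apply: trun_seq (skip_right A2 (leq0n _)) _.
  by apply: trun_move; rewrite /displ; lia.
rewrite /take_cost /single eqxx /unit_cost; nia.
Qed.

Lemma trun_input rin x : rin.+1 < K ->
  exists f, [/\ trun (input_prog rin) (input_tape x) 0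
      (20 + 4 * size x + size x * (take_cost (size x) + 4)) f home,
    lay K (single rin x) f & agrees [::] f].
Proof.
move=> Hr; set f0 := fupd (input_tape x) home (Some false).
have L0 : lay K (single rin [::]) f0.
  split=> [|i v Hv]; first by rewrite /f0 /fupd Z.eqb_refl.
  rewrite /single if_same /f0 /fupd cell_pos_home // andbF /input_tape.
  by case: Z.ltb_spec => //; have := @cell_pos_le K i v.+1; case: i => //; lia.
have A0 : agrees x f0 by move=> z Hz; rewrite /f0 /fupd; case: Z.eqb_spec => //; rewrite /home; lia.
have loop s t f : size (s ++ t) <= size x -> lay K (single rin t) f -> agrees s f ->
    exists f', [/\ trun (TWhile isSome
          (TIf (fun a => a == Some true) (take_bit rin true) (take_bit rin false)))
        f (Z.of_nat (size s) - 1)%Z (size s * (take_cost (size x) + 4)).+1 f' (-1)%Z,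
      lay K (single rin (s ++ t)) f' & agrees [::] f'].
  elim/last_ind: s t f => [|s b IH] t f Hs L A.
    exists f; split=> //; apply: trun_exit; by rewrite /= (agrees_sep A).
  rewrite size_cat size_rcons in Hs; rewrite size_rcons.
  have [f1 [T1 L1 A1]] := trun_take_bit Hr L A.
  case: (IH (b :: t) f1) => //; first by rewrite size_cat /=; lia.
  move=> f2 [T2 L2 A2]; exists f2; rewrite cat_rcons; split=> //.
  have -> : (Z.of_nat (size s).+1 - 1 = Z.of_nat (size s))%Z by lia.
  have Fb : f (Z.of_nat (size s)) = Some b by rewrite (agrees_nat _ A) onth_rcons eqxx.
  apply: trun_weaken.
    apply: trun_loop T2; first by rewrite Fb.
    by move: Fb T1; case: (b) => Fb T1; [apply: trun_then T1 | apply: trun_else T1]; rewrite Fb.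
  have : take_cost (size s + size t) <= take_cost (size x) by rewrite /take_cost leq_mul2l; lia.
  by rewrite mulSn; lia.
case: (loop x [::] f0) => //; first by rewrite cats0.
rewrite cats0 => f [T L A]; exists f; split=> //.
apply: trun_weaken.
  apply: trun_seq (trun_move (h' := home) _ _) _ => //.
  apply: trun_seq (trun_write _ _ _) _.
  apply: trun_seq (trun_move (h' := Z.of_nat 0) _ _) _ => //.
  apply: trun_seq (skip_right A0 (leq0n _)) _.
  apply: trun_seq (trun_move (h' := (Z.of_nat (size x) - 1)%Z) _ _) _; first by rewrite /displ; lia.
  by apply: trun_seq T (trun_move _ _).
lia.
Qed.

End Program.

Definition init_state (rin : nat) (x : seq bool) : state := upd [::] rin x.

(** The bridge from stack programs to P. The input is erased while it is loaded, so the answer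
    written at [home] by the final test has the blank at [-1] to its right, as [machine_run]
    requires. *)
Lemma program_inP (L : seq bool -> bool) (c : cmd) (rin rout : nat) (t : nat -> nat) :
  (forall x, ohead (reg (exec c (init_state rin x)) rout) = Some (L x)) ->
  pbounded t -> (forall x, cost c (init_state rin x) <= t (size x)) -> inP L.
Proof.
move=> HL Hp Ht.
(* Room for one return track, [R] registers and one counter per level of loop nesting. *)
pose R := maxn (regs c) (maxn rin rout).+1; pose K := (R + depth c).+2.
pose prog := TSeq (input_prog K rin) (TSeq (compile R K 0 c)
  (test_prog K rout (twrite None) (twrite (Some false)) (twrite (Some true)))).
pose T n := (20 + 4 * n + n * (take_cost K n + 4)) +
  (cost_factor K * (n + t n).+1 * t n + (unit_cost K * (n + t n).+1 + 1)).
have [C [D PT]] : pbounded T.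
  have CC := pbounded_const.
  have S : pbounded (fun n => (n + t n).+1) by exact: pbounded_succ (pbounded_add pbounded_id Hp).
  apply: pbounded_add; first (apply: pbounded_add; first apply: pbounded_add).
  - exact: CC.
  - exact: pbounded_mul (CC 4) pbounded_id.
  - apply: pbounded_mul pbounded_id _; apply: pbounded_add (CC 4).
    exact: (pbounded_mul (CC (unit_cost K + 20)) (pbounded_succ pbounded_id)).
  - apply: pbounded_add; first exact: pbounded_mul (pbounded_mul (CC _) S) Hp.
    exact: pbounded_add (pbounded_mul (CC _) S) (CC 1).
exists (machine (assemble prog 0)), C, D => x.
have Hin : rin.+1 < K by rewrite /K /R; lia.
have Hout : rout.+1 < K by rewrite /K /R; lia.
have [f1 [T1 L1 A1]] := trun_input x Hin.
set st := init_state rin x.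
have Est : single rin x = tracks R st (fun=> 0).
  apply: functional_extensionality => w; rewrite /single /tracks /st /init_state nth_set_nth /= nth_nil.
  by case: eqP => [->|_]; case: ltnP => // H; rewrite /R in H; lia.
rewrite Est in L1.
have Bst w : size (reg st w) + cost c st <= size x + t (size x).
  apply: leq_add (Ht x); rewrite /st /init_state nth_set_nth /= nth_nil.
  by case: eqP.
have [] := @compile_correct R K c 0 st (fun=> 0) f1 (size x + t (size x)) => //; try by rewrite /K /R; lia.
move=> f2 [T2 L2 R2].
have [f3 [L3 R3 T3]] := run_test (twrite None) (twrite (Some false)) (twrite (Some true)) Hout L2.
have Rout : tracks R (exec c st) (fun=> 0) rout = reg (exec c st) rout.
  by rewrite /tracks; case: ltnP => // H; rewrite /R in H; lia.
have HLx := HL x; rewrite -/st -Rout in HLx.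
have Sout : size (tracks R (exec c st) (fun=> 0) rout) <= size x + t (size x).
  rewrite Rout; apply: leq_trans (size_exec _ _ _) (Bst _).
have [f4 T4 F4] : exists2 f4, trun (match tracks R (exec c st) (fun=> 0) rout with
      [::] => twrite None | b :: _ => if b then twrite (Some true) else twrite (Some false) end)
      f3 home 1 f4 home & f4 = fupd f3 home (Some (L x)).
  exists (fupd f3 home (Some (L x))) => //.
  by case: tracks HLx => //= b s [<-]; case: b; exact: trun_write.
have {}T4 := T3 _ _ T4.
have [n Hn E] := trun_seq T1 (trun_seq T2 T4).
have Run : runs_within (machine (assemble prog 0)) x n [:: L x].
  apply: machine_run E _ _; first by rewrite F4 /fupd Z.eqb_refl.
  rewrite F4 /fupd /=; have Hm : (-2 < -1)%Z by [].
  by rewrite R3 // R2 // (agrees_sep A1).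
case: Run => n' Hn' Run; exists n' => //.
apply: leq_trans Hn' _; apply: leq_trans Hn _; apply: leq_trans (PT _).
rewrite /T leq_add2l leq_add //; first by rewrite leq_mul2l Ht orbT.
by rewrite leq_add2r leq_mul2l ltnS Sout orbT.
Qed.

(** * Specifications of stack programs *)

Definition spec (c : cmd) (st st' : state) (t : nat) : Prop :=
  exec c st = st' /\ cost c st <= t.

Lemma spec_weaken c st st' t u : spec c st st' t -> t <= u -> spec c st st' u.
Proof. by case=> E C H; split=> //; apply: leq_trans H. Qed.

Lemma spec_seq c1 c2 st st1 st2 t1 t2 :
  spec c1 st st1 t1 -> spec c2 st1 st2 t2 -> spec (c1 ;; c2) st st2 (t1 + t2).
Proof. by case=> E1 C1 [E2 C2]; split; rewrite /= E1 // leq_add. Qed.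

Lemma spec_skip st : spec Skip st st 1. Proof. by []. Qed.

Lemma spec_push v b st : spec (Push v b) st (upd st v (b :: reg st v)) 1. Proof. by []. Qed.

Lemma spec_pop v st : spec (Pop v) st (upd st v (behead (reg st v))) 1. Proof. by []. Qed.

Lemma spec_test v ce c0 c1 b s st st' t : reg st v = b :: s ->
  spec (if b then c1 else c0) st st' t -> spec (Test v ce c0 c1) st st' t.+1.
Proof. by move=> E; rewrite /spec /= E; case: b {E} => -[E C]; split=> //; rewrite ltnS. Qed.

Lemma spec_for v c (F : nat -> state) n B : size (reg (F 0) v) = n ->
  (forall i, i < n -> spec c (F i) (F i.+1) B) -> spec (For v c) (F 0) (F n) (n * B.+1 + 2).
Proof.
move=> Hn H; rewrite /spec /= Hn.
have E i : i <= n -> iter i (exec c) (F 0) = F i.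
  by elim: i => //= i IH Hi; rewrite IH ?(ltnW Hi) //; case: (H i Hi).
split; first exact: E.
have -> : n * B.+1 = \sum_(i < n) B.+1 by rewrite sum_nat_const card_ord.
rewrite addn2 !ltnS leq_sum // => i _.
by rewrite E ?(ltnW (ltn_ord i)) // ltnS; case: (H i (ltn_ord i)).
Qed.

(** Polynomials are kept as syntax because they are used twice: [peval] is the value and [ploop] the
    nest of loops that runs a command that many times. *)
Inductive pexp :=
| PConst of nat
| PVar
| PAdd of pexp & pexp
| PMul of pexp & pexp
| PExp of pexp & nat.

Fixpoint peval (e : pexp) (n : nat) : nat :=
  match e with
  | PConst k => k
  | PVar => n
  | PAdd e1 e2 => peval e1 n + peval e2 n
  | PMul e1 e2 => peval e1 n * peval e2 n
  | PExp e k => peval e n ^ k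
  end.

Fixpoint ploop (v : nat) (e : pexp) (c : cmd) : cmd :=
  match e with
  | PConst k => iter k (Seq c) Skip
  | PVar => For v c
  | PAdd e1 e2 => ploop v e1 c ;; ploop v e2 c
  | PMul e1 e2 => ploop v e1 (ploop v e2 c)
  | PExp e k => iter k (ploop v e) c
  end.

Fixpoint loop_factor (e : pexp) (n : nat) : nat :=
  match e with
  | PConst k => k.+1
  | PVar => n.+2
  | PAdd e1 e2 => loop_factor e1 n + loop_factor e2 n
  | PMul e1 e2 => loop_factor e1 n * (loop_factor e2 n).+1
  | PExp e k => iter k (fun f => loop_factor e n * f.+1) 1
  end.

(** [F i] is the state after [i] rounds. The length of register [v] must be the same in all of them
    because inner loops read it afresh each time they are entered. *)
Lemma spec_ploop e v c n B (F : nat -> state) :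
  (forall i, i < peval e n -> spec c (F i) (F i.+1) B) ->
  (forall i, i <= peval e n -> size (reg (F i) v) = n) ->
  spec (ploop v e c) (F 0) (F (peval e n)) (loop_factor e n * B.+1).
Proof.
(* Common step for products and powers: round [i] of the outer loop covers the rounds from [i * m]
   to [i * m + m] of the flattened sequence [F]. *)
have nest e1 c1 c2 m f : 
    (forall B F, (forall i, i < peval e1 n -> spec c1 (F i) (F i.+1) B) ->
      (forall i, i <= peval e1 n -> size (reg (F i) v) = n) ->
      spec (ploop v e1 c1) (F 0) (F (peval e1 n)) (loop_factor e1 n * B.+1)) ->
    (forall B F, (forall i, i < m -> spec c2 (F i) (F i.+1) B) ->
      (forall i, i <= m -> size (reg (F i) v) = n) ->
      spec c1 (F 0) (F m) (f * B.+1)) ->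
    forall B F, (forall i, i < peval e1 n * m -> spec c2 (F i) (F i.+1) B) ->
      (forall i, i <= peval e1 n * m -> size (reg (F i) v) = n) ->
      spec (ploop v e1 c1) (F 0) (F (peval e1 n * m)) (loop_factor e1 n * f.+1 * B.+1).
  move=> H1 H2 {}B {}F HF HS.
  have bd i j : i < peval e1 n -> j <= m -> i * m + j <= peval e1 n * m by nia.
  have := H1 (f * B.+1) (fun i => F (i * m)) => /=; rewrite mul0n => {}H1.
  apply: spec_weaken; first apply: H1.
  - move=> i Hi; have := H2 B (fun j => F (i * m + j)).
    rewrite addn0 mulSn addnC; apply=> j Hj; last by apply: HS; apply: bd.
    by rewrite addnS; apply: HF; have := bd i j.+1 Hi Hj; rewrite addnS.
  - by move=> i Hi; apply: HS; rewrite leq_mul2r Hi orbT.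
  by nia.
elim: e c B F => [k||e1 IH1 e2 IH2|e1 IH1 e2 IH2|e1 IH1 k] c B F /= HF HS.
- elim: k F HF {HS} => [|k IH] F HF; first exact: spec_weaken (spec_skip _) _.
  apply: spec_weaken; first apply: spec_seq (HF 0 _) (IH (fun i => F i.+1) _) => //.
    by move=> i Hi; apply: HF.
  nia.
- apply: spec_weaken; first by apply: spec_for HF; apply: HS.
  nia.
- apply: spec_weaken.
    apply: spec_seq.
      apply: (IH1 c B F) => i Hi; first by apply: HF; apply: ltn_addr.
      by apply: HS; apply: leq_trans Hi (leq_addr _ _).
    have := IH2 c B (fun i => F (peval e1 n + i)); rewrite addn0; apply=> i Hi.
      by rewrite addnS; apply: HF; rewrite ltn_add2l.
    by apply: HS; rewrite leq_add2l.
  by rewrite mulnDl.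
- by apply: (nest e1 (ploop v e2 c) c (peval e2 n) (loop_factor e2 n) _ _ B F HF HS);
    [exact: IH1 | exact: IH2].
- elim: k B F HF HS => [|k IH] B F HF HS.
    by rewrite mul1n; apply: spec_weaken (HF 0 _) _.
  rewrite expnS in HF HS *; rewrite !iterS.
  by apply: (nest e1 (iter k (ploop v e1) c) c (peval e1 n ^ k) _ _ _ B F HF HS);
    [exact: IH1 | exact: IH].
Qed.

Lemma pbounded_peval e : pbounded (peval e).
Proof.
elim: e => /= [k||e1 H1 e2 H2|e1 H1 e2 H2|e H k].
- exact: pbounded_const.
- exact: pbounded_id.
- exact: pbounded_add.
- exact: pbounded_mul.
- exact: pbounded_exp.
Qed.

Lemma pbounded_loop_factor e : pbounded (loop_factor e).
Proof.
elim: e => /= [k||e1 H1 e2 H2|e1 H1 e2 H2|e H k].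
- exact: pbounded_const.
- exact: pbounded_succ (pbounded_succ pbounded_id).
- exact: pbounded_add.
- exact: pbounded_mul H1 (pbounded_succ H2).
- elim: k => [|k IH]; first exact: pbounded_const.
  exact: pbounded_mul H (pbounded_succ IH).
Qed.

Definition ppoly (c d : nat) (e : pexp) : pexp :=
  PAdd (PMul (PConst c) (PExp e d)) (PConst c).

Definition clear (v : nat) : cmd := For v (Pop v).

Lemma upd_upd (st : state) v s s' : upd (upd st v s) v s' = upd st v s'.
Proof. by rewrite set_set_nth eqxx. Qed.

Lemma upd_reg (st : state) v : v < size st -> upd st v (reg st v) = st.
Proof.
move=> H; apply: (@eq_from_nth _ [::]) => [|i _]; first by rewrite size_set_nth; apply/maxn_idPr.
by rewrite nth_set_nth /=; case: eqP => [->|].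
Qed.

Lemma spec_clear v (st : state) : v < size st ->
  spec (clear v) st (upd st v [::]) (size (reg st v) * 2 + 2).
Proof.
move=> H; have := @spec_for v (Pop v) (fun i => upd st v (drop i (reg st v))) (size (reg st v)) 1.
rewrite drop0 drop_size upd_reg //; apply=> // i Hi; split=> //=.
by rewrite nth_set_nth /= eqxx upd_upd -drop1 drop_drop add1n.
Qed.

(* The value at For is junk: only used for loop-free programs. *)
Fixpoint flat_cost (c : cmd) : nat :=
  match c with
  | Skip | Push _ _ | Pop _ => 1
  | Test _ ce c0 c1 => (flat_cost ce + flat_cost c0 + flat_cost c1).+1
  | For _ _ => 0
  | Seq c1 c2 => flat_cost c1 + flat_cost c2
  end.

Fixpoint flat (c : cmd) : bool :=
  match c with
  | Skip | Push _ _ | Pop _ => true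
  | Test _ ce c0 c1 => [&& flat ce, flat c0 & flat c1]
  | For _ _ => false
  | Seq c1 c2 => flat c1 && flat c2
  end.

Lemma flat_costP c st : flat c -> cost c st <= flat_cost c.
Proof.
elim: c st => //= [v ce IHe c0 IH0 c1 IH1|c1 IH1 c2 IH2] st.
  case/and3P=> /(IHe st) ? /(IH0 st) ? /(IH1 st) ?.
  by rewrite ltnS; case: (reg st v) => [|[] _]; lia.
by case/andP=> /(IH1 st) ? /(IH2 (exec c1 st)) ?; lia.
Qed.

Definition emit (s : seq bool) : cmd := foldr (fun b c => Push 0 b ;; c) Skip s.

Lemma spec_emit s out rest :
  spec (emit s) (out :: rest) ((rev s ++ out) :: rest) (size s).+1.
Proof.
elim: s out => [|b s IH] out; first exact: spec_skip.
rewrite rev_cons cat_rcons; apply: spec_weaken.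
  by apply: (@spec_seq (Push 0 b) _ _ ((b :: out) :: rest)); [exact: spec_push | exact: IH].
by rewrite add1n.
Qed.

Definition sym_code (a : sym) : seq bool :=
  match a with Some b => [:: true; b] | None => [:: false; false] end.

Definition tape_code (u : seq sym) : seq bool := flatten (map sym_code u).

Definition push_sym (v : nat) (a : sym) : cmd :=
  match a with
  | Some b => Push v b ;; Push v true
  | None => Push v false ;; Push v false
  end.

(* An exhausted register reads as a blank. *)
Definition pop_sym (v : nat) (k : sym -> cmd) : cmd :=
  Test v (k None) (Pop v ;; Pop v ;; k None)
    (Pop v ;; Test v (k None) (Pop v ;; k (Some false)) (Pop v ;; k (Some true))).

Definition push_nat (v n : nat) : cmd := iter n (Seq (Push v true)) Skip.

(** Case distinction on a number stored in unary: the register is emptied bit by bit, and [i] counts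
    the bits popped so far. The bound [n] is fixed, so the program needs no loop. *)
Fixpoint switch (v n : nat) (k : nat -> cmd) (i : nat) : cmd :=
  if n is n'.+1 then
    Test v (k i) (Pop v ;; switch v n' k i.+1) (Pop v ;; switch v n' k i.+1)
  else k i.

Lemma exec_switch v n k i (st : state) q : reg st v = nseq q true -> q <= n ->
  v < size st -> exec (switch v n k i) st = exec (k (i + q)) (upd st v [::]).
Proof.
elim: n i st q => [|n IH] i st [|q] //= E Hq Hv; rewrite ?E ?addn0 /=.
- by rewrite -{1}(upd_reg Hv) E.
- by rewrite -{1}(upd_reg Hv) E.
- rewrite (IH _ _ q) ?nth_set_nth /= ?eqxx //.
    by rewrite upd_upd addSnnS.
  by rewrite size_set_nth leq_max Hv orbT.
Qed.

Lemma flat_switch v n k i : (forall j, flat (k j)) -> flat (switch v n k i).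
Proof. by move=> H; elim: n i => //= n IH i; rewrite H !IH. Qed.

Lemma flat_pop_sym v k : (forall a, flat (k a)) -> flat (pop_sym v k).
Proof. by move=> H; rewrite /= !H. Qed.

Lemma flat_push_nat v n : flat (push_nat v n).
Proof. by elim: n. Qed.

Lemma flat_push_sym v a : flat (push_sym v a).
Proof. by case: a. Qed.

(** * Simulation of Turing machines by stack programs *)

Section Simulation.
Variable M : TM.

(** [sim_regs] wants the symbol under the head to be present explicitly in register 2. A right move
    may exhaust that register, hence the test that pushes a blank. *)
Definition state_prog (q : 'I_(tm_nq M).+1) : cmd :=
  if tm_halt M q then push_nat 3 q else
  pop_sym 2 (fun a => let: (q', s, mv) := tm_delta M q a in
    push_nat 3 q' ;;
    match mv with
    | Stay => push_sym 2 s
    | MoveR => push_sym 1 s ;; Test 2 (push_sym 2 None) Skip Skip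
    | MoveL => push_sym 2 s ;; pop_sym 1 (push_sym 2)
    end).

Definition step_prog : cmd := switch 3 (tm_nq M) (fun i => state_prog (inord i)) 0.

Definition sim_regs (out clk : seq bool) (rest : state) (c : config M) : state :=
  let: (q, (l, a, r)) := c in
  [:: out, tape_code l, tape_code (a :: r), nseq q true, clk & rest].

Lemma exec_push_nat3 a l r q clk rest n :
  exec (push_nat 3 n) [:: a, l, r, q, clk & rest] = [:: a, l, r, nseq n true ++ q, clk & rest].
Proof.
elim: n q => //= n IH q; rewrite IH; congr [:: _, _, _, _, _ & _].
by elim: n {IH} => //= n ->.
Qed.

Lemma exec_step out clk rest (c : config M) :
  exec step_prog (sim_regs out clk rest c) = sim_regs out clk rest (@step M c).
Proof.
case: c => [q [[l a] r]]; rewrite /step_prog /sim_regs.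
rewrite (@exec_switch _ _ _ _ _ q) //= -1?ltnS // add0n inord_val /state_prog.
case: ifP => Hh; first by rewrite exec_push_nat3 cats0.
case E: (tm_delta M q a) => [[q' s] mv].
set K := fun a => _.
have -> : exec (pop_sym 2 K) [:: out, tape_code l, tape_code (a :: r), [::], clk & rest] =
    exec (K a) [:: out, tape_code l, tape_code r, [::], clk & rest].
  by case: a {E} => [[]|].
rewrite /K E /= exec_push_nat3 cats0.
case: mv {E K} => /=.
- by case: s => [b|]; case: l => [|[[]|] l].
- by case: s => [b|]; case: r => [|[[]|] r].
- by case: s => [b|].
Qed.

Lemma flat_step : flat step_prog.
Proof.
apply: flat_switch => i; rewrite /state_prog; case: ifP => _; first exact: flat_push_nat.
apply: flat_pop_sym => a; case: tm_delta => [[q s] mv] /=.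
by rewrite flat_push_nat; case: mv; rewrite /= ?flat_push_sym.
Qed.

Variables (c d : nat).

(* The input word is expected reversed in register 0.  Registers 1 and 2 hold the tape on the left
   of the head and from the head on, register 3 the state in unary, register 4 the clock. *)
Definition sim_prog : cmd :=
  clear 1 ;; clear 2 ;; clear 3 ;; clear 4 ;;
  For 0 (Push 4 true) ;;
  For 0 (Test 0 Skip (Pop 0 ;; push_sym 2 (Some false)) (Pop 0 ;; push_sym 2 (Some true))) ;;
  Test 2 (push_sym 2 None) Skip Skip ;;
  ploop 4 (ppoly c d PVar) step_prog.

Definition sim_cost (s n : nat) : nat :=
  2 * s + 8 + (n * 2 + 2) + (n * 5 + 2) + 3 + loop_factor (ppoly c d PVar) n * (flat_cost step_prog).+1.

(** The contents of registers 1 to 4 are arbitrary so that a second simulation can start on the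
    remains of a first one; the cost pays for clearing them. The clock always runs to its end. *)
Lemma spec_sim z l r q clk rest :
  spec sim_prog [:: rev z, l, r, q, clk & rest]
    (sim_regs [::] (nseq (size z) true) rest
      (iter (polyb c d (size z)) (@step M) (init M z)))
    (sim_cost (size l + size r + size q + size clk) (size z)).
Proof.
set n := size z; set clk' := nseq n true.
have count : spec (For 0 (Push 4 true)) [:: rev z, [::], [::], [::], [::] & rest]
    [:: rev z, [::], [::], [::], clk' & rest] (n * 2 + 2).
  apply: (@spec_for _ _ (fun i => [:: rev z, [::], [::], [::], nseq i true & rest])) => //=.
  by rewrite size_rev.
have load : spec
    (For 0 (Test 0 Skip (Pop 0 ;; push_sym 2 (Some false)) (Pop 0 ;; push_sym 2 (Some true))))
    [:: rev z, [::], [::], [::], clk' & rest]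
    [:: [::], [::], tape_code (map Some z), [::], clk' & rest] (n * 5 + 2).
  have := @spec_for 0 _ (fun i => [:: drop i (rev z), [::],
    tape_code (map Some (rev (take i (rev z)))), [::], clk' & rest]) n 4.
  rewrite drop0 take0 drop_oversize ?take_oversize ?size_rev // revK; apply=> //.
  move=> i Hi; have Hi' : i < size (rev z) by rewrite size_rev.
  rewrite (drop_nth false Hi') (take_nth false Hi') rev_rcons.
  by split=> /=; case: (nth false _ i).
have blank : spec (Test 2 (push_sym 2 None) Skip Skip)
    [:: [::], [::], tape_code (map Some z), [::], clk' & rest]
    (sim_regs [::] clk' rest (init M z)) 3.
  by split; case: (z).
have run : spec (ploop 4 (ppoly c d PVar) step_prog) (sim_regs [::] clk' rest (init M z))
    (sim_regs [::] clk' rest (iter (polyb c d n) (@step M) (init M z)))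
    (loop_factor (ppoly c d PVar) n * (flat_cost step_prog).+1).
  rewrite -[polyb c d n]/(peval (ppoly c d PVar) n).
  apply: (spec_ploop (F := fun i => sim_regs [::] clk' rest (iter i (@step M) (init M z)))).
    by move=> i _; split; [exact: exec_step | exact: flat_costP flat_step].
  by move=> i _; case: (iter i _ _) => [? [[? ?] ?]]; rewrite /= size_nseq.
apply: spec_weaken.
  apply: spec_seq (spec_clear (v := 1) _) _ => //.
  apply: spec_seq (spec_clear (v := 2) _) _ => //.
  apply: spec_seq (spec_clear (v := 3) _) _ => //.
  apply: spec_seq (spec_clear (v := 4) _) _ => //.
  exact: spec_seq count (spec_seq load (spec_seq blank run)).
rewrite /sim_cost /=; lia.
Qed.

(** A halted configuration is a fixed point of [step], so letting the clock run on does not change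
    the output. *)
Lemma sim_output z b : runs_within M z (polyb c d (size z)) b ->
  @output M (iter (polyb c d (size z)) (@step M) (init M z)) = b.
Proof.
case=> t Ht [Hh <-]; rewrite -(subnK Ht) iterD; move: (iter t _ _) Hh => st Hh.
have E : @step M st = st by case: st Hh => [q [[l a] r]] /= Hh; rewrite /step Hh.
by rewrite iter_fix.
Qed.

End Simulation.

Lemma loop_factor_mono e n m : n <= m -> loop_factor e n <= loop_factor e m.
Proof.
move=> H; elim: e => [k||e1 H1 e2 H2|e1 H1 e2 H2|e He k] //.
- exact: leq_add.
- exact: leq_mul.
- by elim: k => // k IH; apply: leq_mul.
Qed.

Lemma sim_cost_mono M c d s s' n n' : s <= s' -> n <= n' -> sim_cost M c d s n <= sim_cost M c d s' n'.
Proof.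
by move=> Hs Hn; rewrite /sim_cost !leq_add // ?leq_mul // loop_factor_mono.
Qed.

(** The code of [Some b] is [[:: true; b]]; dropping its first bit leaves the answer on top of
    register 2. *)
Lemma sim_answer M x t b : runs_within M x t [:: b] ->
  forall c d, t = polyb c d (size x) ->
  forall out clk rest, ohead (reg (exec (Pop 2) (sim_regs out clk rest
    (iter (polyb c d (size x)) (@step M) (init M x)))) 2) = Some b.
Proof.
move=> Hr c d Et out clk rest; rewrite Et in Hr; have := sim_output Hr.
case: (iter _ _ _) => [q [[l a] r]] /=.
by case: a => [a|] //= [->].
Qed.

Lemma pbounded_sim_cost M c d s t : pbounded s -> pbounded t ->
  pbounded (fun n => sim_cost M c d (s n) (t n)).
Proof.
move=> Hs Ht; have CC := pbounded_const; rewrite /sim_cost.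
have affine a b : pbounded (fun n => t n * a + b) by exact: pbounded_add (pbounded_mul Ht (CC a)) (CC b).
apply: pbounded_add; last first.
  apply: pbounded_mul (CC _); exact: pbounded_comp (pbounded_loop_factor _) Ht.
apply: pbounded_add (CC 3); apply: pbounded_add (affine 5 2); apply: pbounded_add (affine 2 2).
exact: pbounded_add (pbounded_mul (CC 2) Hs) (CC 8).
Qed.

(** * P is contained in NP *)

Fixpoint unpair (z : seq bool) : seq bool :=
  if z is b1 :: b2 :: z' then if b1 == b2 then b1 :: unpair z' else [::] else [::].

Lemma unpair_enc x w : unpair (pair_enc x w) = x.
Proof. by elim: x => [|b x IH] //=; rewrite eqxx IH. Qed.

Definition unpair_step : cmd :=
  Test 5 Skip
    (Pop 5 ;; Test 5 Skip (Pop 5 ;; Push 0 false) (clear 5))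
    (Pop 5 ;; Test 5 Skip (clear 5) (Pop 5 ;; Push 0 true)).

Definition unpair_regs (p : seq bool * seq bool) : state :=
  [:: p.1; [::]; [::]; [::]; [::]; p.2].

Definition unpair_fun (p : seq bool * seq bool) : seq bool * seq bool :=
  match p.2 with
  | b1 :: b2 :: z' => if b1 == b2 then (b1 :: p.1, z') else (p.1, [::])
  | _ => (p.1, [::])
  end.

Lemma spec_unpair_step p n : size p.2 <= n ->
  spec unpair_step (unpair_regs p) (unpair_regs (unpair_fun p)) (2 * n + 8).
Proof.
case: p => out [|b1 [|b2 z]] /= Hn; [by split => //=; lia|by split; case: b1 => //=; lia|].
have [E C] := @spec_clear 5 (unpair_regs (out, b2 :: z)) isT.
rewrite /spec /unpair_fun /unpair_regs /= in E C *.
case: (b1 =P b2) => [<-|Hb]; first by split; case: b1 {E C}; rewrite //=; lia.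
by case: b1 b2 Hb E C => [] [] //= _ E C; rewrite E; split=> //=; move: C; rewrite /=; lia.
Qed.

Lemma iter_unpair out z n : size z <= n -> iter n unpair_fun (out, z) = (rev (unpair z) ++ out, [::]).
Proof.
have stop k o : iter k unpair_fun (o, [::]) = (o, [::]) by elim: k => //= k ->.
elim: n z out => [|n IH] z out; first by case: z.
case: z => [|b1 [|b2 z]] Hn; rewrite ?iterSr /unpair_fun /= ?stop //.
case: eqP => _; rewrite ?stop // IH; last by move: Hn => /=; lia.
by rewrite rev_cons cat_rcons.
Qed.

Lemma size_iter_unpair p n : size (iter n unpair_fun p).2 <= size p.2.
Proof.
elim: n => //= n; apply: leq_trans; case: (iter n _ _) => o [|b1 [|b2 z]] //=.
by rewrite /unpair_fun /=; case: eqP => //= _; lia.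
Qed.

Lemma size_unpair z : size (unpair z) <= size z.
Proof.
move: {2}(size z) (leqnn (size z)) => n; elim: n z => [|n IH] [|b1 [|b2 z]] //= Hn.
by case: eqP => //= _; have := IH z; lia.
Qed.

Lemma inP_inNP (L : seq bool -> bool) : inP L -> inNP L.
Proof.
case=> M [c [d HM]]; exists (fun z => L (unpair z)), 0, 0; split; last first.
  move=> x; split; first by move=> Lx; exists [::]; rewrite ?unpair_enc.
  by case=> w _; rewrite unpair_enc.
pose prog := For 5 unpair_step ;; sim_prog M c d ;; Pop 2.
pose t n := (n * (2 * n + 8).+1 + 2) + (sim_cost M c d 0 n + 1).
have dec z : spec (For 5 unpair_step) (init_state 5 z)
    [:: rev (unpair z); [::]; [::]; [::]; [::]; [::]] (size z * (2 * size z + 8).+1 + 2).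
  have := @spec_for 5 unpair_step (fun i => unpair_regs (iter i unpair_fun ([::], z))) (size z)
    (2 * size z + 8) erefl.
  rewrite (iter_unpair _ (leqnn _)) cats0; apply=> i _.
  exact: spec_unpair_step (size_iter_unpair _ _).
have sim z := spec_sim M c d (unpair z) [::] [::] [::] [::] [:: [::]].
have run z : spec prog (init_state 5 z) (exec (Pop 2) _) _ :=
  spec_seq (dec z) (spec_seq (sim z) (conj erefl (leqnn _))).
apply: (@program_inP _ prog 5 2 t).
- by move=> z; have [-> _] := run z; exact: sim_answer (HM _) _ _ erefl _ _ _.
- have CC := pbounded_const.
  apply: pbounded_add; last first.
    exact: pbounded_add (pbounded_sim_cost _ _ _ (CC 0) pbounded_id) (CC 1).
  apply: pbounded_add (CC 2); apply: pbounded_mul pbounded_id (pbounded_succ _).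
  exact: pbounded_add (pbounded_mul (CC 2) pbounded_id) (CC 8).
- move=> z; have [_ C] := run z; apply: leq_trans C _.
  rewrite /t leq_add2l leq_add2r.
  exact: sim_cost_mono (size_unpair z).
Qed.

(** * The gadget *)

Definition matrix_instance (k m : nat) (rows : seq (seq bool)) : instance := {|
  nv := size rows; nc := m;
  ballot := [ffun i : 'I_(size rows) => [set j : 'I_m | nth false (nth [::] rows i) j]];
  csize := k |}.

Lemma map_enum_ord T (x : T) (u : seq T) n : size u = n ->
  [seq nth x u i | i : 'I_n <- enum 'I_n] = u.
Proof.
move=> <-; rewrite (map_comp (nth x u) (@nat_of_ord _)) val_enum_ord.
exact: mkseq_nth.
Qed.

Lemma enc_matrix_instance k m rows : all (fun r => size r == m) rows ->
  enc_instance (matrix_instance k m rows) =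
  enc_nat k ++ enc_nat (size rows) ++ enc_nat m ++ flatten rows.
Proof.
move=> /allP Hm; rewrite /enc_instance /=; do 3!congr (_ ++ _); congr flatten.
rewrite -[RHS](map_enum_ord [::] (erefl (size rows))); apply: eq_map => i.
rewrite ffunE -[RHS](map_enum_ord false (n := m)); last first.
  by apply/eqP/Hm/mem_nth.
by apply: eq_map => j; rewrite inE.
Qed.

Lemma card_nth_count T (x : T) (u : seq T) n (a : pred T) : size u = n ->
  #|[set i : 'I_n | a (nth x u i)]| = count a u.
Proof.
by move=> <-; rewrite cardsE -sum1_card -sum1_count (big_nth x) big_mkord.
Qed.

Lemma jr_degree_represented (I : instance) W d G :
  d <= jr_degree I W -> cohesive I G -> d <= represented I W G.
Proof.
move=> Hd HG; apply: leq_trans Hd _; apply/bigmax_leqP => c /forallP/(_ G).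
by rewrite HG.
Qed.

Lemma opt_jr_ge (I : instance) (W : {set 'I_(nc I)}) d : #|W| = csize I -> d <= nv I ->
  (forall G, cohesive I G -> d <= represented I W G) -> d <= opt_jr I.
Proof.
move=> HW Hd H; apply: leq_trans (leq_bigmax_cond W _); last by rewrite HW.
have Hd' : d < (nv I).+1 by [].
apply: (@leq_trans (Ordinal Hd')) => //.
apply: (leq_bigmax_cond (F := fun c : 'I_(nv I).+1 => c : nat)).
by apply/forallP => G; apply/implyP/H.
Qed.

Section Gadget.
Variables (core : seq (seq bool)) (w b s : nat).
Hypotheses (core_size : all (fun r => size r == w) core) (core_has : all (has id) core).
Hypotheses (b_core : b < size core) (b_w : b <= w) (s_gt0 : 0 < s).

(** The solution [D] of the balance equation [size core * s + 1 + D * (s - 1) = (b + D) * s]: core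
    copies, shared voter and dummy voters on the left, [k * s] on the right. *)
Definition dummies : nat := (size core - b) * s + 1.
Local Notation D := dummies.

Definition dummy_row (j : nat) : seq bool :=
  nseq w false ++ nseq j false ++ true :: nseq (D.-1 - j) false.

Definition shared_row : seq bool := nseq w false ++ nseq D true.

(* Each of the D dummy candidates is approved by s - 1 voters of its own and by the shared voter,
   so leaving it out of the committee caps the degree at 1.  This forces D picks at the price of
   one voter less per pick, and the voters saved make room for the core rows. *)
Definition gadget_rows : seq (seq bool) :=
  flatten [seq nseq s (r ++ nseq D false) | r <- core] ++
  shared_row :: flatten [seq nseq s.-1 (dummy_row j) | j <- iota 0 D].
Local Notation rows := gadget_rows.

Definition gadget : instance := matrix_instance (b + D) (w + D) rows.

Lemma size_flatten_nseq T U (f : T -> seq U) n u :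
  size (flatten [seq nseq n (f x) | x <- u]) = n * size u.
Proof. by elim: u => [|x u IH] /=; rewrite ?muln0 // size_cat size_nseq IH mulnS. Qed.

Lemma size_gadget_rows : size rows = (b + D) * s.
Proof.
rewrite size_cat /= !size_flatten_nseq // size_iota /D.
by move: b_core s_gt0; move: (size core) => g ? ?; nia.
Qed.

Lemma size_row r : r \in rows -> size r = w + D.
Proof.
have D0 : 0 < D by rewrite /D addn1.
rewrite mem_cat inE => /or3P[/flatten_mapP[r0 Hr0]|/eqP->|/flatten_mapP[j]].
- rewrite mem_nseq => /andP[_ /eqP->]; rewrite size_cat size_nseq.
  by rewrite (eqP (allP core_size _ Hr0)).
- by rewrite size_cat !size_nseq.
- rewrite mem_iota mem_nseq => Hj /andP[_ /eqP->]; rewrite !size_cat /= !size_nseq.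
  lia.
Qed.

Lemma gadget_enc : enc_instance gadget =
  enc_nat (b + D) ++ enc_nat ((b + D) * s) ++ enc_nat (w + D) ++ flatten rows.
Proof.
rewrite enc_matrix_instance ?size_gadget_rows //.
by apply/allP => r /size_row ->.
Qed.

(** There are exactly [k * s] voters, so cancelling [k] in the size condition leaves the threshold
    [s]. *)
Lemma gadget_cohesive (G : {set 'I_(nv gadget)}) : cohesive gadget G =
  (s <= #|G|) && [exists c : 'I_(w + D), [forall i in G, nth false (nth [::] rows i) c]].
Proof.
have k0 : 0 < b + D by rewrite /D addn1 addnS.
rewrite /cohesive; congr andb.
  rewrite -[s <= _](leq_pmul2r k0) [s * _]mulnC; congr leq; exact: size_gadget_rows.
by apply: eq_existsb => c; apply: eq_forallb => i; rewrite ffunE inE.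
Qed.

Definition hits (r y : seq bool) : Prop := exists2 j, nth false r j & nth false y j.

Lemma nth_lt (u : seq bool) j : nth false u j -> j < size u.
Proof. by case: ltnP => // H; rewrite nth_default. Qed.

Lemma core_hits r h t : r \in core -> size h = w -> hits (r ++ nseq D false) (h ++ t) -> hits r h.
Proof.
move=> Hr Hh [j]; have Sr := eqP (allP core_size _ Hr).
rewrite !nth_cat Sr Hh; case: ltnP => Hj A B; first by exists j.
by move: A; rewrite nth_nseq if_same.
Qed.

Lemma approves_hits (i : 'I_(size rows)) y : size y = w + D ->
  (ballot gadget i :&: dec_committee (nc gadget) y != set0) <-> hits (nth [::] rows i) y.
Proof.
move=> Hy; split.
  by case/set0Pn => j; rewrite !inE ffunE inE => /andP[A B]; exists j.
case=> j A B; have Hj := nth_lt B; rewrite Hy in Hj.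
by apply/set0Pn; exists (Ordinal Hj); rewrite !inE ffunE inE A.
Qed.

Lemma count_core r : r \in core -> s <= count_mem (r ++ nseq D false) rows.
Proof.
move=> Hr; rewrite count_cat; apply: leq_trans (leq_addr _ _).
elim: core Hr => //= r0 u IH; rewrite inE count_cat => /orP[/eqP<-|/IH Hu].
  by rewrite count_nseq /= eqxx mul1n leq_addr.
exact: leq_trans Hu (leq_addl _ _).
Qed.

Lemma count_dummy j : j < D -> s.-1 <= count_mem (dummy_row j) rows.
Proof.
move=> Hj; rewrite count_cat /=; do 2!apply: leq_trans (leq_addl _ _).
have : j \in iota 0 D by rewrite mem_iota.
elim: (iota 0 D) => //= i u IH; rewrite inE count_cat => /orP[/eqP<-|/IH Hu].
  by rewrite count_nseq /= eqxx mul1n leq_addr.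
exact: leq_trans Hu (leq_addl _ _).
Qed.

(** The copies of any one core row form a cohesive group, since the row approves some candidate. *)
Lemma gadget_valid : valid_instance gadget.
Proof.
split; first by rewrite /= /D; lia.
have Hr : nth [::] core 0 \in core by apply: mem_nth; apply: leq_ltn_trans b_core.
set r := nth [::] core 0 in Hr.
exists [set i : 'I_(size rows) | nth [::] rows i == r ++ nseq D false].
rewrite gadget_cohesive (@card_nth_count _ _ _ _ (pred1 _)) // count_core //=.
have /(has_nthP false)[j Hj Hn] := allP core_has _ Hr.
have Hj' : j < w + D by rewrite (eqP (allP core_size _ Hr)) in Hj; apply: ltn_addr.
apply/existsP; exists (Ordinal Hj'); apply/forall_inP => i; rewrite inE => /eqP -> /=.
by rewrite nth_cat Hj.
Qed.

Lemma dummy_picked y j : size y = w + D ->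
  2 <= jr_degree gadget (dec_committee (nc gadget) y) -> j < D -> nth false y (w + j).
Proof.
move=> Hy Hd Hj; apply/negPn/negP => Hn.
have D2 : 1 < D by rewrite /D; move: b_core s_gt0; nia.
have nth_dummy i : nth false (dummy_row j) (w + i) = (i == j).
  rewrite nth_cat size_nseq ltnNge leq_addr /= addKn nth_cat size_nseq nth_nseq.
  case: (ltngtP i j) => [|H|->]; rewrite ?subnn // -(subnSK H) /=.
  by rewrite nth_nseq if_same.
have Hz : size (flatten [seq nseq s (r ++ nseq D false) | r <- core]) < size rows.
  by rewrite [size rows]size_cat /=; lia.
pose z : 'I_(size rows) := Ordinal Hz.
have nz : nth [::] rows z = shared_row by rewrite /= nth_cat ltnn subnn.
pose E := [set i : 'I_(size rows) | nth [::] rows i == dummy_row j].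
have zE : z \notin E.
  (* The shared row is told from dummy row [j] by looking at dummy [0], or at dummy [1] when
     [j = 0]. The second case uses [1 < D]. *)
  rewrite inE nz; apply/eqP => /(congr1 (fun u => nth false u (w + (j == 0)))).
  rewrite nth_dummy nth_cat size_nseq ltnNge leq_addr /= addKn nth_nseq.
  by case: j {nth_dummy E Hn} Hj => [|j] Hj /=; rewrite ?D2 ?(ltn_trans _ D2).
have coh : cohesive gadget (z |: E).
  rewrite gadget_cohesive cardsU1 zE (@card_nth_count _ _ _ _ (pred1 _)) //.
  apply/andP; split; first by have := count_dummy Hj; lia.
  have Hwj : w + j < w + D by rewrite ltn_add2l.
  apply/existsP; exists (Ordinal Hwj); apply/forall_inP => i.
  rewrite !inE => /orP[/eqP->|/eqP->]; last by rewrite /= nth_dummy.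
  by rewrite nz nth_cat size_nseq ltnNge leq_addr /= addKn nth_nseq Hj.
have := jr_degree_represented Hd coh; apply/negP; rewrite -leqNgt.
rewrite -(cards1 z); apply/subset_leq_card/subsetP => i.
rewrite !inE => /andP[/orP[//|/eqP Ei]] /approves_hits => /(_ Hy); rewrite Ei => -[l].
case: (ltnP l w) => Hl; first by rewrite nth_cat size_nseq Hl nth_nseq Hl.
by rewrite -(subnKC Hl) nth_dummy => /eqP->; rewrite (negbTE Hn).
Qed.

(** All dummies are in the committee, which leaves exactly [b] picks for the core. The copies of a
    core row form a cohesive group of identical voters, so one represented member already means that
    the row is hit. *)
Lemma gadget_sound y : size y = w + D -> #|dec_committee (nc gadget) y| = b + D ->
  2 <= jr_degree gadget (dec_committee (nc gadget) y) ->
  count id (take w y) = b /\ forall r, r \in core -> hits r (take w y).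
Proof.
move=> Hy Hc Hd; split.
  rewrite (@card_nth_count _ _ _ _ id) // -{1}(cat_take_drop w y) count_cat in Hc.
  have Sd : size (drop w y) = D by rewrite size_drop Hy addKn.
  suff Ed : all id (drop w y) by rewrite all_count in Ed; rewrite (eqP Ed) Sd in Hc; apply: addIn Hc.
  apply/(all_nthP false) => j; rewrite Sd nth_drop.
  exact: dummy_picked.
move=> r Hr; set E := [set i : 'I_(size rows) | nth [::] rows i == r ++ nseq D false].
have coh : cohesive gadget E.
  rewrite gadget_cohesive (@card_nth_count _ _ _ _ (pred1 _)) // count_core //=.
  have /(has_nthP false)[j Hj Hn] := allP core_has _ Hr.
  have Hj' : j < w + D by rewrite (eqP (allP core_size _ Hr)) in Hj; apply: ltn_addr.
  apply/existsP; exists (Ordinal Hj'); apply/forall_inP => i; rewrite inE => /eqP -> /=.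
  by rewrite nth_cat Hj.
have /(leq_trans (ltn0Sn 1)) := jr_degree_represented Hd coh.
rewrite card_gt0 => /set0Pn[i]; rewrite !inE => /andP[/eqP Ei /approves_hits -/(_ Hy)].
rewrite Ei -{1}(cat_take_drop w y); apply: core_hits => //.
by rewrite size_takel // Hy leq_addr.
Qed.

(** The hitting set together with all dummies represents every voter, so each cohesive group counts
    in full, with at least [s] members. *)
Lemma gadget_complete h : size h = w -> count id h = b ->
  (forall r, r \in core -> hits r h) -> s <= opt_jr gadget.
Proof.
move=> Hh Hb Hc; pose y := h ++ nseq D true.
have Hy : size y = w + D by rewrite size_cat Hh size_nseq.
have hit r : r \in rows -> hits r y.
  have D0 : 0 < D by rewrite /D addn1.
  rewrite mem_cat inE => /or3P[/flatten_mapP[r0 Hr0]|/eqP->|/flatten_mapP[j]].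
  - rewrite mem_nseq => /andP[_ /eqP->]; have [j A B] := Hc _ Hr0.
    by exists j; rewrite nth_cat nth_lt.
  - by exists w; rewrite nth_cat ?size_nseq ?Hh ltnn subnn nth_nseq D0.
  - rewrite mem_iota mem_nseq => /= Hj /andP[_ /eqP->]; exists (w + j).
      by rewrite !nth_cat !size_nseq ltnNge leq_addr /= addKn ltnn subnn.
    by rewrite nth_cat Hh ltnNge leq_addr /= addKn nth_nseq Hj.
apply: (@opt_jr_ge gadget (dec_committee (nc gadget) y)).
- by rewrite (@card_nth_count _ _ _ _ id) // count_cat Hb count_nseq mul1n.
- by rewrite /= size_gadget_rows leq_pmull // /D addn1 addnS.
- move=> G; rewrite gadget_cohesive => /andP[Hs _]; apply: leq_trans Hs _.
  apply/subset_leq_card/subsetP => i Hi; rewrite inE Hi.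
  by apply/approves_hits => //; apply/hit/mem_nth.
Qed.

End Gadget.

(** * Space-time diagrams *)

Section SpaceTime.
Variable V : TM.
Local Notation Q := 'I_(tm_nq V).+1.

(* A tape cell of a configuration: the state if the head is there, and the symbol.  The head
   state None is an additional initial state, entered on the blank before the input. *)
Definition letter : finType := (option (option Q) * sym)%type.

Definition action (p : option Q) (s : sym) : Q * sym * move :=
  match p with
  | None => (ord0, s, MoveR)
  | Some q => if tm_halt V q then (q, s, Stay) else tm_delta V q s
  end.

Definition arrives (a : letter) (mv : move) : option Q :=
  if a.1 is Some p then
    let: (q, _, mv') := action p a.2 in
    match mv, mv' with
    | MoveL, MoveL | MoveR, MoveR | Stay, Stay => Some q
    | _, _ => None
    end
  else None.

Definition written (a : letter) : sym :=
  if a.1 is Some p then (action p a.2).1.2 else a.2.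

(** The outer letters matter only through a head that moves onto the middle cell. This is what makes
    the wrapped neighbours at the ends of a row harmless. *)
Definition local_rule (a b c : letter) : letter :=
  (if arrives b Stay is Some q then Some (Some q)
   else if arrives a MoveR is Some q then Some (Some q)
   else if arrives c MoveL is Some q then Some (Some q) else None, written b).

Definition blank : letter := (None, None).

Definition rejecting (a : letter) : bool :=
  if a.1 is Some (Some q) then tm_halt V q && (a.2 != Some true) else false.

Variable z : seq bool.

Definition fconfig := (option Q * ftape * Z)%type.

Definition fstep (c : fconfig) : fconfig :=
  let: (p, f, h) := c in
  let: (q, s, mv) := action p (f h) in (Some q, fupd f h s, (h + displ mv)%Z).

Definition run (t : nat) : fconfig := iter t fstep (None, input_tape z, (-1)%Z).

Definition cell (t : nat) (i : Z) : letter :=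
  let: (p, f, h) := run t in (if Z.eqb i h then Some p else None, f i).

Definition head_at (t : nat) : Z := (run t).2.

Lemma cell_head t i : i <> head_at t -> (cell t i).1 = None.
Proof. by rewrite /cell /head_at; case: run => [[p f] h] /= /Z.eqb_neq ->. Qed.

Lemma head_bound t : (- Z.of_nat t - 1 <= head_at t <= Z.of_nat t + 1)%Z.
Proof.
elim: t => [|t]; first by rewrite /head_at /=; lia.
rewrite /head_at /run iterS -/(run t); case: (run t) => [[p f] h] /=.
by case: action => [[q s] mv] /=; case: mv => /=; lia.
Qed.

Lemma cell_step t i :
  cell t.+1 i = local_rule (cell t (i - 1)%Z) (cell t i) (cell t (i + 1)%Z).
Proof.
rewrite /cell /run iterS -/(run t); case: (run t) => [[p f] h] /=.
rewrite /local_rule /arrives /written.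
case E: (action p (f h)) => [[q s] mv]; rewrite /fupd.
case: (Z.eqb_spec i h) => [->|Hi] /=.
  rewrite E /=.
  have -> : (h - 1 =? h)%Z = false by apply/Z.eqb_neq; lia.
  have -> : (h + 1 =? h)%Z = false by apply/Z.eqb_neq; lia.
  by case: mv {E} => /=; case: Z.eqb_spec => //; lia.
case: (Z.eqb_spec (i - 1)%Z h) => [El|Hl] /=.
  have -> : (i + 1 =? h)%Z = false by apply/Z.eqb_neq; lia.
  rewrite El E /=.
  by case: mv {E} => /=; case: Z.eqb_spec => //; lia.
case: (Z.eqb_spec (i + 1)%Z h) => [Er|Hr] /=.
  rewrite Er E /=.
  by case: mv {E} => /=; case: Z.eqb_spec => //; lia.
by case: mv {E} => /=; case: Z.eqb_spec => //; lia.
Qed.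

(** The opening step only moves the head from the blank at [-1] to position [0], so the diagram is
    one step behind the machine. *)
Lemma run_config t : let c := iter t (@step V) (init V z) in
  exists f h, run t.+1 = (Some c.1, f, h) /\ represents c.2 f h.
Proof.
elim: t => [|t [f [h [Hr R]]]] c.
  by exists (input_tape z), 0%Z; split; [rewrite /run /= fupd_id|exact: represents_init].
rewrite /run iterS -/(run t.+1) Hr /c iterS.
move: (iter t _ _) R => [q [[l a] r]] R /=.
have [Ea _ _] := R; rewrite -Ea.
case: ifP => Hh.
  by exists f, h; rewrite {1}Ea fupd_id Z.add_0_r.
case: tm_delta => [[q' s] mv]; exists (fupd f h s), (h + displ mv)%Z; split=> //.
exact: represents_step R.
Qed.

Variables (T0 : nat) (b : bool).
Hypothesis runs : runs_within V z T0 [:: b].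

Lemma run_halted t : T0 < t -> exists q f,
  [/\ run t = (Some q, f, head_at t), tm_halt V q & f (head_at t) = Some b].
Proof.
case: t => // t Ht; have [t0 Ht0 [Hh Ho]] := runs.
have E : iter t (@step V) (init V z) = iter t0 (@step V) (init V z).
  have Ht' : t0 <= t by apply: leq_trans Ht0 Ht.
  rewrite -(subnK Ht') iterD; apply: iter_fix.
  by move: (iter t0 _ _) Hh => [q [[l a] r]] /= Hh; rewrite /step Hh.
have [f [h [Er R]]] := run_config t; rewrite E in Er R.
exists (iter t0 (@step V) (init V z)).1, f; rewrite /head_at Er; split=> //=.
move: (iter t0 _ _) R Ho => [q [[l a] r]] /= [-> _ _].
by case: (f h) => [b'|] //= [->].
Qed.

Lemma cell_rejecting t : T0 < t -> rejecting (cell t (head_at t)) = ~~ b.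
Proof.
move=> /run_halted[q [f [E Hq Hf]]]; rewrite /cell E Z.eqb_refl /rejecting /= Hq Hf.
by case: b.
Qed.

(** Halting is permanent: a rejecting cell at an early time would still be there after [T0], where
    the head shows the answer [b]. *)
Lemma cell_not_rejecting t i : b -> ~~ rejecting (cell t i).
Proof.
move=> Hb; case: (Z.eqb_spec i (head_at t)) => [->|/cell_head E]; last by rewrite /rejecting E.
case: (ltnP T0 t) => Ht; first by rewrite cell_rejecting // Hb.
rewrite /cell /head_at /rejecting; case E: (run t) => [[p f] h] /=; rewrite Z.eqb_refl.
case: p E => // q E; apply/andP => -[Hq Ha].
have stays k : run (k + t) = run t.
  rewrite /run iterD; apply: iter_fix.
  by rewrite -/(run t) E /= Hq /= fupd_id Z.add_0_r.
have := @cell_rejecting (T0.+1 - t + t).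
rewrite /cell /head_at stays E Z.eqb_refl /rejecting /= Hq Ha Hb => H.
by suff : true = false by []; apply: H; lia.
Qed.

End SpaceTime.

(** * The tableau as a hitting-set instance *)

Section Grid.
Variable T : finType.
Implicit Types (F : nat -> pred T) (y : seq bool).

Definition block (B : pred T) : seq bool := map B (enum T).

Definition grid F m n : seq bool := flatten [seq block (F u) | u <- iota m n].

Definition at_cell y u (x : T) : bool := nth false y (#|T| * u + index x (enum T)).

Lemma size_block B : size (block B) = #|T|.
Proof. by rewrite size_map -cardE. Qed.

Lemma size_grid F m n : size (grid F m n) = #|T| * n.
Proof.
rewrite /grid; elim: n m => [|n IH] m /=; first by rewrite muln0.
by rewrite size_cat size_block IH mulnS.
Qed.

Lemma index_enum_lt (x : T) : index x (enum T) < #|T|.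
Proof. by rewrite cardE index_mem mem_enum. Qed.

Lemma nth_block (x : T) B : nth false (block B) (index x (enum T)) = B x.
Proof. by rewrite (nth_map x) ?nth_index ?index_mem ?mem_enum. Qed.

Lemma at_grid F m n u x : u < n -> at_cell (grid F m n) u x = F (m + u) x.
Proof.
rewrite /at_cell /grid; elim: n m u => // n IH m [|u] Hu /=.
  by rewrite muln0 nth_cat size_block index_enum_lt nth_block addn0.
rewrite nth_cat size_block mulnS -addnA ltnNge leq_addr /= addKn.
by rewrite IH // addSnnS.
Qed.

Lemma hits_grid F n y : hits (grid F 0 n) y <->
  exists u x, [/\ u < n, F u x & at_cell y u x].
Proof.
split=> [[j Hg Hy]|[u [x [Hu HF Hy]]]]; last first.
  by exists (#|T| * u + index x (enum T)) => //; have := at_grid F 0 x Hu; rewrite /at_cell add0n => ->.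
have Hs := nth_lt Hg; rewrite size_grid in Hs.
have [u [x [E H1 H2]]] : exists u x,
    [/\ j = #|T| * u + index x (enum T), #|T| * u <= j & j < #|T| * u.+1].
  have T0 : 0 < #|T| by case: #|T| Hs => [|//]; lia.
  have x0 : T by apply: (enum_val (A := T)); apply: (Ordinal T0).
  exists (j %/ #|T|), (nth x0 (enum T) (j %% #|T|)); split.
  - by rewrite index_uniq ?enum_uniq -?cardE ?ltn_mod // mulnC -divn_eq.
  - by rewrite mulnC leq_divM.
  - by rewrite mulnC ltn_ceil.
have Hu : u < n by move: H1 Hs; case: #|T| H2 => [|k]; nia.
exists u, x; split=> //; last by rewrite /at_cell -E.
by have := at_grid F 0 x Hu; rewrite /at_cell -E Hg add0n => <-.
Qed.

Definition block_count y u : nat := count id (take #|T| (drop (#|T| * u) y)).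

Lemma count_blocks y n : size y = #|T| * n -> count id y = \sum_(u < n) block_count y u.
Proof.
elim: n y => [|n IH] y Hy.
  by rewrite big_ord0; rewrite muln0 in Hy; rewrite (size0nil Hy).
rewrite -{1}(cat_take_drop #|T| y) count_cat big_ord_recl /block_count muln0 drop0.
congr addn; rewrite IH; last by rewrite size_drop Hy mulnS addKn.
by apply: eq_bigr => u _; rewrite /block_count drop_drop lift0 mulnS addnC.
Qed.

Lemma nth_block_count y u (x : T) :
  at_cell y u x = nth false (take #|T| (drop (#|T| * u) y)) (index x (enum T)).
Proof. by rewrite nth_take ?index_enum_lt // nth_drop. Qed.

Lemma block_count_ge1 y u x : at_cell y u x -> 0 < block_count y u.
Proof.
rewrite nth_block_count -has_count => H; apply/(has_nthP false).
by exists (index x (enum T)) => //; apply: nth_lt.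
Qed.

Lemma block_count_le1 y u x x' : block_count y u <= 1 -> at_cell y u x -> at_cell y u x' -> x = x'.
Proof.
rewrite /block_count !nth_block_count; set s := take _ _.
rewrite -(@card_nth_count _ false s (size s) id) // => /card_le1_eqP H A A'.
apply: (@index_inj _ x (enum T)); rewrite ?mem_enum //=.
have := H (Ordinal (nth_lt A)) (Ordinal (nth_lt A')); rewrite !inE => /(_ A A').
by move/(congr1 val).
Qed.

(** Pigeonhole: each of the first [n] blocks holds at least one of the [n] picks, hence exactly one,
    and the last block holds none. *)
Lemma one_pick y n : size y = #|T| * n.+1 -> count id y = n ->
  (forall u, u < n -> exists x, at_cell y u x) ->
  forall u x x', u < n -> at_cell y u x -> at_cell y u x' -> x = x'.
Proof.
move=> Hy Hc H u x x' Hu; apply: block_count_le1.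
have G v : v < n -> 0 < block_count y v by move=> /H[t /block_count_ge1].
have : \sum_(v < n) (block_count y v - 1) = 0.
  rewrite sumnB => [|v _]; last exact: G.
  apply/eqP; rewrite subn_eq0 sum1_card card_ord.
  have E := count_blocks Hy; rewrite Hc big_ord_recr /= in E.
  by rewrite [X in _ <= X]E leq_addr.
move/eqP; rewrite sum_nat_eq0 => /forallP/(_ (Ordinal Hu))/eqP /=.
by move: (G u Hu); lia.
Qed.

Lemma count_onehot (a : nat -> T) n : count id (grid (fun u => pred1 (a u)) 0 n) = n.
Proof.
rewrite /grid count_flatten -map_comp (eq_map (g := fun=> 1)); last first.
  move=> u /=; rewrite /block count_map (eq_count (a2 := pred1 (a u))) //.
  by rewrite count_uniq_mem ?enum_uniq // mem_enum.
have E k m : sumn [seq 1 | _ <- iota m k] = k by elim: k m => //= k IH m; rewrite IH.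
exact: E.
Qed.

End Grid.

Lemma grid_cat (T : finType) (F : nat -> pred T) m n1 n2 :
  grid F m (n1 + n2) = grid F m n1 ++ grid F (m + n1) n2.
Proof. by rewrite /grid iotaD map_cat flatten_cat. Qed.

Lemma eq_grid (T : finType) (F G : nat -> pred T) m n :
  (forall u, m <= u < m + n -> F u =1 G u) -> grid F m n = grid G m n.
Proof.
move=> H; rewrite /grid; congr flatten; apply/eq_in_map => u; rewrite mem_iota => Hu.
by apply: eq_map; apply: H.
Qed.
Lemma grid0 (T : finType) m n :
  grid (fun=> pred0 : pred T) m n = nseq (#|T| * n) false.
Proof.
rewrite /grid; elim: n m => [|n IH] m /=; first by rewrite muln0.
rewrite IH mulnS nseqD; congr (_ ++ _).
by rewrite /block cardE; elim: (enum T) => //= a l ->.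
Qed.

Lemma onth_cat T (u v : seq T) i :
  onth (u ++ v) i = if i < size u then onth u i else onth v (i - size u).
Proof. by elim: u i => [|a u IH] [|i] //=; rewrite IH. Qed.

Lemma onth_default T (u : seq T) i : size u <= i -> onth u i = None.
Proof. by elim: u i => [|a u IH] [|i] //= /IH. Qed.

(** [pmap] drops the blanks, and this shifts no position because a blank is followed only by
    blanks. *)
Lemma onth_pmap_mono T (s : nat -> option T) m k :
  (forall i, m <= i -> i.+1 < m + k -> s i = None -> s i.+1 = None) ->
  forall i, i < k -> onth (pmap s (iota m k)) i = s (m + i).
Proof.
elim: k m => // k IH m H i Hi /=.
case E: (s m) => [b|] /=; last first.
  have N j : j < k.+1 -> s (m + j) = None.
    by elim: j => [|j IHj] Hj; rewrite ?addn0 // addnS H //; [lia|lia|apply: IHj; lia].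
  rewrite N // (_ : pmap s _ = [::]); first by case: (i).
  have : forall j, j \in iota m.+1 k -> s j = None.
    by move=> j; rewrite mem_iota => Hj; have := N (j - m); rewrite subnKC; [apply|]; lia.
  elim: (iota m.+1 k) => //= j u IHu Hu; rewrite Hu ?mem_head //=.
  by apply: IHu => l Hl; apply: Hu; rewrite inE Hl orbT.
case: i Hi => [|i] Hi; first by rewrite addn0.
rewrite /= IH ?addSnnS // => j Hj1 Hj2; apply: H; lia.
Qed.

Section Tableau.
Variables (V : TM) (L : seq bool -> bool) (rows wl : nat) (x : seq bool).
Local Notation letter := (letter V).
Local Notation blank := (blank V).

Definition origin : nat := rows + 4.
Definition witness_at : nat := origin + (2 * size x + 2).
(** During [rows] steps the head stays within [rows + 1] cells of the first input position. The
    blanks on both sides of the input exceed this, so the head never reaches an end of a row. *)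
Definition width : nat := rows + rows + 10 + (2 * size x + wl).
(** Rows [0] to [rows] end to end, and one more cell. The window at cells [u], [u + 1], [u + 2]
    determines cell [u + P + 1]; so [items] prescribes the first [P + 1] cells, and the windows with
    [u < P * rows] account for all the others. *)
Definition ncells : nat := width * rows + width + 1.
Local Notation P := width.
Local Notation N := ncells.

Definition bit_letter (b : bool) : letter := (None, Some b).
Definition start_letter : letter := (Some None, None).

Definition input_letter (a : letter) : bool := (a.1 == None).

(* The cells of the initial row and the first one of the next row; None stands for the cells of
   the witness, which are only required to form a word followed by blanks. *)
Definition items : seq (option letter) :=
  nseq (rows + 3) (Some blank) ++ Some start_letter ::
  [seq Some (bit_letter b) | b <- pair_enc x [::]] ++
  nseq wl None ++ nseq (rows + 5) (Some blank).

(** All clauses are given the shape of a window, with empty predicates where nothing is wanted, so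
    that a single program can print every kind of row. *)
Definition pattern u (B1 B2 B3 B4 : pred letter) : nat -> pred letter := fun v a =>
  [|| (v == u) && B1 a, (v == u.+1) && B2 a, (v == u.+2) && B3 a | (v == u + P + 1) && B4 a].

(** The block of index [N] is padding for which no pick is left. It makes the last stretch of empty
    cells exactly [P * rows - u] long, a number that the printing program keeps in a register. *)
Definition core_row u B1 B2 B3 B4 : seq bool := grid (pattern u B1 B2 B3 B4) 0 N.+1.

(** The second row of a witness cell says that a blank is followed by a blank, so that the witness
    cells spell a word. *)
Definition item_rows u (it : option letter) : seq (seq bool) :=
  match it with
  | Some a => [:: core_row u (pred1 a) pred0 pred0 pred0]
  | None => [:: core_row u input_letter pred0 pred0 pred0;
                core_row u (predC1 blank) (pred1 blank) pred0 pred0]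
  end.

Fixpoint init_rows u its : seq (seq bool) :=
  if its is it :: its' then item_rows u it ++ init_rows u.+1 its' else [::].

Definition window_row u (t : letter * letter * letter) : seq bool :=
  let: (a, b, c) := t in
  core_row u (predC1 a) (predC1 b) (predC1 c) (pred1 (local_rule a b c)).

Definition triples : seq (letter * letter * letter) := enum {: letter * letter * letter}.

(** The first row does double duty: it provides a letter that is not rejecting in cell [u + P + 1],
    and it thereby forces the pick in this cell on which the counting argument rests. *)
Definition main_rows u : seq (seq bool) :=
  core_row u pred0 pred0 pred0 (fun a => ~~ rejecting a) :: map (window_row u) triples.

Definition core : seq (seq bool) :=
  init_rows 0 items ++ flatten [seq main_rows u | u <- iota 0 (P * rows)].

Lemma size_pair w : size (pair_enc x w) = 2 * size x + 2 + size w.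
Proof.
by rewrite /pair_enc size_cat /=; elim: x => [|b u IH] /=; [rewrite muln0 | move: IH; lia].
Qed.

Lemma pair_cat w : pair_enc x w = pair_enc x [::] ++ w.
Proof. by rewrite /pair_enc -!catA. Qed.

Lemma size_items : size items = P.+1.
Proof.
rewrite /items size_cat size_nseq size_cons size_cat size_map size_pair size_cat !size_nseq /width /=.
lia.
Qed.

Lemma size_init_rows u its : size (init_rows u its) = size its + count (pred1 None) its.
Proof.
elim: its u => //= it its IH u; rewrite size_cat IH.
by case: it => [a|] /=; lia.
Qed.

Lemma count_items : count (pred1 None) items = wl.
Proof.
rewrite /items count_cat count_nseq [count _ (_ :: _)]/= count_cat count_map count_cat !count_nseq.
by rewrite (@eq_count _ (preim _ _) pred0) // count_pred0 /=; lia.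
Qed.

Lemma size_core : size core = N + (wl + size triples * (P * rows)).
Proof.
rewrite size_cat size_init_rows size_items count_items /ncells size_flatten /shape -map_comp.
have -> : [seq (size \o main_rows) u | u <- iota 0 (P * rows)] = nseq (P * rows) (size triples).+1.
  rewrite (eq_map (g := fun=> (size triples).+1)); last by move=> u; rewrite /= size_map.
  by elim: (P * rows) 0 => //= n IH m; rewrite IH.
rewrite sumn_nseq; lia.
Qed.

Lemma mem_init_rows r k its : r \in init_rows k its <->
  exists2 i, i < size its & r \in item_rows (k + i) (nth (Some blank) its i).
Proof.
elim: its k => [|it its IH] k /=; first by split=> // -[].
rewrite mem_cat; split.
  case/orP=> [H|/IH[i Hi H]]; first by exists 0; rewrite ?addn0.
  by exists i.+1 => //; rewrite addnS -addSn.
case=> [[|i]]; rewrite ?addn0 => Hi /= H; first by rewrite H.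
by apply/orP; right; apply/IH; exists i => //; rewrite addSnnS.
Qed.

Lemma mem_core r : r \in core <->
  (exists2 u, u <= P & r \in item_rows u (nth (Some blank) items u)) \/
  (exists2 u, u < P * rows & r \in main_rows u).
Proof.
rewrite mem_cat; split.
  case/orP=> [/mem_init_rows[u]|/flatten_mapP[u]]; rewrite ?size_items ?mem_iota => Hu H.
    by left; exists u.
  by right; exists u.
case=> [[u Hu H]|[u Hu H]]; apply/orP; [left|right].
  by apply/mem_init_rows; exists u; rewrite ?size_items.
by apply/flatten_mapP; exists u; rewrite ?mem_iota.
Qed.

Lemma core_sizes : all (fun r => size r == #|letter| * N.+1) core.
Proof.
apply/allP => r /mem_core[[u _]|[u _]].
  rewrite /item_rows; case: nth => [a|]; rewrite !inE; first by move/eqP->; rewrite size_grid.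
  by case/orP=> /eqP->; rewrite size_grid.
by rewrite inE => /orP[/eqP->|/mapP[[[a b] c] _ ->]]; rewrite size_grid.
Qed.

Lemma core_row_hits u B1 B2 B3 B4 y : hits (core_row u B1 B2 B3 B4) y <->
  exists v a, [/\ v <= N, pattern u B1 B2 B3 B4 v a & at_cell y v a].
Proof. by split=> [/hits_grid|H]; [|apply/hits_grid]. Qed.

Lemma target_lt u : u < P * rows -> u + P + 1 < N.
Proof. rewrite /ncells; lia. Qed.

Lemma core_has : all (has id) core.
Proof.
have hasP r (y : seq bool) : hits r y -> has id r.
  by case=> j Hj _; apply/(has_nthP false); exists j => //; apply: nth_lt.
have row_has u B1 B2 B3 B4 v a : v <= N -> pattern u B1 B2 B3 B4 v a -> has id (core_row u B1 B2 B3 B4).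
  move=> Hv Hp; apply: (hasP _ (grid (fun=> predT : pred letter) 0 N.+1)); apply/core_row_hits.
  by exists v, a; rewrite Hv Hp at_grid.
have PN u : u <= P -> u <= N by rewrite /ncells; lia.
apply/allP => r /mem_core[[u /PN Hu]|[u /target_lt /ltnW Hu]].
  rewrite /item_rows; case: nth => [a|]; rewrite !inE.
    by move/eqP->; apply: (row_has _ _ _ _ _ u a); rewrite // /pattern /= !eqxx.
  case/orP=> /eqP->; first by apply: (row_has _ _ _ _ _ u blank); rewrite // /pattern eqxx.
  by apply: (row_has _ _ _ _ _ u start_letter); rewrite // /pattern eqxx.
rewrite inE => /orP[/eqP->|/mapP[[[a b] c] _ ->]].
  by apply: (row_has _ _ _ _ _ (u + P + 1) blank); rewrite // /pattern eqxx !orbT.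
by apply: (row_has _ _ _ _ _ (u + P + 1) (local_rule a b c)); rewrite // /pattern /= !eqxx !orbT.
Qed.

Lemma width_gt1 : 1 < P. Proof. rewrite /width; lia. Qed.

Hypothesis runs : forall z, size z <= 2 * size x + 2 + wl -> runs_within V z rows.-1 [:: L z].
Hypothesis rows_gt1 : 1 < rows.

(** * The run of the verifier as a sequence of letters *)

Section Trace.
Variable z : seq bool.

Definition trace (u : nat) : letter :=
  cell V z (u %/ P) (Z.of_nat (u %% P) - Z.of_nat origin)%Z.

Lemma traceE t p : p < P -> trace (t * P + p) = cell V z t (Z.of_nat p - Z.of_nat origin)%Z.
Proof.
move=> Hp; have P0 : 0 < P by have := width_gt1; lia.
by rewrite /trace divnMDl // divn_small // addn0 modnMDl modn_small.
Qed.

Definition init_letter (u : nat) : letter :=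
  if u.+1 == origin then start_letter else (None, if u < origin then None else onth z (u - origin)).

Hypothesis size_z : size z <= 2 * size x + 2 + wl.

Lemma trace_init u : u <= P -> trace u = init_letter u.
Proof.
(* Cell [P] starts row [1]: it lies left of both head and input, and [init_letter] agrees because
   [P - origin] is past the end of [z]. *)
rewrite leq_eqVlt => /orP[/eqP->|Hu].
  have -> : trace P = trace (1 * P + 0) by rewrite mul1n addn0.
  rewrite traceE; last by have := width_gt1; lia.
  rewrite /cell /run /= fupd_id /init_letter.
  have -> : P.+1 == origin = false by rewrite /origin /width; lia.
  have -> : P < origin = false by rewrite /origin /width; lia.
  rewrite onth_default; last by move: size_z; rewrite /origin /width; lia.
  rewrite /input_tape; case: Z.eqb_spec; first by rewrite /origin; lia.
  by case: Z.ltb_spec => //; rewrite /origin; lia.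
have -> : trace u = trace (0 * P + u) by rewrite mul0n.
rewrite traceE // /cell /run /= /init_letter /input_tape /origin.
case: Z.eqb_spec => Hi; case: eqP => // Ho; try lia.
  by case: Z.ltb_spec => //; lia.
case: Z.ltb_spec => H; case: ltnP => //; try lia.
by move=> _; congr (_, onth z _); lia.
Qed.

Lemma local_rule_left a a' b c : a.1 = None -> a'.1 = None ->
  local_rule a b c = local_rule a' b c :> letter.
Proof. by rewrite /local_rule /arrives => -> ->. Qed.

Lemma local_rule_right a b c c' : c.1 = None -> c'.1 = None ->
  local_rule a b c = local_rule a b c' :> letter.
Proof. by rewrite /local_rule /arrives => -> ->. Qed.

(** Inside a row this is [cell_step]. At the ends of a row, the neighbour by index lies in an
    adjacent row instead of further along the tape. Both that letter and the true neighbour are too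
    far from the head to carry it, so exchanging them does not affect [local_rule]. *)
Lemma trace_step u : u + P + 1 < N ->
  trace (u + P + 1) = local_rule (trace u) (trace u.+1) (trace u.+2).
Proof.
move=> Hu; have P1 := width_gt1.
have Eu := divn_eq u.+1 P; set t := u.+1 %/ P in Eu; set p := u.+1 %% P in Eu.
have Hp : p < P by rewrite ltn_mod; lia.
have Ht : t <= rows.
  have : t * P <= rows * P by move: Hu; rewrite /ncells; lia.
  by rewrite leq_pmul2r; lia.
have Hb := head_bound V z t.
have -> : u + P + 1 = t.+1 * P + p by rewrite mulSn; lia.
rewrite Eu !traceE // cell_step.
set i := (Z.of_nat p - Z.of_nat origin)%Z.
rewrite (_ : local_rule (cell V z t (i - 1)) _ _ =
  local_rule (trace u) (cell V z t i) (cell V z t (i + 1))).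
  case: (ltnP p.+1 P) => Hp'.
    have -> : (t * P + p).+1 = t * P + p.+1 by lia.
    by rewrite traceE //; congr (local_rule _ _ (cell _ _ _ _)); rewrite /i; lia.
  have -> : (t * P + p).+1 = t.+1 * P + 0 by rewrite mulSn; lia.
  rewrite traceE; last by lia.
  apply: local_rule_right; apply: cell_head.
    by rewrite /i; move: Hp' Hb; rewrite /width /origin; lia.
  by have := head_bound V z t.+1; rewrite /origin; lia.
case: p Hp Eu @i => [|p] Hp Eu i.
  have t0 : 0 < t by case: t Eu {Ht Hb} => //; lia.
  have -> : u = t.-1 * P + P.-1.
    by move: Eu; rewrite -{1}(prednK t0) mulSn; lia.
  rewrite traceE; last by lia.
  apply: local_rule_left; apply: cell_head.
    by rewrite /i; move: Hb; rewrite /origin; lia.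
  by have := head_bound V z t.-1; rewrite /width /origin; lia.
have -> : u = t * P + p by lia.
by rewrite traceE; [congr (local_rule (cell _ _ _ _) _ _); rewrite /i|]; lia.
Qed.

(** Row [rows] lies past the time bound, so its head cell displays the answer; an accepting run has
    no rejecting cell at any time. *)
Lemma trace_rejecting : (forall u, P < u < N -> ~~ rejecting (trace u)) <-> L z.
Proof.
split=> [H|HL u _]; last exact: cell_not_rejecting (runs size_z) _ _ HL.
have Hb := head_bound V z rows.
have Hr := cell_rejecting (runs size_z) (t := rows).
pose p := Z.to_nat (head_at V z rows + Z.of_nat origin).
have Hp : p < P by rewrite /p /width; move: Hb; rewrite /origin; lia.
have Hu : P < rows * P + p < N by rewrite /ncells; have := width_gt1; nia.
have := H _ Hu; rewrite traceE //.
have -> : (Z.of_nat p - Z.of_nat origin)%Z = head_at V z rows by rewrite /p; move: Hb; rewrite /origin; lia.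
by rewrite Hr ?negbK //; lia.
Qed.

End Trace.

(** * From hitting sets to witnesses and back *)

Definition witness_sym (y : seq bool) (u : nat) : sym :=
  if at_cell y u (bit_letter true) then Some true
  else if at_cell y u (bit_letter false) then Some false else None.

Definition witness (y : seq bool) : seq bool :=
  pmap (witness_sym y) (iota witness_at wl).

Lemma size_witness y : size (witness y) <= wl.
Proof. by rewrite size_pmap (leq_trans (count_size _ _)) // size_iota. Qed.

Lemma nth_items_tail j : nth (Some blank) items (origin + j) =
  nth (Some blank) ([seq Some (bit_letter b) | b <- pair_enc x [::]] ++
    nseq wl None ++ nseq (rows + 5) (Some blank)) j.
Proof.
rewrite /items nth_cat size_nseq /origin.
have -> : rows + 4 + j < rows + 3 = false by lia.
by have -> : rows + 4 + j - (rows + 3) = j.+1 by lia.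
Qed.

Lemma nth_items_witness i : i < wl -> nth (Some blank) items (witness_at + i) = None.
Proof.
move=> Hi; rewrite /witness_at -addnA nth_items_tail nth_cat size_map size_pair addn0.
by rewrite ltnNge leq_addr addKn nth_cat size_nseq Hi nth_nseq Hi.
Qed.

Lemma init_letter_witness w i :
  init_letter (pair_enc x w) (witness_at + i) = (None, onth w i).
Proof.
rewrite /init_letter /witness_at.
have -> : (origin + (2 * size x + 2) + i).+1 == origin = false by lia.
have -> : origin + (2 * size x + 2) + i < origin = false by lia.
rewrite -addnA addKn pair_cat onth_cat size_pair addn0 ltnNge leq_addr /=.
by rewrite addKn.
Qed.

Lemma nth_items w u : size w <= wl -> u <= P ->
  match nth (Some blank) items u with
  | Some a => a = init_letter (pair_enc x w) u
  | None => exists2 i, i < wl & u = witness_at + i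
  end.
Proof.
move=> Sw Hu; case: (ltnP u origin) => Ho.
  rewrite /items nth_cat size_nseq /init_letter Ho.
  case: ltnP => Hu'; first by rewrite nth_nseq Hu'; case: eqP => //; rewrite /origin; lia.
  have -> : u = rows + 3 by move: Ho; rewrite /origin; lia.
  by rewrite subnn /= /origin addn4 addn3 eqxx.
rewrite -(subnKC Ho); move: (u - origin) => j; rewrite nth_items_tail nth_cat size_map size_pair addn0.
case: ltnP => Hj.
  rewrite (nth_map false) ?size_pair ?addn0 // /init_letter.
  have -> : (origin + j).+1 == origin = false by lia.
  have -> : origin + j < origin = false by lia.
  rewrite addKn (pair_cat w) onth_cat size_pair addn0 Hj /bit_letter; congr pair.
  have : j < size (pair_enc x [::]) by rewrite size_pair addn0.
  by elim: (pair_enc x [::]) j {Hj} => [|b l IH] [|j] //= /IH.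
rewrite -(subnKC Hj); move: (j - _) => i; rewrite addKn addnA -/witness_at.
rewrite nth_cat size_nseq; case: ltnP => Hi; first by rewrite nth_nseq Hi; exists i.
rewrite nth_nseq if_same init_letter_witness onth_default //.
exact: leq_trans Sw Hi.
Qed.

(** Counting leaves one letter per cell. By strong induction on the index of the cell, the window
    clauses then force the picks to follow the run on [x] paired with the word read off, and the
    rows against rejecting letters make this run accept. *)
Lemma tableau_sound y : size y = #|letter| * N.+1 -> count id y = N ->
  (forall r, r \in core -> hits r y) -> L (pair_enc x (witness y)).
Proof.
move=> Hy Hc Hh; set w := witness y; have Sw := size_witness y; set z := pair_enc x w.
have PN : P < N by rewrite /ncells; lia.
have item u (Hu : u <= P) r (Hr : r \in item_rows u (nth (Some blank) items u)) : hits r y.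
  by apply: Hh; apply/mem_core; left; exists u.
have main u (Hu : u < P * rows) r (Hr : r \in main_rows u) : hits r y.
  by apply: Hh; apply/mem_core; right; exists u.
have main_ok u : u < P * rows -> exists2 a : letter, at_cell y (u + P + 1) a & ~~ rejecting a.
  move=> Hu; have := main u Hu _ (mem_head _ _).
  case/core_row_hits=> v [a [_ Hp Ha]]; move: Hp; rewrite /pattern /= !andbF /=.
  by case/andP=> /eqP E R; exists a => //; rewrite -E.
have free_ok u : u <= P -> nth (Some blank) items u = None ->
    exists2 a : letter, at_cell y u a & input_letter a.
  move=> Hu E; have := item u Hu; rewrite E => /(_ _ (mem_head _ _)).
  case/core_row_hits=> v [a [_ Hp Ha]]; move: Hp; rewrite /pattern /= !andbF !orbF /=.
  by case/andP=> /eqP Ev R; exists a => //; rewrite -Ev.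
have fixed_ok u (a : letter) : u <= P -> nth (Some blank) items u = Some a -> at_cell y u a.
  move=> Hu E; have := item u Hu; rewrite E => /(_ _ (mem_head _ _)).
  case/core_row_hits=> v [a' [_ Hp Ha]]; move: Hp; rewrite /pattern /= !andbF !orbF /=.
  by case/andP=> /eqP Ev /eqP Ea; rewrite -Ev -Ea.
(* Every cell below [N] receives a pick, from its item row or from the first of its main rows, so
   the [N] picks are one per cell. *)
have uniq_at : forall u (a a' : letter), u < N -> at_cell y u a -> at_cell y u a' -> a = a'.
  apply: one_pick Hy Hc _ => u Hu; case: (leqP u P) => HuP.
    case E: (nth (Some blank) items u) => [a|]; first by exists a; apply: fixed_ok.
    by have [a Ha _] := free_ok u HuP E; exists a.
  have [|a Ha _] := main_ok (u - P - 1); first by move: Hu; rewrite /ncells; lia.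
  by exists a; move: Ha; rewrite (_ : u - P - 1 + P + 1 = u) //; lia.
have wit_lt i : i < wl -> witness_at + i <= P by rewrite /witness_at /origin /width; lia.
have wit_cell i : i < wl -> at_cell y (witness_at + i) ((None, witness_sym y (witness_at + i)) : letter).
  move=> Hi; set u := witness_at + i.
  have [[p s] Ha /eqP /= Hp] := free_ok u (wit_lt i Hi) (nth_items_witness Hi).
  rewrite Hp in Ha.
  have Hu : u < N := leq_ltn_trans (wit_lt i Hi) PN.
  rewrite /witness_sym; case: ifP => [H|H1]; first exact: H.
  case: ifP => [H|H0]; first exact: H.
  by case: s Ha => [[]|] // Ha; [move: H1 | move: H0]; rewrite /bit_letter Ha.
have mono i : witness_at <= i -> i.+1 < witness_at + wl -> witness_sym y i = None ->
    witness_sym y i.+1 = None.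
  move=> Hi Hi' E.
  have Hj : i - witness_at < wl by lia.
  have Ei : witness_at + (i - witness_at) = i by lia.
  have C := wit_cell _ Hj; rewrite Ei E in C.
  have HiP := wit_lt _ Hj; rewrite Ei in HiP.
  have HiP' := wit_lt (i.+1 - witness_at); rewrite subnKC in HiP'; last by lia.
  have {}HiP' : i.+1 <= P by apply: HiP'; lia.
  have W := nth_items_witness Hj; rewrite Ei in W.
  have := item i HiP; rewrite W => /(_ _ (mem_last _ _)).
  case/core_row_hits=> v [a [_ Hp Ha]]; move: Hp; rewrite /pattern /= !andbF !orbF.
  case/orP=> /andP[/eqP Ev].
    move=> Na; move: Ha; rewrite Ev => /(uniq_at _ _ _ (leq_ltn_trans HiP PN) C) Ea.
    by rewrite -Ea eqxx in Na.
  move=> /eqP Ea; rewrite Ev Ea in Ha.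
  have U b : at_cell y i.+1 (bit_letter b) = false.
    by apply/negP => /(uniq_at _ _ _ (leq_ltn_trans HiP' PN) Ha).
  by rewrite /witness_sym !U.
have wit_onth i : i < wl -> onth w i = witness_sym y (witness_at + i).
  exact: onth_pmap_mono.
have Sz : size z <= 2 * size x + 2 + wl by rewrite size_pair leq_add2l.
have cells u : u < N -> at_cell y u (trace z u).
  elim/ltn_ind: u => u IH Hu; case: (leqP u P) => HuP.
    rewrite trace_init //; have := nth_items Sw HuP.
    case E: nth => [a|]; first by move=> <-; apply: fixed_ok.
    by case=> i Hi ->; rewrite init_letter_witness wit_onth //; apply: wit_cell.
  have [v Ev] : exists v, u = v + P + 1 by exists (u - P - 1); lia.
  have Hv : v < P * rows by move: Hu; rewrite /ncells; lia.
  have P1 := width_gt1.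
  rewrite Ev trace_step -?Ev //.
  set t := (trace z v, trace z v.+1, trace z v.+2).
  have /(main v Hv) : window_row v t \in main_rows v.
    by rewrite inE map_f ?orbT // mem_enum.
  case/core_row_hits=> v' [a [_ Hp Ha]]; move: Hp; rewrite /pattern /=.
  (* A hit at one of the three earlier cells would be a second letter next to the one known by
     induction; only the fourth disjunct of the clause survives. *)
  have no j : (v' == j) && (a != trace z j) -> v <= j <= v.+2 -> False.
    move=> /andP[/eqP Ej Na] Hj; rewrite Ej in Ha.
    have Hj' : j < u by lia.
    have Hj'' : j < N by lia.
    by rewrite (uniq_at _ _ _ Hj'' Ha (IH _ Hj' Hj'')) eqxx in Na.
  case/or4P=> [/no[]|/no[]|/no[]|/andP[/eqP Ev' /eqP Ea]]; try lia.
  by rewrite -Ea Ev -Ev'.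
apply/(trace_rejecting Sz) => u /andP[HuP Hu].
have [|a Ha Ra] := main_ok (u - P - 1); first by move: Hu; rewrite /ncells; lia.
rewrite (_ : u - P - 1 + P + 1 = u) in Ha; last by lia.
by rewrite (uniq_at _ _ _ Hu (cells u Hu) Ha).
Qed.

(** The hitting set picks the letter of the trace in each of the first [N] cells and nothing in the
    padding block. *)
Lemma tableau_complete w : size w <= wl -> L (pair_enc x w) ->
  exists h, [/\ size h = #|letter| * N.+1, count id h = N & forall r, r \in core -> hits r h].
Proof.
move=> Sw HL; set z := pair_enc x w.
have Sz : size z <= 2 * size x + 2 + wl by rewrite size_pair leq_add2l.
pose h := grid (fun u a => (u < N) && (a == trace z u)) 0 N.+1.
have hat u : u < N -> at_cell h u (trace z u).
  by move=> Hu; rewrite at_grid ?add0n ?Hu ?eqxx // ltnW.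
exists h; split.
- exact: size_grid.
- rewrite /h -addn1 grid_cat count_cat (@eq_grid _ _ (fun u => pred1 (trace z u))).
    rewrite count_onehot (@eq_grid _ _ (fun=> pred0)).
      by rewrite grid0 count_nseq /= addn0.
    by move=> u Hu a /=; rewrite ltnNge; case: leqP => //; lia.
  by move=> u Hu a /=; rewrite (_ : u < N).
have PN : P < N by rewrite /ncells; lia.
have at_row u B1 B2 B3 B4 v : v < N -> pattern u B1 B2 B3 B4 v (trace z v) ->
    hits (core_row u B1 B2 B3 B4) h.
  move=> Hv Hp; apply/core_row_hits; exists v, (trace z v).
  by split=> //; [exact: ltnW | exact: hat].
move=> r /mem_core[[u Hu]|[u Hu]].
  have := nth_items Sw Hu; have HuN := leq_ltn_trans Hu PN.
  case: nth => [a|] /=.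
    move=> ->; rewrite inE => /eqP ->; apply: (at_row _ _ _ _ _ u) => //.
    by rewrite /pattern /= trace_init // !eqxx.
  case=> i Hi Eu; have Et : trace z u = (None, onth w i) by rewrite trace_init // Eu init_letter_witness.
  rewrite !inE => /orP[/eqP->|/eqP->].
    by apply: (at_row _ _ _ _ _ u) => //; rewrite /pattern Et /= eqxx.
  case E: (onth w i) => [b|].
    by apply: (at_row _ _ _ _ _ u) => //; rewrite /pattern Et E /= eqxx.
  have HuP : u.+1 <= P by rewrite Eu /witness_at /origin /width; lia.
  have Et' : trace z u.+1 = blank.
    rewrite trace_init // Eu -addnS init_letter_witness onth_default //.
    by have := isSome_onth w i; rewrite E; case: ltnP => // H _; apply: leqW.
  apply: (at_row _ _ _ _ _ u.+1); first exact: leq_ltn_trans HuP PN.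
  by rewrite /pattern /= Et' !eqxx orbT.
have Ht := target_lt Hu.
rewrite inE => /orP[/eqP->|/mapP[[[a b] c] _ ->]].
  apply: (at_row _ _ _ _ _ (u + P + 1)) => //.
  rewrite /pattern eqxx /= !orbA; apply/orP; right.
  by apply: (proj2 (trace_rejecting Sz) HL); lia.
have P1 := width_gt1.
(* If the trace differs from the triple in some cell, that cell hits the row; otherwise the cell
   determined by the window does. *)
case: (eqVneq (trace z u) a) => [Ea|Na]; last first.
  by apply: (at_row _ _ _ _ _ u); [lia | rewrite /pattern /= eqxx Na].
case: (eqVneq (trace z u.+1) b) => [Eb|Nb]; last first.
  by apply: (at_row _ _ _ _ _ u.+1); [lia | rewrite /pattern /= eqxx Nb orbT].
case: (eqVneq (trace z u.+2) c) => [Ec|Nc]; last first.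
  by apply: (at_row _ _ _ _ _ u.+2); [lia | rewrite /pattern /= eqxx Nc !orbT].
apply: (at_row _ _ _ _ _ (u + P + 1)) => //.
by rewrite /pattern /= trace_step // Ea Eb Ec !eqxx !orbT.
Qed.

End Tableau.

(** * Computing the reduction *)

Ltac pbounded_tac :=
  lazymatch goal with
  | |- pbounded (fun n => @?t n + @?u n) => apply: (@pbounded_add t u); pbounded_tac
  | |- pbounded (fun n => @?t n * @?u n) => apply: (@pbounded_mul t u); pbounded_tac
  | |- pbounded (fun n => (@?t n).+1) => apply: (@pbounded_succ t); pbounded_tac
  | |- pbounded (fun n => peval ?e n) => exact: (pbounded_peval e)
  | |- pbounded (fun n => loop_factor ?e n) => exact: (pbounded_loop_factor e)
  | |- pbounded (peval ?e) => exact: (pbounded_peval e)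
  | |- pbounded (loop_factor ?e) => exact: (pbounded_loop_factor e)
  | |- pbounded (fun=> ?k) => exact: (pbounded_const k)
  | |- pbounded (fun n => n) => exact: pbounded_id
  | |- _ => assumption
  end.

(** * Printing words with loops *)

Definition emits (c : cmd) (rest : state) (s : seq bool) (t : nat) : Prop :=
  forall out, spec c (out :: rest) ((rev s ++ out) :: rest) t.

Lemma emits_weaken c rest s t t' : emits c rest s t -> t <= t' -> emits c rest s t'.
Proof. by move=> H Ht out; apply: spec_weaken (H out) Ht. Qed.

Lemma emits_emit s rest : emits (emit s) rest s (size s).+1.
Proof. by move=> out; apply: spec_emit. Qed.

Lemma emits_seq c1 c2 rest s1 s2 t1 t2 :
  emits c1 rest s1 t1 -> emits c2 rest s2 t2 -> emits (c1 ;; c2) rest (s1 ++ s2) (t1 + t2).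
Proof. by move=> H1 H2 out; rewrite rev_cat -catA; apply: spec_seq (H1 out) (H2 _). Qed.

Lemma flatten_nseqS T (s : seq T) k : flatten (nseq k.+1 s) = flatten (nseq k s) ++ s.
Proof. by rewrite -addn1 nseqD flatten_cat /= cats0. Qed.

Lemma emits_iter c rest s t (out : seq bool) i : emits c rest s t ->
  spec c ((rev (flatten (nseq i s)) ++ out) :: rest) ((rev (flatten (nseq i.+1 s)) ++ out) :: rest) t.
Proof. by move=> H; rewrite flatten_nseqS rev_cat -catA. Qed.

Lemma emits_ploop v e c rest s t n : size (reg rest v) = n -> emits c rest s t ->
  emits (ploop v.+1 e c) rest (flatten (nseq (peval e n) s)) (loop_factor e n * t.+1).
Proof.
move=> Hn H out.
by apply: (spec_ploop (F := fun i => (rev (flatten (nseq i s)) ++ out) :: rest)) => // i _; apply: emits_iter.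
Qed.

Lemma emits_for v c rest s t k m : size (reg rest v) = k -> k <= m -> emits c rest s t ->
  emits (For v.+1 c) rest (flatten (nseq k s)) (m * t.+1 + 2).
Proof.
move=> Hk Hm H out; apply: spec_weaken.
  apply: (spec_for (F := fun i => (rev (flatten (nseq i s)) ++ out) :: rest)) => [|i _]; first exact: Hk.
  exact: emits_iter.
by rewrite leq_add2r leq_mul2r Hm orbT.
Qed.

Lemma flatten_iotaS T (f : nat -> seq T) k :
  flatten [seq f u | u <- iota 0 k.+1] = flatten [seq f u | u <- iota 0 k] ++ f k.
Proof. by rewrite -addn1 iotaD map_cat flatten_cat /= cats0. Qed.

Lemma flatten_nseq1 T (a : T) k : flatten (nseq k [:: a]) = nseq k a.
Proof. by elim: k => //= k ->. Qed.

Lemma flatten_nseq_nseq T (a : T) k l : flatten (nseq k (nseq l a)) = nseq (l * k) a.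
Proof. by elim: k => [|k IH]; rewrite ?muln0 //= IH mulnS nseqD. Qed.

Lemma init_rows_cat V rows wl x u its its' :
  @init_rows V rows wl x u (its ++ its') =
  @init_rows V rows wl x u its ++ @init_rows V rows wl x (u + size its) its'.
Proof.
elim: its u => [|it its IH] u /=; first by rewrite addn0.
by rewrite IH catA addSnnS.
Qed.

Section Emission.
Variables (V : TM) (cV dV c d e : nat).
Local Notation letter := (letter V).

(* Polynomials in the length of the input: length of the witness (eW), rows of the tableau (eT),
   width minus two (eP2), number of windows (ePT), cells and core picks (eN), core rows beyond the
   one per cell (eX), copies of each core row (eS = eS1 + 1), dummies (eD), committee size (eK) and
   candidates (eM). *)
Definition eW : pexp := ppoly c d PVar.
Definition eT : pexp :=
  PAdd (ppoly cV dV (PAdd (PAdd (PMul (PConst 2) PVar) (PConst 2)) eW)) (PConst 2).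
Definition eP2 : pexp :=
  PAdd (PAdd (PAdd eT eT) (PConst 8)) (PAdd (PMul (PConst 2) PVar) eW).
Definition ePT : pexp := PMul (PAdd eP2 (PConst 2)) eT.
Definition eN : pexp := PAdd (PAdd ePT (PAdd eP2 (PConst 2))) (PConst 1).
Definition eX : pexp := PAdd eW (PMul (PConst (size (triples V))) ePT).
Definition eS1 : pexp := PExp (PAdd (PAdd eN eX) (PConst 2)) e.
Definition eS : pexp := PAdd eS1 (PConst 1).
Definition eD : pexp := PAdd (PMul eX eS) (PConst 1).
Definition eK : pexp := PAdd eN eD.
Definition eM : pexp := PAdd (PMul (PConst #|letter|) (PAdd eN (PConst 1))) eD.

Section Input.
Variable x : seq bool.
Local Notation n := (size x).

Definition n_rows := peval eT n.
Definition n_wit := peval eW n.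
Local Notation width_x := (width n_rows n_wit x).

Lemma width_E : width_x = peval eP2 n + 2.
Proof. by rewrite /width /n_rows /n_wit /=; lia. Qed.

Lemma ncells_E : ncells n_rows n_wit x = peval eN n.
Proof. by rewrite /ncells width_E. Qed.

Lemma PT_E : width_x * n_rows = peval ePT n.
Proof. by rewrite width_E. Qed.

Lemma rows_gt1 : 1 < n_rows.
Proof. by rewrite /n_rows /= addn2. Qed.

Lemma width_lt_PT : width_x < peval ePT n.
Proof. by rewrite -PT_E; have := rows_gt1; have := @width_gt1 n_rows n_wit x; nia. Qed.

Definition core_x := core V n_rows n_wit x.

Lemma size_core_x : size core_x = peval eN n + peval eX n.
Proof. by rewrite size_core ncells_E PT_E. Qed.

Definition copies (r : seq bool) : seq bool :=
  flatten (nseq (peval eS n) (r ++ nseq (peval eD n) false)).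

Definition out_rows (rs : seq (seq bool)) : seq bool := flatten (map copies rs).

Definition regs_at (y u ur j jr y2 : seq bool) : state :=
  [:: [::]; [::]; [::]; [::]; x; y; u; ur; j; jr; y2].

End Input.

Definition zero_cell : cmd := emit (nseq #|letter| false).

Definition row_prog (B1 B2 B3 B4 : pred letter) : cmd :=
  ploop 5 eS (For 7 zero_cell ;; emit (block B1) ;; emit (block B2) ;; emit (block B3) ;;
    ploop 5 eP2 zero_cell ;; emit (block B4) ;; For 8 zero_cell ;; ploop 5 eD (emit [:: false])).

(** The [N + 1] blocks split as [u], three window cells, [P - 2], the target cell and
    [P * rows - u]. Each stretch of empty cells is thus as long as a register or has a length given
    by a polynomial loop. *)
Lemma core_row_split x u B1 B2 B3 B4 : u <= peval ePT (size x) ->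
  @core_row V (n_rows x) (n_wit x) x u B1 B2 B3 B4 =
  flatten (nseq u (nseq #|letter| false)) ++ block B1 ++ block B2 ++ block B3 ++
  flatten (nseq (peval eP2 (size x)) (nseq #|letter| false)) ++ block B4 ++
  flatten (nseq (peval ePT (size x) - u) (nseq #|letter| false)).
Proof.
move=> Hu; rewrite /core_row !flatten_nseq_nseq.
set P2 := peval eP2 _; set PT := peval ePT _ in Hu *.
have -> : (ncells (n_rows x) (n_wit x) x).+1 = u + (1 + (1 + (1 + (P2 + (1 + (PT - u)))))).
  rewrite /ncells PT_E width_E -/P2 -/PT; lia.
have HW : width (n_rows x) (n_wit x) x = P2 + 2 := width_E x.
clearbody P2 PT.
rewrite !grid_cat.
have one m : grid (pattern (n_rows x) (n_wit x) x u B1 B2 B3 B4) m 1 =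
    block (pattern (n_rows x) (n_wit x) x u B1 B2 B3 B4 m) by rewrite /grid /= cats0.
have zero m k : (forall v, m <= v < m + k -> [&& v != u, v != u.+1, v != u.+2 & v != u + (P2 + 2) + 1]) ->
    grid (pattern (n_rows x) (n_wit x) x u B1 B2 B3 B4) m k = nseq (#|letter| * k) false.
  move=> H; rewrite -(grid0 _ m); apply: eq_grid => v /H /and4P[H1 H2 H3 H4] a.
  by rewrite /pattern HW (negbTE H1) (negbTE H2) (negbTE H3) (negbTE H4).
rewrite !one zero; last by move=> v; lia.
rewrite zero; last by move=> v; lia.
rewrite zero; last by move=> v; lia.
have blk m B : (forall a, pattern (n_rows x) (n_wit x) x u B1 B2 B3 B4 m a = B a) ->
    block (pattern (n_rows x) (n_wit x) x u B1 B2 B3 B4 m) = block B by move=> H; apply: eq_map.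
rewrite (blk (0 + u) B1) ?(blk (0 + u + 1) B2) ?(blk (0 + u + 1 + 1) B3)
  ?(blk (0 + u + 1 + 1 + 1 + P2) B4) // => a; rewrite /pattern HW.
- have -> : (0 + u + 1 + 1 + 1 + P2 == u) = false by lia.
  have -> : (0 + u + 1 + 1 + 1 + P2 == u.+1) = false by lia.
  have -> : (0 + u + 1 + 1 + 1 + P2 == u.+2) = false by lia.
  by have -> : (0 + u + 1 + 1 + 1 + P2 == u + (P2 + 2) + 1) by lia.
- have -> : (0 + u + 1 + 1 == u) = false by lia.
  have -> : (0 + u + 1 + 1 == u.+1) = false by lia.
  have -> : (0 + u + 1 + 1 == u.+2) by lia.
  by have -> : (0 + u + 1 + 1 == u + (P2 + 2) + 1) = false; [lia | rewrite orbF].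
- have -> : (0 + u + 1 == u) = false by lia.
  have -> : (0 + u + 1 == u.+1) by lia.
  have -> : (0 + u + 1 == u.+2) = false by lia.
  by have -> : (0 + u + 1 == u + (P2 + 2) + 1) = false; [lia | rewrite orbF].
- have -> : (0 + u == u) by lia.
  have -> : (0 + u == u.+1) = false by lia.
  have -> : (0 + u == u.+2) = false by lia.
  by have -> : (0 + u == u + (P2 + 2) + 1) = false; [lia | rewrite orbF].
Qed.

Lemma row_emits B1 B2 B3 B4 : exists2 t, pbounded t & forall x y u j jr y2,
  u <= peval ePT (size x) ->
  emits (row_prog B1 B2 B3 B4) (regs_at x y (nseq u true) (nseq (peval ePT (size x) - u) true) j jr y2)
    (copies x (@core_row V (n_rows x) (n_wit x) x u B1 B2 B3 B4)) (t (size x)).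
Proof.
pose z := #|letter|.+1.
exists (fun n => loop_factor eS n * (((peval ePT n * z.+1 + 2) + (z + (z + (z + (loop_factor eP2 n * z.+1 +
  (z + ((peval ePT n * z.+1 + 2) + loop_factor eD n * 3)))))))).+1).
  by pbounded_tac.
move=> x y u j jr y2 Hu; rewrite /row_prog /copies.
apply: emits_ploop => //.
rewrite core_row_split // -!catA.
have Z rest : emits zero_cell rest (nseq #|letter| false) z.
  by apply: emits_weaken (emits_emit _ _) _; rewrite size_nseq.
have E (B : pred letter) rest : emits (emit (block B)) rest (block B) z.
  by apply: emits_weaken (emits_emit _ _) _; rewrite size_block.
apply: emits_seq; first by apply: emits_for (Z _); rewrite ?size_nseq.
do 3!(apply: emits_seq; first exact: E).
apply: emits_seq; first exact: emits_ploop (Z _).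
apply: emits_seq; first exact: E.
apply: emits_seq; first by apply: emits_for (Z _); rewrite /= ?size_nseq ?leq_subr.
rewrite -(flatten_nseq1 false (peval eD (size x))).
by apply: emits_ploop => //; apply: emits_emit.
Qed.

Arguments peval : simpl never.
Arguments loop_factor : simpl never.

Section Stages.
Variable x : seq bool.
Local Notation n := (size x).

(* Register 0 holds the reversed output, registers 7 and 8 the current cell u and PT - u. *)
Definition stage out y u j jr y2 : state :=
  out :: regs_at x y (nseq u true) (nseq (peval ePT n - u) true) j jr y2.

(** The words [y] and [y'] are the contents of register 6 before and after; only the items that
    encode [x] consume it. *)
Definition advances (cm : cmd) (y y' : seq bool) (its : seq (option letter)) (t : nat) : Prop :=
  forall out u y2, u + size its <= peval ePT n ->
    spec cm (stage out y u [::] [::] y2)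
      (stage (rev (out_rows x (@init_rows V (n_rows x) (n_wit x) x u its)) ++ out) y'
        (u + size its) [::] [::] y2) t.

Lemma out_rows_cat rs rs' : out_rows x (rs ++ rs') = out_rows x rs ++ out_rows x rs'.
Proof. by rewrite /out_rows map_cat flatten_cat. Qed.

Lemma advances_seq c1 c2 y y1 y2 its1 its2 t1 t2 :
  advances c1 y y1 its1 t1 -> advances c2 y1 y2 its2 t2 ->
  advances (c1 ;; c2) y y2 (its1 ++ its2) (t1 + t2).
Proof.
move=> H1 H2 out u z; rewrite size_cat addnA => Hu.
rewrite init_rows_cat out_rows_cat rev_cat -catA.
by apply: spec_seq (H1 _ _ _ _) (H2 _ _ _ _) => //; lia.
Qed.

Lemma advances_ploop ex cm y it t : advances cm y y [:: it] t ->
  advances (ploop 5 ex cm) y y (nseq (peval ex n) it) (loop_factor ex n * t.+1).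
Proof.
move=> H out u y2; rewrite size_nseq => Hu.
have := @spec_ploop ex 5 cm n t (fun i => stage
  (rev (out_rows x (@init_rows V (n_rows x) (n_wit x) x u (nseq i it))) ++ out) y (u + i) [::] [::] y2).
rewrite addn0; apply=> // i Hi.
rewrite -addn1 nseqD init_rows_cat out_rows_cat rev_cat -catA size_nseq addnA.
by apply: H; rewrite /=; lia.
Qed.

Lemma stage_next out y u j jr y2 : u < peval ePT n ->
  spec (Push 7 true ;; Pop 8) (stage out y u j jr y2) (stage out y u.+1 j jr y2) 2.
Proof.
move=> Hu; split=> //; rewrite /stage /regs_at /=.
by rewrite -[peval ePT n - u](@prednK) /= ?subnS //; lia.
Qed.

End Stages.

Definition next_cell : cmd := Push 7 true ;; Pop 8.

Definition item_prog (it : option letter) : cmd :=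
  match it with
  | Some a => row_prog (pred1 a) pred0 pred0 pred0 ;; next_cell
  | None => row_prog (@input_letter V) pred0 pred0 pred0 ;;
      row_prog (predC1 (blank V)) (pred1 (blank V)) pred0 pred0 ;; next_cell
  end.

Lemma item_advances it : exists2 t, pbounded t &
  forall x y, advances x (item_prog it) y y [:: it] (t (size x)).
Proof.
case: it => [a|].
  have [t Ht H] := row_emits (pred1 a) pred0 pred0 pred0.
  exists (fun n => t n + 2); first by pbounded_tac.
  move=> x y out u y2 Hu; rewrite /= addn1 in Hu *.
  rewrite /out_rows /= cats0.
  by apply: spec_seq (H _ _ _ _ _ _ _ _) (stage_next _ _ _ _ _ _); rewrite // ltnW.
have [t Ht H] := row_emits (@input_letter V) pred0 pred0 pred0.
have [t' Ht' H'] := row_emits (predC1 (blank V)) (pred1 (blank V)) pred0 pred0.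
exists (fun n => t n + (t' n + 2)); first by pbounded_tac.
move=> x y out u y2 Hu; rewrite /= addn1 in Hu *.
rewrite /out_rows /= cats0 rev_cat -catA.
apply: spec_seq (H _ _ _ _ _ _ _ _) _; first exact: ltnW.
by apply: spec_seq (H' _ _ _ _ _ _ _ _) (stage_next _ _ _ _ _ _); rewrite // ltnW.
Qed.

(** The number of rounds is fixed on entry, so the register can be emptied on the way, one bit per
    round. *)
Definition each v (f : bool -> cmd) : cmd :=
  For v (Test v Skip (f false ;; Pop v) (f true ;; Pop v)).

Definition double_item b : cmd := item_prog (Some (bit_letter V b)) ;; item_prog (Some (bit_letter V b)).

Definition init_prog : cmd :=
  ploop 5 (PAdd eT (PConst 3)) (item_prog (Some (blank V))) ;;
  item_prog (Some (start_letter V)) ;;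
  each 6 double_item ;;
  item_prog (Some (bit_letter V false)) ;; item_prog (Some (bit_letter V true)) ;;
  ploop 5 eW (item_prog None) ;;
  ploop 5 (PAdd eT (PConst 5)) (item_prog (Some (blank V))).

Definition doubled (l : seq bool) : seq (option letter) :=
  flatten [seq [:: Some (bit_letter V b); Some (bit_letter V b)] | b <- l].

Lemma size_doubled l : size (doubled l) = 2 * size l.
Proof. by elim: l => //= b l; rewrite /doubled => ->; lia. Qed.

Lemma items_E x : items V (n_rows x) (n_wit x) x =
  nseq (n_rows x + 3) (Some (blank V)) ++ [:: Some (start_letter V)] ++ doubled x ++
  [:: Some (bit_letter V false)] ++ [:: Some (bit_letter V true)] ++
  nseq (n_wit x) None ++ nseq (n_rows x + 5) (Some (blank V)).
Proof.
rewrite /items; congr (_ ++ _ :: _).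
by rewrite /pair_enc map_cat -catA; congr (_ ++ _); elim: x => //= b l ->.
Qed.

Lemma each_advances : exists2 t, pbounded t &
  forall x, advances x (each 6 double_item) x [::] (doubled x) (t (size x)).
Proof.
have [t1 H1 A1] := item_advances (Some (bit_letter V true)).
have [t0 H0 A0] := item_advances (Some (bit_letter V false)).
exists (fun n => n * (t1 n + t1 n + (t0 n + t0 n) + 2).+1 + 2); first by pbounded_tac.
move=> x out u y2; rewrite size_doubled => Hu.
have := @spec_for 6 (Test 6 Skip (double_item false ;; Pop 6) (double_item true ;; Pop 6))
  (fun i => stage x (rev (out_rows x (@init_rows V (n_rows x) (n_wit x) x u (doubled (take i x)))) ++ out)
    (drop i x) (u + 2 * i) [::] [::] y2) (size x)
  (t1 (size x) + t1 (size x) + (t0 (size x) + t0 (size x)) + 2).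
rewrite take0 drop0 muln0 addn0 take_size drop_size; apply=> // i Hi.
rewrite (drop_nth false Hi) (take_nth false Hi) -cats1 /doubled map_cat flatten_cat -/(doubled _).
set b := nth false x i.
rewrite init_rows_cat out_rows_cat rev_cat -catA size_doubled size_takel ?(ltnW Hi) //.
have [t Ht] : exists2 t, t <= t1 (size x) + t1 (size x) + (t0 (size x) + t0 (size x)) &
    advances x (double_item b) (b :: drop i.+1 x) (b :: drop i.+1 x)
      ([:: Some (bit_letter V b)] ++ [:: Some (bit_letter V b)]) t.
  case: b; last first.
    by exists (t0 (size x) + t0 (size x)); [apply: leq_addl | apply: advances_seq].
  by exists (t1 (size x) + t1 (size x)); [apply: leq_addr | apply: advances_seq].
move=> /(_ (rev (out_rows x (@init_rows V (n_rows x) (n_wit x) x u (doubled (take i x)))) ++ out)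
  (u + 2 * i) y2).
have Hu' : u + 2 * i + 2 <= peval ePT (size x) by lia.
move=> /(_ Hu') H.
have -> : u + 2 * i.+1 = u + 2 * i + 2 by lia.
apply: spec_weaken; first apply: (@spec_test 6 _ _ _ b (drop i.+1 x)) => //.
  have S : spec (double_item b ;; Pop 6) _ _ _ := spec_seq H (spec_pop 6 _).
  have -> : (if b then double_item true ;; Pop 6 else double_item false ;; Pop 6) =
    (double_item b ;; Pop 6) by case: (b).
  exact: S.
by lia.
Qed.

Lemma init_advances : exists2 t, pbounded t & forall x,
  advances x init_prog x [::] (items V (n_rows x) (n_wit x) x) (t (size x)).
Proof.
have [tb Hb Ab] := item_advances (Some (blank V)).
have [ts Hs As] := item_advances (Some (start_letter V)).
have [t1 H1 A1] := item_advances (Some (bit_letter V true)).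
have [t0 H0 A0] := item_advances (Some (bit_letter V false)).
have [tn Hn An] := item_advances None.
have [te He Ae] := each_advances.
exists (fun n => loop_factor (PAdd eT (PConst 3)) n * (tb n).+1 + (ts n + (te n + (t0 n + (t1 n +
  (loop_factor eW n * (tn n).+1 + loop_factor (PAdd eT (PConst 5)) n * (tb n).+1)))))).
  by pbounded_tac.
move=> x; rewrite items_E.
apply: advances_seq; first exact: (@advances_ploop x (PAdd eT (PConst 3)) _ _ _ _ (Ab x x)).
do 2!(apply: advances_seq; first by []).
do 2!(apply: advances_seq; first by []).
apply: advances_seq; first exact: (@advances_ploop x eW _ _ _ _ (An x [::])).
exact: (@advances_ploop x (PAdd eT (PConst 5)) _ _ _ _ (Ab x [::])).
Qed.

Definition window_prog (t : letter * letter * letter) : cmd :=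
  let: (a1, a2, a3) := t in
  row_prog (predC1 a1) (predC1 a2) (predC1 a3) (pred1 (local_rule a1 a2 a3)).

Definition windows_prog (ts : seq (letter * letter * letter)) : cmd :=
  foldr (fun t cm => window_prog t ;; cm) Skip ts.

Lemma windows_emits ts : exists2 t, pbounded t & forall x y u j jr y2, u <= peval ePT (size x) ->
  emits (windows_prog ts) (regs_at x y (nseq u true) (nseq (peval ePT (size x) - u) true) j jr y2)
    (out_rows x (map (@window_row V (n_rows x) (n_wit x) x u) ts)) (t (size x)).
Proof.
elim: ts => [|[[a1 a2] a3] ts [t Ht H]].
  by exists (fun=> 1); [exact: pbounded_const | move=> *; apply: (emits_emit [::])].
have [t' Ht' H'] := row_emits (predC1 a1) (predC1 a2) (predC1 a3) (pred1 (local_rule a1 a2 a3)).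
exists (fun n => t' n + t n); first by pbounded_tac.
by move=> x y u j jr y2 Hu; apply: emits_seq; [apply: H' | apply: H].
Qed.

Definition main_prog : cmd :=
  ploop 5 ePT (row_prog pred0 pred0 pred0 (fun a => ~~ rejecting a) ;;
    windows_prog (triples V) ;; next_cell).

Lemma main_spec : exists2 t, pbounded t & forall x out y y2,
  spec main_prog (stage x out y 0 [::] [::] y2)
    (stage x (rev (out_rows x (flatten
      [seq @main_rows V (n_rows x) (n_wit x) x u | u <- iota 0 (peval ePT (size x))])) ++ out)
      y (peval ePT (size x)) [::] [::] y2) (t (size x)).
Proof.
have [t1 H1 E1] := row_emits pred0 pred0 pred0 (fun a => ~~ rejecting a).
have [t2 H2 E2] := windows_emits (triples V).
exists (fun n => loop_factor ePT n * (t1 n + (t2 n + 2)).+1); first by pbounded_tac.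
move=> x out y y2.
apply: (@spec_ploop ePT 5 _ (size x) (t1 (size x) + (t2 (size x) + 2))
  (fun i => stage x (rev (out_rows x (flatten
    [seq @main_rows V (n_rows x) (n_wit x) x u | u <- iota 0 i])) ++ out)
    y i [::] [::] y2)) => // i Hi.
cbv beta; rewrite flatten_iotaS out_rows_cat rev_cat -catA.
apply: spec_seq (E1 _ _ _ _ _ _ (ltnW Hi) _) _.
rewrite /out_rows [map _ (main_rows _ _ _ _ _)]/= [flatten (_ :: _)]/= rev_cat -catA.
exact: spec_seq (E2 _ _ _ _ _ _ (ltnW Hi) _) (stage_next _ _ _ _ _ Hi).
Qed.

(** After the initial row the cell counter returns to [0], because the main rows are indexed from
    the start of their windows. *)
Definition reset_prog : cmd := For 7 (Push 8 true ;; Pop 7).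

Lemma reset_spec x out y u j jr y2 : u <= peval ePT (size x) ->
  spec reset_prog (stage x out y u j jr y2) (stage x out y 0 j jr y2) (peval ePT (size x) * 3 + 2).
Proof.
move=> Hu; have := @spec_for 7 (Push 8 true ;; Pop 7) (fun i => stage x out y (u - i) j jr y2) u 2.
rewrite subn0 subnn => H; apply: spec_weaken (H _ _) _.
- exact: size_nseq.
- move=> i Hi; split=> //; rewrite /stage /regs_at /=.
  have -> : u - i = (u - i.+1).+1 by lia.
  have -> : peval ePT (size x) - (u - i.+1) = (peval ePT (size x) - (u - i.+1).+1).+1 by lia.
  by [].
- by rewrite leq_add2r leq_mul2r Hu orbT.
Qed.

Definition core_prog : cmd := init_prog ;; reset_prog ;; main_prog.

Lemma core_spec : exists2 t, pbounded t & forall x out,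
  spec core_prog (stage x out x 0 [::] [::] x)
    (stage x (rev (out_rows x (core_x x)) ++ out) [::] (peval ePT (size x)) [::] [::] x) (t (size x)).
Proof.
have [t1 H1 S1] := init_advances; have [t2 H2 S2] := main_spec.
exists (fun n => t1 n + ((peval ePT n * 3 + 2) + t2 n)); first by pbounded_tac.
move=> x out; have Hs : size (items V (n_rows x) (n_wit x) x) <= peval ePT (size x).
  by rewrite size_items; apply: width_lt_PT.
apply: spec_seq (S1 _ _ _ _ _) _; first exact: Hs.
apply: spec_seq (reset_spec _ _ _ _ _ _) _; first exact: Hs.
by rewrite /core_x /core PT_E out_rows_cat rev_cat -catA; apply: S2.
Qed.

(** * Header, shared row, dummy rows and the complete encoding *)

Definition eN1 : pexp := PAdd eN (PConst 1).

Definition header_prog : cmd :=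
  ploop 5 eK (emit [:: true]) ;; emit [:: false] ;;
  ploop 5 (PMul eK eS) (emit [:: true]) ;; emit [:: false] ;;
  ploop 5 eM (emit [:: true]) ;; emit [:: false].

Definition shared_prog : cmd := ploop 5 eN1 zero_cell ;; ploop 5 eD (emit [:: true]).

Definition dummy_prog : cmd :=
  ploop 5 eD (ploop 5 eS1 (ploop 5 eN1 zero_cell ;; For 9 (emit [:: false]) ;; emit [:: true] ;;
    For 10 (emit [:: false])) ;; Push 9 true ;; Pop 10).

Definition cand_width (x : seq bool) : nat := #|letter| * (peval eN (size x)).+1.

Definition reduction (x : seq bool) : instance :=
  gadget (core_x x) (cand_width x) (peval eN (size x)) (peval eS (size x)).

Lemma dummies_E x : dummies (core_x x) (peval eN (size x)) (peval eS (size x)) = peval eD (size x).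
Proof. by rewrite /dummies size_core_x addKn. Qed.


Lemma zeros_emits ex rest (x : seq bool) : size (reg rest 4) = size x ->
  emits (ploop 5 ex zero_cell) rest (nseq (#|letter| * peval ex (size x)) false)
    (loop_factor ex (size x) * (#|letter|).+2).
Proof.
move=> H; rewrite -flatten_nseq_nseq; apply: emits_ploop => //.
by apply: emits_weaken (emits_emit _ _) _; rewrite size_nseq.
Qed.

Lemma bits_emits ex rest (x : seq bool) b : size (reg rest 4) = size x ->
  emits (ploop 5 ex (emit [:: b])) rest (nseq (peval ex (size x)) b)
    (loop_factor ex (size x) * 3).
Proof.
by move=> H; rewrite -flatten_nseq1; apply: emits_ploop => //; apply: emits_emit.
Qed.

Lemma header_emits : exists2 t, pbounded t & forall x y u ur j jr y2,
  emits header_prog (regs_at x y u ur j jr y2)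
    (enc_nat (peval eK (size x)) ++ enc_nat (peval eK (size x) * peval eS (size x)) ++
     enc_nat (peval eM (size x))) (t (size x)).
Proof.
exists (fun n => loop_factor eK n * 3 + (2 + (loop_factor (PMul eK eS) n * 3 + (2 +
  (loop_factor eM n * 3 + 2))))); first by pbounded_tac.
move=> x y u ur j jr y2; rewrite /enc_nat -!catA.
have E b rest : emits (emit [:: b]) rest [:: b] 2 := emits_emit _ _.
by do 2!(apply: emits_seq; first exact: bits_emits; apply: emits_seq; first exact: E);
  apply: emits_seq; [exact: bits_emits | exact: E].
Qed.

Lemma shared_emits : exists2 t, pbounded t & forall x y u ur j jr y2,
  emits shared_prog (regs_at x y u ur j jr y2)
    (shared_row (core_x x) (cand_width x) (peval eN (size x)) (peval eS (size x))) (t (size x)).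
Proof.
exists (fun n => loop_factor eN1 n * (#|letter|).+2 + loop_factor eD n * 3); first by pbounded_tac.
move=> x y u ur j jr y2; rewrite /shared_row dummies_E /cand_width -(addn1 (peval eN _)).
by apply: emits_seq; [exact: (zeros_emits eN1) | exact: bits_emits].
Qed.

Lemma dummy_spec : exists2 t, pbounded t & forall x out y u ur y2,
  spec dummy_prog (out :: regs_at x y u ur [::] (nseq (peval eD (size x)).-1 true) y2)
    ((rev (flatten (flatten [seq nseq (peval eS1 (size x))
       (dummy_row (core_x x) (cand_width x) (peval eN (size x)) (peval eS (size x)) j)
       | j <- iota 0 (peval eD (size x))])) ++ out) ::
     regs_at x y u ur (nseq (peval eD (size x)) true) [::] y2) (t (size x)).
Proof.
pose tr n := loop_factor eN1 n * (#|letter|).+2 + ((peval eD n * 3 + 2) + (2 + (peval eD n * 3 + 2))).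
exists (fun n => loop_factor eD n * (loop_factor eS1 n * (tr n).+1 + 2).+1).
  by rewrite /tr; pbounded_tac.
move=> x out y u ur y2; set D := peval eD (size x).
set row := dummy_row _ _ _ _.
have := @spec_ploop eD 5 (ploop 5 eS1 (ploop 5 eN1 zero_cell ;; For 9 (emit [:: false]) ;; emit [:: true] ;;
    For 10 (emit [:: false])) ;; Push 9 true ;; Pop 10) (size x) (loop_factor eS1 (size x) * (tr (size x)).+1 + 2)
  (fun i => (rev (flatten (flatten [seq nseq (peval eS1 (size x)) (row j) | j <- iota 0 i])) ++ out) ::
     regs_at x y u ur (nseq i true) (nseq (D.-1 - i) true) y2).
rewrite subn0 -/D (_ : D.-1 - D = 0); last by lia.
apply=> // i Hi.
cbv beta; rewrite flatten_iotaS flatten_cat rev_cat -catA.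
have E b rest : emits (emit [:: b]) rest [:: b] 2 := emits_emit _ _.
have R : emits (ploop 5 eS1 (ploop 5 eN1 zero_cell ;; For 9 (emit [:: false]) ;; emit [:: true] ;;
    For 10 (emit [:: false]))) (regs_at x y u ur (nseq i true) (nseq (D.-1 - i) true) y2)
    (flatten (nseq (peval eS1 (size x)) (row i))) (loop_factor eS1 (size x) * (tr (size x)).+1).
  apply: emits_ploop => //; rewrite /row /dummy_row dummies_E -/D /cand_width -(addn1 (peval eN _)).
  apply: emits_seq; first exact: (zeros_emits eN1).
  rewrite -(flatten_nseq1 false); apply: emits_seq.
    by apply: emits_for (E _ _); [exact: size_nseq | exact: ltnW].
  rewrite -(cat1s true (nseq _ _)); apply: emits_seq; first exact: E.
  rewrite -(flatten_nseq1 false); apply: emits_for (E _ _); first exact: size_nseq.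
  by rewrite -/D; lia.
apply: spec_seq (R _) _; split=> //; rewrite /regs_at /=.
have -> : D.-1 - i.+1 = (D.-1 - i).-1 by lia.
by case: (D.-1 - i).
Qed.

(** The opening push and pop only extend the list of registers to twelve, the form in which later
    states are written. The input is reversed through register 1 and copied to three places:
    register 5 bounds the loops, register 6 feeds the initial row, and register 11 is kept for
    pairing with the witness. *)
Definition prepare_prog : cmd :=
  Push 11 true ;; Pop 11 ;;
  each 5 (Push 1) ;; each 1 (fun b => Push 5 b ;; Push 6 b ;; Push 11 b) ;;
  ploop 5 ePT (Push 8 true).

Lemma prepare_spec : exists2 t, pbounded t & forall x,
  spec prepare_prog (init_state 5 x) (stage x [::] x 0 [::] [::] x) (t (size x)).
Proof.
exists (fun n => 1 + (1 + ((n * 4 + 2) + ((n * 6 + 2) + loop_factor ePT n * 2)))); first by pbounded_tac.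
move=> x; pose st l x' := [:: [::]; l; [::]; [::]; [::]; x'; x'; [::]; [::]; [::]; [::]; x'] : state.
have A : spec (each 5 (Push 1)) [:: [::]; [::]; [::]; [::]; [::]; x; [::]; [::]; [::]; [::]; [::]; [::]]
    (st (rev x) [::]) (size x * 4 + 2).
  have := @spec_for 5 (Test 5 Skip (Push 1 false ;; Pop 5) (Push 1 true ;; Pop 5))
    (fun i => [:: [::]; rev (take i x); [::]; [::]; [::]; drop i x;
                  [::]; [::]; [::]; [::]; [::]; [::]]) (size x) 3.
  rewrite take0 drop0 take_size drop_size; apply=> // i Hi.
  by rewrite (drop_nth false Hi) (take_nth false Hi) rev_rcons; split; case: (nth false x i).
have B : spec (each 1 (fun b => Push 5 b ;; Push 6 b ;; Push 11 b)) (st (rev x) [::]) (st [::] x)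
    (size x * 6 + 2).
  have := @spec_for 1 (Test 1 Skip ((Push 5 false ;; Push 6 false ;; Push 11 false) ;; Pop 1)
     ((Push 5 true ;; Push 6 true ;; Push 11 true) ;; Pop 1))
    (fun i => st (drop i (rev x)) (rev (take i (rev x)))) (size x) 5.
  rewrite take0 drop0 drop_oversize ?take_oversize ?size_rev // revK; apply=> [|i Hi]; first by [].
  have Hi' : i < size (rev x) by rewrite size_rev.
  by rewrite (drop_nth false Hi') (take_nth false Hi') rev_rcons; split; case: (nth false (rev x) i).
have C : spec (ploop 5 ePT (Push 8 true)) (st [::] x) (stage x [::] x 0 [::] [::] x)
    (loop_factor ePT (size x) * 2).
  rewrite /stage subn0.
  exact: (@spec_ploop ePT 5 (Push 8 true) (size x) 1
    (fun i => [::] :: regs_at x x [::] (nseq i true) [::] [::] x)).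
apply: spec_seq (spec_push _ _ _) _; apply: spec_seq (spec_pop _ _) _.
exact: spec_seq A (spec_seq B C).
Qed.

(** Register 10 is filled with [D] bits and shortened by one because dummy row [j] ends in
    [D - 1 - j] zeros; registers 9 and 10 hold [j] and this number. *)
Definition encode_prog : cmd :=
  prepare_prog ;; header_prog ;; core_prog ;; shared_prog ;;
  ploop 5 eD (Push 10 true) ;; Pop 10 ;; dummy_prog.

Lemma core_lt x : peval eN (size x) < size (core_x x).
Proof.
rewrite size_core_x -{1}(addn0 (peval eN _)) ltn_add2l.
have T1 : 0 < size (triples V).
  rewrite lt0n size_eq0; apply/eqP => E.
  have := mem_enum {: letter * letter * letter} (blank V, blank V, blank V).
  by rewrite -/(triples V) E.
have PT0 : 0 < peval ePT (size x) by apply: leq_ltn_trans (width_lt_PT x).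
have -> : peval eX (size x) = peval eW (size x) + size (triples V) * peval ePT (size x) by [].
by rewrite addn_gt0 muln_gt0 T1 PT0 orbT.
Qed.

Lemma core_sizes_x x : all (fun r => size r == cand_width x) (core_x x).
Proof. by rewrite /cand_width -ncells_E; apply: core_sizes. Qed.

Lemma core_has_x x : all (has id) (core_x x).
Proof. exact: core_has. Qed.

Lemma cells_le_width (x : seq bool) : peval eN (size x) <= cand_width x.
Proof.
rewrite /cand_width; have : 0 < #|letter| by apply/card_gt0P; exists (blank V).
by move: (peval eN _) #|letter| => k s; nia.
Qed.

Lemma eS_pred (x : seq bool) : (peval eS (size x)).-1 = peval eS1 (size x).
Proof. by have -> : peval eS (size x) = peval eS1 (size x) + 1 by []; rewrite addn1. Qed.

Lemma eS_gt0 (x : seq bool) : 0 < peval eS (size x).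
Proof. by have -> : peval eS (size x) = peval eS1 (size x) + 1 by []; rewrite addn1. Qed.

Lemma reduction_enc x : enc_instance (reduction x) =
  (enc_nat (peval eK (size x)) ++ enc_nat (peval eK (size x) * peval eS (size x)) ++
   enc_nat (peval eM (size x))) ++ out_rows x (core_x x) ++
  shared_row (core_x x) (cand_width x) (peval eN (size x)) (peval eS (size x)) ++
  flatten (flatten [seq nseq (peval eS1 (size x))
       (dummy_row (core_x x) (cand_width x) (peval eN (size x)) (peval eS (size x)) j)
       | j <- iota 0 (peval eD (size x))]).
Proof.
rewrite (gadget_enc (core_sizes_x x) (core_has_x x) (core_lt x) (cells_le_width x) (eS_gt0 x)).
rewrite dummies_E.
have -> : cand_width x + peval eD (size x) = peval eM (size x).
  by rewrite /cand_width -addn1.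
have copiesE rs : flatten (flatten [seq nseq (peval eS (size x)) (r ++ nseq (peval eD (size x)) false)
    | r <- rs]) = out_rows x rs.
  by rewrite /out_rows /copies; elim: rs => //= r rs IH; rewrite flatten_cat IH.
rewrite /gadget_rows dummies_E eS_pred.
by rewrite flatten_cat copiesE [flatten (_ :: _)]/= -!catA.
Qed.

Lemma encode_spec : exists2 t, pbounded t & forall x, exists rest,
  [/\ spec encode_prog (init_state 5 x)
    [:: rev (enc_instance (reduction x)), [::], [::], [::], [::], x, [::] & rest] (t (size x)),
   size rest = 5, reg rest 2 = nseq (peval eD (size x)) true,
   reg rest 3 = [::] & reg rest 4 = x].
Proof.
have [t1 H1 S1] := prepare_spec; have [t2 H2 S2] := header_emits; have [t3 H3 S3] := core_spec.
have [t4 H4 S4] := shared_emits; have [t5 H5 S5] := dummy_spec.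
exists (fun n => t1 n + (t2 n + (t3 n + (t4 n + (loop_factor eD n * 2 + (1 + t5 n)))))).
  by pbounded_tac.
move=> x; set D := peval eD (size x).
exists [:: nseq (peval ePT (size x)) true; [::]; nseq D true; [::]; x]; split=> //.
apply: spec_seq (S1 x) _.
apply: spec_seq (S2 _ _ _ _ _ _ _ _) _.
apply: spec_seq (S3 _ _) _.
apply: spec_seq (S4 _ _ _ _ _ _ _ _) _.
set out := rev _ ++ _.
have J : spec (ploop 5 eD (Push 10 true))
    (out :: regs_at x [::] (nseq (peval ePT (size x)) true)
      (nseq (peval ePT (size x) - peval ePT (size x)) true) [::] [::] x)
    (out :: regs_at x [::] (nseq (peval ePT (size x)) true)
      (nseq (peval ePT (size x) - peval ePT (size x)) true) [::] (nseq D true) x)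
    (loop_factor eD (size x) * 2).
  exact: (@spec_ploop eD 5 (Push 10 true) (size x) 1
    (fun i => out :: regs_at x [::] (nseq (peval ePT (size x)) true)
    (nseq (peval ePT (size x) - peval ePT (size x)) true) [::] (nseq i true) x)).
rewrite subnn in J *; apply: spec_seq J _.
apply: (spec_seq (st1 := out :: regs_at x [::] (nseq (peval ePT (size x)) true) [::] [::] (nseq D.-1 true) x)).
  by split=> //; rewrite /regs_at /=; case: (D).
have := S5 x out [::] (nseq (peval ePT (size x)) true) [::] x.
rewrite -/D; set rows1 := flatten _; set st1 := regs_at _ _ _ _ _ _ _.
have -> : rev rows1 ++ out = rev (enc_instance (reduction x)).
  by rewrite reduction_enc -/D -/rows1 /out !rev_cat -!catA cats0.
exact.
Qed.

End Emission.

(** * The approximation ratio *)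

Lemma INR_expn a n : INR (a ^ n) = pow (INR a) n.
Proof. by elim: n => [|n IH] //=; rewrite expnS -multE mult_INR IH. Qed.

Lemma ln_INR_expn a n : 0 < a -> ln (INR (a ^ n)) = Rmult (INR n) (ln (INR a)).
Proof.
move=> /ltP/lt_0_INR Ha; rewrite INR_expn; elim: n => [|n IH]; first by rewrite /= ln_1 Rmult_0_l.
by rewrite -tech_pow_Rmult ln_mult //; [rewrite IH S_INR; ring | exact: pow_lt].
Qed.

Lemma exponent_exists (eps : R) : Rlt 0 eps -> exists e, Rle 1 (Rmult eps (INR e)).
Proof.
move=> He; have [n Hn] := INR_unbounded (Rinv eps).
exists n; have := Rmult_lt_compat_l _ _ _ He Hn; rewrite Rinv_r; lra.
Qed.

(* s / k^(1 - eps) > 1 because k < G s and k^eps >= G. *)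
Lemma ratio_gap (eps : R) (k s G e opt deg : nat) :
  Rlt 0 eps -> Rle 1 (Rmult eps (INR e)) -> 1 < G -> 0 < s -> k < G * s -> G ^ e <= k -> s <= opt ->
  Rle (Rmult (Rpower (Rdiv 1 (INR k)) (Rminus 1 eps)) (INR opt)) (INR deg) -> 1 < deg.
Proof.
move=> He H1 HG Hs Hk HGk Hopt H; rewrite ltnNge; apply/negP => Hdeg.
have k0 : 0 < k by apply: leq_trans HGk; rewrite expn_gt0 ltnW.
have rk : Rlt 0 (INR k) by apply/lt_0_INR/ltP.
have rs : Rlt 0 (INR s) by apply/lt_0_INR/ltP.
have rG : Rlt 0 (INR G) by apply/lt_0_INR/ltP/ltnW.
have lG : Rlt 0 (ln (INR G)) by rewrite -ln_1; apply: ln_increasing; [lra | apply/(lt_INR 1)/ltP].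
have lk : Rlt (ln (INR k)) (Rplus (ln (INR G)) (ln (INR s))).
  rewrite -ln_mult // -mult_INR; apply: ln_increasing => //; exact/lt_INR/ltP.
have lkG : Rle (Rmult (INR e) (ln (INR G))) (ln (INR k)).
  rewrite -(ln_INR_expn e (ltnW HG)).
  have P : Rlt 0 (INR (G ^ e)) by apply/lt_0_INR/ltP; rewrite expn_gt0 (ltnW HG).
  have H' : Rle (INR (G ^ e)) (INR k) by exact/le_INR/leP.
  by case: H' => [H'|->]; [left; apply: ln_increasing | right].
have P0 := exp_pos (Rmult (Rminus 1 eps) (ln (Rdiv 1 (INR k)))); rewrite -/(Rpower _ _) in P0.
have Hle : Rle (Rmult (Rpower (Rdiv 1 (INR k)) (Rminus 1 eps)) (INR s)) 1.
  apply: Rle_trans (Rle_trans _ _ _ H _); last by apply/(le_INR _ 1)/leP.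
  by apply: Rmult_le_compat_l; [lra | apply/le_INR/leP].
(* In logarithms: [ln s > ln k - ln G], and [ln G <= eps * e * ln G <= eps * ln k], so
   [ln s > (1 - eps) * ln k]. *)
have : Rlt 1 (Rmult (Rpower (Rdiv 1 (INR k)) (Rminus 1 eps)) (INR s)); last lra.
rewrite -[X in Rmult _ X](exp_ln _ rs) /Rpower -exp_plus -[X in Rlt X _]exp_0.
apply: exp_increasing; rewrite /Rdiv Rmult_1_l ln_Rinv //.
have A := Rmult_le_compat_l _ _ _ (Rlt_le _ _ He) lkG.
have B := Rmult_le_compat_r _ _ _ (Rlt_le _ _ lG) H1.
lra.
Qed.

(** * The decision procedure *)

Lemma read_bits_map s : exists tl, s = map Some (read_bits s) ++ tl.
Proof.
elim: s => [|[b|] s [tl IH]] /=; [by exists [::] | by exists tl; rewrite -IH | by exists (None :: s)].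
Qed.

Section Decode.
Variables (T : eqType) (one zero : T).

(** [Some true] takes precedence over [Some false], as in [witness_sym]. The word read is therefore
    the same even for a committee that picks both letters in a cell. *)
Definition update (a : T) (acc : sym) : sym :=
  if a == one then Some true else if (a == zero) && (acc != Some true) then Some false else acc.

(* The accumulator lives in the control of the program, hence the exponential size. *)
Fixpoint read_block (ls : seq T) (acc : sym) : cmd :=
  if ls is a :: ls' then
    Pop 2 ;; Test 2 Skip (Pop 2 ;; read_block ls' acc) (Pop 2 ;; read_block ls' (update a acc))
  else if acc is Some b then Push 0 b else Skip.

Fixpoint fold_bits (ls : seq T) (bs : seq bool) (acc : sym) : sym :=
  match ls, bs with
  | a :: ls', b :: bs' => fold_bits ls' bs' (if b then update a acc else acc)
  | _, _ => acc
  end.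

Definition ocons (a : sym) (out : seq bool) : seq bool := if a is Some b then b :: out else out.

Lemma flat_read_block ls acc : flat (read_block ls acc).
Proof. by elim: ls acc => [|a ls IH] acc /=; [case: acc | rewrite !IH]. Qed.

Lemma exec_read_block ls acc bs out l u rest : size bs = size ls ->
  exec (read_block ls acc) [:: out, l, tape_code (map Some bs ++ u) & rest] =
  [:: ocons (fold_bits ls bs acc) out, l, tape_code u & rest].
Proof.
elim: ls bs acc => [|a ls IH] [|b bs] acc //=; first by case: acc.
by case=> Hs; case: b => /=; rewrite IH.
Qed.

Lemma fold_bitsE ls bs acc : one != zero -> uniq ls -> size bs = size ls ->
  fold_bits ls bs acc =
  if (acc == Some true) || nth false bs (index one ls) then Some true
  else if (acc == Some false) || nth false bs (index zero ls) then Some false else None.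
Proof.
move=> Hoz; elim: ls bs acc => [|a ls IH] [|b bs] acc //=; first by case: acc => [[]|].
case/andP=> Ha Hu [Hs]; rewrite IH // /update.
have out c : c \notin ls -> nth false bs (index c ls) = false.
  by move=> Hc; rewrite nth_default // Hs leqNgt index_mem.
case: (eqVneq a one) => [E|N1]; last case: (eqVneq a zero) => [E|N0].
- subst a; rewrite (negbTE Hoz) (out _ Ha) /= orbF.
  by case: b; rewrite /= ?orbT ?orbF //; case: acc => [[]|].
- subst a; rewrite (out _ Ha) /= !orbF.
  by case: b; rewrite /= ?orbT ?orbF //; case: acc => [[]|]; rewrite //= ?orbT; case: nth.
- by rewrite /= if_same.
Qed.

End Decode.

Section Solver.
Variables (V M : TM) (L : seq bool -> bool) (cV dV cM dM c d e : nat).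
Local Notation letter := (letter V).
Local Notation one := (bit_letter V true).
Local Notation zero := (bit_letter V false).
Local Notation rows x := (n_rows cV dV c d x).
Local Notation wl x := (n_wit c d x).
Local Notation wit x := (witness V (rows x) (wl x) x).

Definition skip_exp : pexp :=
  PMul (PConst #|letter|) (PAdd (PAdd (eT cV dV c d) (PConst 4)) (PAdd (PMul (PConst 2) PVar) (PConst 2))).

Lemma skip_expE (x : seq bool) : peval skip_exp (size x) = #|letter| * witness_at (rows x) x.
Proof. by []. Qed.

(** Rebuilds the pair of [x] and the witness in reverse in register 0, which is where and how
    [sim_prog] takes its input. The output of the first simulation is read from register 2, two bits
    per tape symbol. *)
Definition decode_prog : cmd :=
  each 11 (fun b => Push 0 b ;; Push 0 b) ;; emit [:: false; true] ;;
  ploop 5 skip_exp (Pop 2 ;; Pop 2) ;;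
  ploop 5 (eW c d) (read_block one zero (enum letter) None).

Lemma fold_block y u : size y >= #|letter| * u.+1 ->
  fold_bits one zero (enum letter) (take #|letter| (drop (#|letter| * u) y)) None = witness_sym V y u.
Proof.
move=> Hy; rewrite fold_bitsE ?enum_uniq //; last first.
  by rewrite -cardE size_takel // size_drop; move: Hy; rewrite mulnS; lia.
by rewrite /witness_sym !nth_block_count.
Qed.

Lemma decode_spec : exists2 t, pbounded t & forall x y tl l q clk y7 r7 r8 r9 r10,
  #|letter| * (witness_at (rows x) x + wl x) <= size y -> exists r,
  spec decode_prog [:: [::], l, tape_code (map Some y ++ tl), q, clk, x, y7 & [:: r7; r8; r9; r10; x]]
    [:: rev (pair_enc x (wit x y)), l, r, q, clk, x, y7 & [:: r7; r8; r9; r10; [::]]] (t (size x)).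
Proof.
exists (fun n => (n * 5 + 2) + (3 + (loop_factor skip_exp n * 3 +
  loop_factor (eW c d) n * (flat_cost (read_block one zero (enum letter) None)).+1))); first by pbounded_tac.
move=> x y tl l q clk y7 r7 r8 r9 r10 Hy.
exists (tape_code (map Some (drop (#|letter| * (witness_at (rows x) x + wl x)) y) ++ tl)).
pose dbl s := flatten [seq [:: b; b] | b <- s] : seq bool.
pose st out r y11 : state := [:: out, l, r, q, clk, x, y7 & [:: r7; r8; r9; r10; y11]].
have A r : spec (each 11 (fun b => Push 0 b ;; Push 0 b)) (st [::] r x) (st (rev (dbl x)) r [::])
    (size x * 5 + 2).
  have := @spec_for 11 (Test 11 Skip ((Push 0 false ;; Push 0 false) ;; Pop 11)
     ((Push 0 true ;; Push 0 true) ;; Pop 11))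
    (fun i => st (rev (dbl (take i x))) r (drop i x)) (size x) 4.
  rewrite take0 drop0 take_size drop_size; apply=> // i Hi.
  rewrite (drop_nth false Hi) (take_nth false Hi) -cats1 /dbl map_cat flatten_cat rev_cat.
  by split; case: (nth false x i).
have B r : spec (emit [:: false; true]) (st (rev (dbl x)) r [::]) (st (rev (pair_enc x [::])) r [::]) 3.
  by split=> //; rewrite /pair_enc cats0 rev_cat.
have C out : spec (ploop 5 skip_exp (Pop 2 ;; Pop 2)) (st out (tape_code (map Some y ++ tl)) [::])
    (st out (tape_code (map Some (drop (#|letter| * witness_at (rows x) x) y) ++ tl)) [::])
    (loop_factor skip_exp (size x) * 3).
  have := @spec_ploop skip_exp 5 (Pop 2 ;; Pop 2) (size x) 2
    (fun i => st out (tape_code (map Some (drop i y) ++ tl)) [::]).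
  rewrite drop0 skip_expE; apply=> // i Hi.
  have Hi' : i < size y by apply: leq_trans Hi _; apply: leq_trans Hy; rewrite leq_mul2l leq_addr orbT.
  by rewrite (drop_nth false Hi').
have D out : spec (ploop 5 (eW c d) (read_block one zero (enum letter) None))
    (st out (tape_code (map Some (drop (#|letter| * witness_at (rows x) x) y) ++ tl)) [::])
    (st (rev (wit x y) ++ out)
      (tape_code (map Some (drop (#|letter| * (witness_at (rows x) x + wl x)) y) ++ tl)) [::])
    (loop_factor (eW c d) (size x) * (flat_cost (read_block one zero (enum letter) None)).+1).
  have := @spec_ploop (eW c d) 5 (read_block one zero (enum letter) None) (size x)
    (flat_cost (read_block one zero (enum letter) None))
    (fun i => st (rev (pmap (witness_sym V y) (iota (witness_at (rows x) x) i)) ++ out)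
      (tape_code (map Some (drop (#|letter| * (witness_at (rows x) x + i)) y) ++ tl)) [::]).
  rewrite addn0; apply=> // i Hi.
  split; last exact/flat_costP/flat_read_block.
  have Hb : #|letter| * (witness_at (rows x) x + i).+1 <= size y.
    by apply: leq_trans Hy; rewrite leq_mul2l -addnS leq_add2l Hi orbT.
  rewrite -[X in map Some X](cat_take_drop #|letter|) map_cat -catA drop_drop.
  rewrite exec_read_block; last first.
    by rewrite -cardE size_takel // size_drop; move: Hb; rewrite mulnS; lia.
  rewrite fold_block // -addn1 iotaD pmap_cat rev_cat -catA addn1 addnS mulnS /=.
  by case: witness_sym.
rewrite pair_cat rev_cat.
exact: spec_seq (A _) (spec_seq (B _) (spec_seq (C _) (D _))).
Qed.

Definition solver : cmd :=
  encode_prog V cV dV c d e ;; sim_prog M cM dM ;; decode_prog ;; sim_prog V cV dV ;; Pop 2.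

Hypothesis V_runs : forall z, runs_within V z (polyb cV dV (size z)) [:: L z].

Local Notation inst x := (reduction V cV dV c d e x).

Hypothesis M_runs : forall x, exists2 y, nc (inst x) <= size y &
  runs_within M (enc_instance (inst x)) (polyb cM dM (size (enc_instance (inst x)))) y.

Lemma witness_fits x : #|letter| * (witness_at (rows x) x + wl x) <= nc (inst x).
Proof.
rewrite /= /cand_width; apply: leq_trans (leq_addr _ _).
rewrite leq_mul2l -ncells_E /ncells /width /witness_at /origin; apply/orP; right.
by move: (rows x) (wl x) => a b; nia.
Qed.

Lemma solver_spec : exists2 t, pbounded t & forall x, exists y,
  [/\ nc (inst x) <= size y,
    runs_within M (enc_instance (inst x)) (polyb cM dM (size (enc_instance (inst x)))) y,
    ohead (reg (exec solver (init_state 5 x)) 2) = Some (L (pair_enc x (wit x y)))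
    & cost solver (init_state 5 x) <= t (size x)].
Proof.
have [t1 H1 S1] := encode_spec V cV dV c d e.
have [t3 H3 S3] := decode_spec.
pose t2 n := sim_cost M cM dM 0 (n + t1 n).
have H2 : pbounded t2.
  by apply: pbounded_sim_cost; [exact: pbounded_const | exact: pbounded_add pbounded_id H1].
pose B n := n + (t1 n + (t2 n + t3 n)).
have HB : pbounded B by rewrite /B; pbounded_tac.
(* [B] bounds every register after the first three stages; the factor 4 is for the four registers
   that the second simulation has to clear. *)
pose t4 n := sim_cost V cV dV (4 * B n) (B n).
have H4 : pbounded t4.
  by apply: pbounded_sim_cost => //; apply: pbounded_mul HB; apply: pbounded_const.
exists (fun n => t1 n + (t2 n + (t3 n + (t4 n + 1)))); first by pbounded_tac.
move=> x; have [rest [E1 Hr _ _ Hx]] := S1 x.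
have [y Hy Hrun] := M_runs x; exists y.
set z := enc_instance (inst x) in E1 Hrun *.
have E2 := spec_sim M cM dM z [::] [::] [::] [::] [:: x, [::] & rest].
have Ho := sim_output Hrun.
move: (iter _ _ _) Ho E2 => [q [[l a] r]]; rewrite /output => Ho E2.
have [tl Etl] := read_bits_map (a :: r); rewrite Ho in Etl.
case: rest Hr Hx E1 E2 => [|r7 [|r8 [|r9 [|r10 [|r11 [|]]]]]] // _ Hx E1 E2.
rewrite /= in Hx; subst r11; rewrite /sim_regs Etl in E2.
have [r' E3] := S3 x y tl (tape_code l) (nseq q true) (nseq (size z) true) [::] r7 r8 r9 r10
  (leq_trans (witness_fits x) Hy).
set w := wit x y in E3 *.
have E4 := spec_sim V cV dV (pair_enc x w) (tape_code l) r' (nseq q true) (nseq (size z) true)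
  [:: x; [::]; r7; r8; r9; r10; [::]].
set st4 := [:: rev (pair_enc x w), _, _, _, _ & _] in E4.
have init v : size (reg (init_state 5 x) v) <= size x.
  by rewrite /init_state nth_set_nth /= nth_nil; case: eqP.
have Hz : size z <= size x + t1 (size x).
  have H0 : reg (exec (encode_prog V cV dV c d e) (init_state 5 x)) 0 = rev z by rewrite (proj1 E1).
  (* The encoding is no longer than what its printing cost allows, so its length is polynomial
     without a separate computation. *)
  rewrite -(size_rev z) -H0; apply: leq_trans (size_exec _ _ _) _.
  by apply: leq_add; [exact: init 0 | exact: (proj2 E1)].
have {}E2 := spec_weaken E2 (sim_cost_mono M cM dM (leqnn 0) Hz).
have Hst4 v : size (reg st4 v) <= B (size x).
  have E := spec_seq E1 (spec_seq E2 E3); rewrite /st4 -(proj1 E).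
  by apply: leq_trans (size_exec _ _ _) _; apply: leq_add (init v) (proj2 E).
have Ht4 := Hst4 0; rewrite /= size_rev in Ht4.
have Hs : size (tape_code l) + size r' + size (nseq q true) + size (nseq (size z) true) <= 4 * B (size x).
  rewrite (_ : 4 * _ = B (size x) + B (size x) + B (size x) + B (size x)); last first.
    by rewrite !mulSn !addnA addn0.
  exact: leq_add (leq_add (leq_add (Hst4 1) (Hst4 2)) (Hst4 3)) (Hst4 4).
have {}E4 := spec_weaken E4 (sim_cost_mono V cV dV Hs Ht4).
have E := spec_seq E1 (spec_seq E2 (spec_seq E3 (spec_seq E4 (spec_pop 2 _)))).
split=> //; last exact: (proj2 E).
rewrite (proj1 E); exact: (sim_answer (V_runs _) erefl).
Qed.

End Solver.

Lemma runs_within_mono M x t t' y : runs_within M x t y -> t <= t' -> runs_within M x t' y.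
Proof. by case=> s Hs H Ht; exists s => //; apply: leq_trans Ht. Qed.

Lemma runs_within_inj M x c d y y' : runs_within M x (polyb c d (size x)) y ->
  runs_within M x (polyb c d (size x)) y' -> y = y'.
Proof. by move=> /sim_output <- /sim_output <-. Qed.

Section Correctness.
Variables (V : TM) (L : seq bool -> bool) (cV dV c d e : nat).
Hypothesis V_runs : forall z, runs_within V z (polyb cV dV (size z)) [:: L z].
Local Notation rows x := (n_rows cV dV c d x).
Local Notation wl x := (n_wit c d x).
Local Notation inst x := (reduction V cV dV c d e x).

Lemma inst_valid x : valid_instance (inst x).
Proof.
exact: gadget_valid (core_sizes_x _ _ _ _ _ x) (core_has_x _ _ _ _ _ x) (core_lt _ _ _ _ _ x)
  (cells_le_width _ _ _ _ _ x) (eS_gt0 _ _ _ _ _ _ x).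
Qed.

(** [n_rows] exceeds the time bound of the verifier on the longest admissible pair by two: one row
    for the opening step of the diagram, one to guarantee [1 < n_rows]. *)
Lemma tableau_runs x z : size z <= 2 * size x + 2 + wl x -> runs_within V z (rows x).-1 [:: L z].
Proof.
move=> Hz; apply: runs_within_mono (V_runs z) _.
have -> : rows x = (polyb cV dV (2 * size x + 2 + wl x)).+2 by rewrite -addn2.
exact: leqW (polyb_mono _ _ Hz).
Qed.

(** The solver reads the whole committee word, while [gadget_sound] speaks of its core part; the
    witness cells lie in that part. *)
Lemma witness_take x y : size y = nc (inst x) ->
  witness V (rows x) (wl x) x (take (cand_width V cV dV c d x) y) = witness V (rows x) (wl x) x y.
Proof.
move=> Hy; apply: eq_in_pmap => u; rewrite mem_iota => /andP[_ Hu].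
have Hc (a : letter V) : at_cell (take (cand_width V cV dV c d x) y) u a = at_cell y u a.
  rewrite /at_cell nth_take // /cand_width -ncells_E.
  have := index_enum_lt a; move: (index _ _) => i Hi.
  have : u < (ncells (rows x) (wl x) x).+1.
    move: Hu; rewrite /ncells /width /witness_at /origin.
    by move: (rows x) (wl x) => p q; nia.
  move=> Hu'; apply: (@leq_trans (#|letter V| * u.+1)); last by rewrite leq_mul2l Hu' orbT.
  by rewrite mulnS -addnS addnC leq_add2r.
by rewrite /witness_sym !Hc.
Qed.

(** Any accepted [w] yields a hitting set, hence an optimum of at least [s]. The ratio then lifts
    the degree of the given committee above [1], which makes its core part a hitting set, from which
    an accepted witness is read, possibly different from [w]. *)
Lemma approximation_decides eps x y : Rlt 0 eps -> Rle 1 (Rmult eps (INR e)) ->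
  size y = nc (inst x) -> #|dec_committee (nc (inst x)) y| = csize (inst x) ->
  Rle (Rmult (Rpower (Rdiv 1 (INR (csize (inst x)))) (Rminus 1 eps)) (INR (opt_jr (inst x))))
    (INR (jr_degree (inst x) (dec_committee (nc (inst x)) y))) ->
  forall w, size w <= polyb c d (size x) -> L (pair_enc x w) ->
  L (pair_enc x (witness V (rows x) (wl x) x y)).
Proof.
move=> He He1 Hy Hcard Hratio w Hw HLw.
have sizes := core_sizes_x V cV dV c d x; have nonzero := core_has_x V cV dV c d x.
have lt := core_lt V cV dV c d x; have wide := cells_le_width V cV dV c d x.
have s0 := eS_gt0 V cV dV c d e x.
have Hopt : peval (eS V cV dV c d e) (size x) <= opt_jr (inst x).
  have [h [Sh Ch Hh]] := tableau_complete (@tableau_runs x) (rows_gt1 _ _ _ _ _) Hw HLw.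
  by apply: (gadget_complete sizes nonzero lt wide s0 (h := h)) => //; rewrite ?Sh ?Ch ?/cand_width ncells_E.
have Hdeg : 1 < jr_degree (inst x) (dec_committee (nc (inst x)) y).
  set k := csize _ in Hratio.
  have X0 : 0 < peval (eX V cV dV c d) (size x).
    by move: lt; rewrite size_core_x -{1}(addn0 (peval _ _)) ltn_add2l.
  have Ek : k = peval (eN cV dV c d) (size x) +
      (peval (eX V cV dV c d) (size x) * peval (eS V cV dV c d e) (size x) + 1).
    by rewrite /k /= dummies_E.
  have Es : peval (eS V cV dV c d e) (size x) =
    (peval (eN cV dV c d) (size x) + peval (eX V cV dV c d) (size x) + 2) ^ e + 1 by [].
  (* [G] is the core size plus 2, so [k = N + X * s + 1 < G * s]. Moreover [k >= s > G ^ e] because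
     [X > 0]. *)
  apply: (@ratio_gap eps k _ (peval (eN cV dV c d) (size x) + peval (eX V cV dV c d) (size x) + 2)
    e _ _ He He1 _ s0 _ _ Hopt Hratio).
  - by rewrite addn2.
  - rewrite Ek; move: s0 X0.
    move: (peval (eN _ _ _ _) _) (peval (eX _ _ _ _ _) _) (peval (eS _ _ _ _ _ _) _) => a b s.
    by nia.
  - rewrite Ek Es; move: X0; move: (peval (eN _ _ _ _) _) (peval (eX _ _ _ _ _) _) => a b.
    by move: ((a + b + 2) ^ e) => g; nia.
have Hcard' : #|dec_committee (nc (inst x)) y| =
    peval (eN cV dV c d) (size x) + dummies (core_x V cV dV c d x)
      (peval (eN cV dV c d) (size x)) (peval (eS V cV dV c d e) (size x)).
  by rewrite Hcard.
have [Hcount Hhits] := gadget_sound sizes nonzero lt wide s0 Hy Hcard' Hdeg.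
rewrite -witness_take //.
apply: (tableau_sound (@tableau_runs x)) => //; first exact: rows_gt1.
- by rewrite ncells_E size_takel // Hy leq_addr.
- by rewrite ncells_E.
Qed.

End Correctness.

Theorem theorem5 :
  forall eps : R, Rlt 0 eps -> poly_approx_MDJR eps -> P_eq_NP.
Proof.
move=> eps He [M [cM [dM HM]]] L; split; first exact: inP_inNP.
case=> VL [c [d [[V [cV [dV HV]]] HL]]].
have [e He1] := exponent_exists He.
pose inst x := reduction V cV dV c d e x.
have HM' x : exists2 y, nc (inst x) <= size y &
    runs_within M (enc_instance (inst x)) (polyb cM dM (size (enc_instance (inst x)))) y.
  by have [y [Hr [Hs _]]] := HM (inst x) (inst_valid _ _ _ _ _ _ x); exists y; rewrite ?Hs.
have [t Ht Hsolve] := solver_spec HV HM'.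
apply: (@program_inP L (solver V M cV dV cM dM c d e) 5 2 t) => // x; have [y [_ Hr Ho Hc]] := Hsolve x => //.
(* [solver_spec] knows its [y] only as an output of [M]; by determinism it is the word [y'] that
   satisfies the approximation guarantee. *)
have [y' [Hr' [Hs [Hcard Hratio]]]] := HM (inst x) (inst_valid _ _ _ _ _ _ x).
rewrite Ho -(runs_within_inj Hr' Hr); congr Some; apply/idP/idP => [Hacc|/HL[w Hw Hacc]].
  (* Acceptance certifies itself: the decoded word is short enough to be a witness, whatever the
     quality of the committee. *)
  by apply/HL; eexists; last exact: Hacc; apply: size_witness.
exact: (approximation_decides HV He He1 Hs Hcard Hratio Hw Hacc).
Qed.
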